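(* Let $\alpha,\beta,\gamma\in\mathbb C$, let $H,K$ be integers with $K\ge1$ and $(H,K)=1$, and let $\overline H$ satisfy $\overline HH\equiv1\pmod K$. Then, as meromorphic functions of $s$, $$\begin{aligned} D_{\alpha,\beta,\gamma}\!\left(s,\frac{H}{K}\right) =\ & K^{1-3s-\alpha-\beta-\gamma}\,\mathcal G_{\alpha,\beta,\gamma}(s)\sum_{\varepsilon_1,\varepsilon_2,\varepsilon_3\in\{\pm 1\}}\varepsilon_1\varepsilon_2\varepsilon_3\,e^{\frac{\pi}{2}i(\varepsilon_1(s+\alpha)+\varepsilon_2(s+\beta)+\varepsilon_3(s+\gamma))}\\ &\times \sum_{d\mid K}\frac{1}{d^{1-2s}}\sum_{h\mid d}\frac{\mu(h)\,\tau_{-\beta-\gamma,-\alpha-\gamma,-\alpha-\beta}\left(\frac{d}{h}\right)}{h^{1-s-\alpha-\beta-\gamma}}\\ &\times\sum_{\substack{1\le a\le K/d\\ (a,K/d)=1}} e\!\left(\frac{\overline{a}}{K/d}\right) D_{-\alpha,-\beta,-\gamma}\!\left(1-s,-\varepsilon_1\varepsilon_2\varepsilon_3\frac{\overline{H}ha}{K/d} \right), \end{aligned}$$ where $\overline a$ is the inverse of $a$ modulo $K/d$, and $$\mathcal G_{\alpha,\beta,\gamma}(s)=\mathcal G(s+\alpha)\mathcal G(s+\beta)\mathcal G(s+\gamma),\qquad \mathcal G(s) = -i(2\pi )^{s-1}\Gamma(1-s).$$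
   Context: $e(x)=e^{2\pi i x}$ and $\mu$ is the Möbius function. For $a_1,a_2,a_3\in\mathbb C$, $\tau_{a_1,a_2,a_3}(n)=\sum_{xyz=n}x^{-a_1}y^{-a_2}z^{-a_3}$, the sum being over positive integers $x,y,z$. For a rational number $q$ (given by a fraction, not necessarily in lowest terms), the shifted $GL(3)$ Estermann function is $$D_{a_1,a_2,a_3}(s,q)=\sum_{n=1}^\infty\frac{\tau_{a_1,a_2,a_3}(n)\,e(nq)}{n^s}$$ for $\Re(s)$ sufficiently large, extended to all $s\in\mathbb C$ by meromorphic continuation. *)

(* Defs.v *)
(* Stdlib reals and Coquelicot's complex numbers, with MathComp's [bigop], [div]
   and [prime] for the finite arithmetic sums. MathComp is imported last so that
   [%N] delimits [nat_scope]. *)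
From Stdlib Require Import Reals ZArith QArith Qreals ClassicalEpsilon.
From Coquelicot Require Import Coquelicot.
From mathcomp Require Import all_boot.

Set Implicit Arguments.
Unset Strict Implicit.
Unset Printing Implicit Defensive.

Open Scope C_scope.

Notation "\csum_ ( i <- r ) F" := (\big[Cplus/RtoC 0]_(i <- r) F%C)
  (at level 41, F at level 41, i, r at level 60,
   format "'[' \csum_ ( i  <-  r ) '/  '  F ']'").
Notation "\csum_ ( m <= i < n | P ) F" :=
  (\big[Cplus/RtoC 0]_(m%N <= i < n%N | P%B) F%C)
  (at level 41, F at level 41, i, m, n at level 60,
   format "'[' \csum_ ( m  <=  i  <  n  |  P ) '/  '  F ']'").
Notation "\csum_ ( m <= i < n ) F" :=
  (\big[Cplus/RtoC 0]_(m%N <= i < n%N) F%C)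
  (at level 41, F at level 41, i, m, n at level 60,
   format "'[' \csum_ ( m  <=  i  <  n ) '/  '  F ']'").

Definition Cexp (z : C) : C :=
  RtoC (exp (Re z)) * (cos (Im z), sin (Im z)).

(* [x ^ w], meant for real [x > 0]. *)
Definition Rcpow (x : R) (w : C) : C := Cexp (w * RtoC (ln x)).

Definition ncpow (n : nat) (w : C) : C := Rcpow (INR n) w.

Definition e (x : R) : C := Cexp (2 * RtoC PI * Ci * RtoC x).

(* Gauss's limit: n! n^z / (z (z+1) ... (z+n)) tends to Gamma z for every z that is not
   a pole, i.e. not a nonpositive integer. *)
Definition Gamma_seq (z : C) (n : nat) : C :=
  RtoC (INR (n`!)) * ncpow n z
  / \big[Cmult/RtoC 1]_(0 <= k < n.+1) (z + RtoC (INR k)).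

Definition Gamma (z : C) : C :=
  epsilon (inhabits (RtoC 0))
    (fun l : C => filterlim (Gamma_seq z) eventually (locally l)).

Definition mu (n : nat) : Z :=
  if all (fun p => logn p n == 1)%N (primes n)
  then ((-1) ^ Z.of_nat (size (primes n)))%Z else 0%Z.

Definition tau (a1 a2 a3 : C) (n : nat) : C :=
  \csum_(1 <= x < n.+1) \csum_(1 <= y < n.+1)
    \csum_(1 <= z < n.+1 | (x * y * z == n)%N)
      (ncpow x (- a1) * ncpow y (- a2) * ncpow z (- a3)).

(* The least [x < m] with [a x = 1] modulo [m], for [a] coprime to [m]
   (it is 0 when [m = 1]). *)
Definition inv_mod (a m : nat) : nat :=
  find (fun x => a * x == 1 %[mod m])%N (iota 0 m).

(* The value at [z0] is constrained by [analytic_at], but not by [pole_at]: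
   a meromorphic function is a total function with irrelevant values at its
   poles. *)
Definition analytic_at (f : C -> C) (z0 : C) : Prop :=
  exists a : nat -> C, locally z0 (fun z => is_pseries a (z - z0) (f z)).

Definition pole_at (f : C -> C) (z0 : C) : Prop :=
  exists (m : nat) (a : nat -> C), (0 < m)%N /\ a 0%N <> 0 /\
    locally' z0 (fun z => is_pseries a (z - z0) (Cpow (z - z0) m * f z)).

Definition meromorphic (f : C -> C) : Prop :=
  forall z0 : C, analytic_at f z0 \/ pole_at f z0.

(* Equality as meromorphic functions: off a closed discrete set. *)
Definition mero_eq (f g : C -> C) : Prop :=
  forall z0 : C, locally' z0 (fun z => f z = g z).

Definition frac (a : Z) (m : nat) : Q := (inject_Z a / inject_Z (Z.of_nat m))%Q.

Definition estermann_term (a1 a2 a3 s : C) (q : Q) (n : nat) : C :=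
  tau a1 a2 a3 n * e (INR n * Q2R q) / ncpow n s.

Definition is_estermann (a1 a2 a3 : C) (q : Q) (F : C -> C) : Prop :=
  meromorphic F /\
  exists sigma : R, forall s : C, (sigma < Re s)%R ->
    is_series (fun n => estermann_term a1 a2 a3 s q n.+1) (F s).

(* The meromorphic continuation; it is unique outside its poles. *)
Definition Estermann (a1 a2 a3 s : C) (q : Q) : C :=
  epsilon (inhabits (fun _ : C => RtoC 0)) (is_estermann a1 a2 a3 q) s.

Definition calG (s : C) : C :=
  - Ci * Rcpow (2 * PI) (s - 1) * Gamma (1 - s).

Definition calG3 (al be ga s : C) : C :=
  calG (s + al) * calG (s + be) * calG (s + ga).

Definition signs : seq Z := [:: 1%Z; (-1)%Z].

(* Main.v *)
From HB Require Import structures.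
From mathcomp Require Import all_boot zify_ssreflect.
From Stdlib Require Import Reals ZArith Lra Lia ClassicalEpsilon FunctionalExtensionality.
From Coquelicot Require Import Coquelicot.
From Stdlib Require QArith Qreals.
From mathcomp Require Import ssrnat.
Require Import Defs.

(** Fix [K] and a numerator [h]. Finite Fourier analysis modulo [K] in each of the three
    variables writes [e(hxyz/K)] as [K^(-3)] times a combination of the products [e(j1
    x/K) e(j2 y/K) e(j3 z/K)], the coefficients being the complete sums [csum3 K h]
    ([csum3_fourier]). Hence the Estermann function is a finite combination [fourier_comb]
    of products of three periodic zeta functions [sum_n e(jn/K) n^(-s)]
    ([fourier_comb_series], [Estermann_fourier_comb]). These continue to the plane and
    satisfy Hurwitz's functional equation ([perz_ex]); this gives the continuation of the
    Estermann function for every numerator, and the functional equation of each factor may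
    be inserted in [fourier_comb] ([fourier_comb_left]).

    For [Re s] very negative the result is, for every choice of signs [e1, e2, e3], again
    a Dirichlet series in [1 - s] ([dual_sum_series]), whose [N]-th coefficient is a sum
    over [lmn = N] of powers of [l, m, n] times [csum3 K h (e1 l) (e2 m) (e3 n)]. The
    signs are moved into [h] ([csum3_units]), and summing over one variable turns [csum3]
    into [K] times a sum [hyp K (R l) m n] over a hyperbola [yz = R l] modulo [K], with [R
    h = -1] ([csum3_hyp]). Grouping the points of the hyperbola according to [gcd(y, K)]
    pulls a common divisor out of [l] and [n] ([hyp_gcd]); since [csum3] is symmetric in
    its frequencies this implies Selberg's identity ([hyp_selberg]), and using both one
    arrives at Kloosterman sums [hyp (K/d) 1 1 (R N/d^2)] with [d | K] ([hyp_levels]). The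
    multiplicity of [d] is the number of [g | d] satisfying four divisibility conditions;
    Moebius inversion writes it as a sum over [h u v w = d] of [mu(h)] with one
    divisibility condition on each of [l, m, n] ([mu_count]). The sum over [u, v, w] then
    produces [tau (d/h)], the sum over [l, m, n] produces [tau (N/(d^2 h))]
    ([coef_identity]), and the Kloosterman sum is the sum over [a] in the statement. So
    both sides agree in a left half-plane ([far_left_dual_side]), and by the identity
    theorem they agree as meromorphic functions.

    The functional equation of the periodic zeta function is proved without contour
    integrals, by a discrete form of Lipschitz's formula. Let [z = e(x)] with [0 < x < 1],
    and [w = 1 - s] with [1 < Re w < 2]. Multiplying by [(1 - z)^2] replaces [M^(-s)] by
    its second difference, and the new series [A2] converges for [Re s > -1]. Let [u_n =
    e((x + n)/N)] be the [N]-th roots of [z]. The sum [(1 - z)^2 sum_n (1 - u_n)^(-w)] is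
    evaluated in two ways. On the one hand it is [sum_n ((1 - u_n^N)/(1 - u_n))^2 (1 -
    u_n)^(2-w)], which is expanded by the binomial series on the unit circle; summing over
    [n] keeps only the exponents divisible by [N] ([lipschitz_discrete]), and after
    multiplication by [N^(-w)] the coefficients tend to second differences of [M^(w-1)]
    divided by [Gamma w] ([bstep_lim]), because of Gauss's limit for Gamma. On the other
    hand [N (1 - u_n)] tends to [-2 pi i (x + n)], and at the other end of the range [N (1
    - u_(N-1-n))] tends to [2 pi i (1 - x + n)], which gives the two Hurwitz zeta series
    ([lipschitz_sum_lim]). For [Re s < 0] the functional equation then serves as
    definition, and the definitions agree in the strip [-1 < Re s < 0] ([fe_strip]). When
    [K | j] the function is the Riemann zeta function, obtained from the alternating one
    ([perz_trivial]).

    Functions of a complex variable are handled through power series with a bounded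
    majorant ([nps]), which form a Banach algebra; analyticity of every limit comes from
    [nps_sum]. Meromorphy is used in the form [wm], which ignores the value at the point
    itself, so that it is stable under products and quotients; [normalized_meromorphic]
    recovers a meromorphic function by filling in removable singularities. *)

Set Implicit Arguments.
Unset Strict Implicit.
Unset Printing Implicit Defensive.

Open Scope C_scope.

(** * Monoid laws for the operations on real and complex numbers *)

Lemma Rplus_assoc' : associative Rplus. Proof. by move=> x y z; lra. Qed.
Lemma Rmult_assoc' : associative Rmult. Proof. by move=> x y z; lra. Qed.
Lemma Cmult_0_l' : left_zero (RtoC 0) Cmult. Proof. by move=> x; ring. Qed.
Lemma Cmult_0_r' : right_zero (RtoC 0) Cmult. Proof. by move=> x; ring. Qed.
Lemma Cmult_dl : left_distributive Cmult Cplus. Proof. by move=> x y z; ring. Qed.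
Lemma Cmult_dr : right_distributive Cmult Cplus. Proof. by move=> x y z; ring. Qed.
Lemma Rmult_dl : left_distributive Rmult Rplus. Proof. by move=> x y z; ring. Qed.
Lemma Rmult_dr : right_distributive Rmult Rplus. Proof. by move=> x y z; ring. Qed.

HB.instance Definition _ :=
  Monoid.isComLaw.Build C (RtoC 0) Cplus Cplus_assoc Cplus_comm Cplus_0_l.
HB.instance Definition _ :=
  Monoid.isComLaw.Build C (RtoC 1) Cmult Cmult_assoc Cmult_comm Cmult_1_l.
HB.instance Definition _ := Monoid.isMulLaw.Build C (RtoC 0) Cmult Cmult_0_l' Cmult_0_r'.
HB.instance Definition _ := Monoid.isAddLaw.Build C Cmult Cplus Cmult_dl Cmult_dr.
HB.instance Definition _ :=
  Monoid.isComLaw.Build R 0%R Rplus Rplus_assoc' Rplus_comm Rplus_0_l.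
HB.instance Definition _ :=
  Monoid.isComLaw.Build R 1%R Rmult Rmult_assoc' Rmult_comm Rmult_1_l.
HB.instance Definition _ := Monoid.isMulLaw.Build R 0%R Rmult Rmult_0_l Rmult_0_r.
HB.instance Definition _ := Monoid.isAddLaw.Build R Rmult Rplus Rmult_dl Rmult_dr.

Notation "\rsum_ ( m <= i < n ) F" :=
  (\big[Rplus/0%R]_(m%N <= i < n%N) F%R)
  (at level 41, F at level 41, i, m, n at level 60,
   format "'[' \rsum_ ( m  <=  i  <  n ) '/  '  F ']'").
(** * Finite sums *)

Lemma Cmult_reg_l (a b c : C) : a <> 0 -> a * b = a * c -> b = c.
Proof. by move=> h E; rewrite -(Cmult_1_l b) -(Cinv_l a h) -Cmult_assoc E; field. Qed.

Lemma Cinv_neq0 (z : C) : z <> 0 -> / z <> 0.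
Proof.
move=> h h2; have := Cinv_r z h; rewrite h2 Cmult_0_r => /esym; exact: C1_nz.
Qed.

Lemma Csub_diag (z : C) : z - z = 0. Proof. by ring. Qed.
Lemma Csub_0_l (z : C) : 0 - z = - z. Proof. by ring. Qed.
Lemma Csub_0_r (z : C) : z - 0 = z. Proof. by ring. Qed.

Lemma csum_recr n (F : nat -> C) : \csum_(0 <= i < n.+1) F i = \csum_(0 <= i < n) F i + F n.
Proof. by rewrite big_nat_recr. Qed.
Lemma csum_recl n (F : nat -> C) : \csum_(0 <= i < n.+1) F i = F 0%N + \csum_(0 <= i < n) F i.+1.
Proof. by rewrite big_nat_recl. Qed.
Lemma rsum_recr n (F : nat -> R) :
  \rsum_(0 <= i < n.+1) F i = ((\rsum_(0 <= i < n) F i) + F n)%R.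
Proof. by rewrite big_nat_recr. Qed.
Lemma rsum_recl n (F : nat -> R) :
  \rsum_(0 <= i < n.+1) F i = (F 0%N + \rsum_(0 <= i < n) F i.+1)%R.
Proof. by rewrite big_nat_recl. Qed.
Lemma cprod_recr n (F : nat -> C) :
  \big[Cmult/RtoC 1]_(0 <= i < n.+1) F i = \big[Cmult/RtoC 1]_(0 <= i < n) F i * F n.
Proof. by rewrite big_nat_recr. Qed.
Lemma cprod_recl n (F : nat -> C) :
  \big[Cmult/RtoC 1]_(0 <= i < n.+1) F i = F 0%N * \big[Cmult/RtoC 1]_(0 <= i < n) F i.+1.
Proof. by rewrite big_nat_recl. Qed.

Lemma big_nat_shift T (idx : T) (op : T -> T -> T) k n (F : nat -> T) :
  \big[op/idx]_(k <= i < n + k) F i = \big[op/idx]_(0 <= i < n) F (i + k)%N.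
Proof. by rewrite -{1}(add0n k) big_addn addnK. Qed.

Lemma Cmod_csum I (r : seq I) (P : pred I) (F : I -> C) :
  (Cmod (\big[Cplus/RtoC 0]_(i <- r | P i) F i)
   <= \big[Rplus/0%R]_(i <- r | P i) Cmod (F i))%R.
Proof.
elim/big_rec2: _ => [|i x y _ Hxy]; first by rewrite Cmod_0; lra.
by apply: Rle_trans (Cmod_triangle _ _) _; lra.
Qed.

Lemma rsum_le I (r : seq I) (P : pred I) (F G : I -> R) :
  (forall i, P i -> (F i <= G i)%R) ->
  (\big[Rplus/0%R]_(i <- r | P i) F i <= \big[Rplus/0%R]_(i <- r | P i) G i)%R.
Proof.
move=> H; elim/big_rec2: _ => [|i x y Pi Hxy]; first by lra.
by have := H i Pi; lra.
Qed.

Lemma rsum_ge0 I (r : seq I) (P : pred I) (F : I -> R) :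
  (forall i, P i -> (0 <= F i)%R) -> (0 <= \big[Rplus/0%R]_(i <- r | P i) F i)%R.
Proof.
move=> H; elim/big_rec: _ => [|i x Pi Hx]; first by lra.
by have := H i Pi; lra.
Qed.

Lemma rsum_nat_le m n (F G : nat -> R) :
  (forall i, (m <= i < n)%N -> (F i <= G i)%R) ->
  (\rsum_(m <= i < n) F i <= \rsum_(m <= i < n) G i)%R.
Proof. by move=> H; rewrite !big_nat; apply: rsum_le. Qed.

Lemma rsum_mono m n n' (F : nat -> R) : (forall i, (0 <= F i)%R) -> (n <= n')%N ->
  (\rsum_(m <= i < n) F i <= \rsum_(m <= i < n') F i)%R.
Proof.
move=> H Hn; case: (leqP m n) => Hm.
  rewrite (big_cat_nat Hm Hn) /=.
  have := @rsum_ge0 _ (index_iota n n') xpredT F (fun i _ => H i); lra.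
by rewrite big_geq; [apply: rsum_ge0 | lia].
Qed.

Lemma rsum_const n (c : R) : \rsum_(0 <= i < n) c = (INR n * c)%R.
Proof.
elim: n => [|n IH]; first by rewrite big_geq //=; lra.
by rewrite big_nat_recr // IH S_INR /=; lra.
Qed.

Lemma csum_const n (c : C) : \csum_(0 <= i < n) c = RtoC (INR n) * c.
Proof.
elim: n => [|n IH]; first by rewrite big_geq //=; ring.
by rewrite big_nat_recr // IH S_INR RtoC_plus /=; ring.
Qed.

Lemma csum_mull I (r : seq I) (P : pred I) (F : I -> C) c :
  c * \big[Cplus/RtoC 0]_(i <- r | P i) F i = \big[Cplus/RtoC 0]_(i <- r | P i) (c * F i).
Proof. by rewrite big_distrr. Qed.

Lemma csum_mulr I (r : seq I) (P : pred I) (F : I -> C) c :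
  \big[Cplus/RtoC 0]_(i <- r | P i) F i * c = \big[Cplus/RtoC 0]_(i <- r | P i) (F i * c).
Proof. by rewrite big_distrl. Qed.

Lemma rsum_mull I (r : seq I) (P : pred I) (F : I -> R) (c : R) :
  (c * \big[Rplus/0%R]_(i <- r | P i) F i)%R = \big[Rplus/0%R]_(i <- r | P i) (c * F i)%R.
Proof. by rewrite big_distrr. Qed.

Lemma rsum_mulr I (r : seq I) (P : pred I) (F : I -> R) (c : R) :
  (\big[Rplus/0%R]_(i <- r | P i) F i * c)%R = \big[Rplus/0%R]_(i <- r | P i) (F i * c)%R.
Proof. by rewrite big_distrl. Qed.

Lemma csum_sub I (r : seq I) (P : pred I) (F G : I -> C) :
  \big[Cplus/RtoC 0]_(i <- r | P i) F i - \big[Cplus/RtoC 0]_(i <- r | P i) G i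
  = \big[Cplus/RtoC 0]_(i <- r | P i) (F i - G i).
Proof.
elim/big_rec3: _ => [|i x y z _ <-]; first by ring.
by ring.
Qed.

Lemma rsum_RtoC I (r : seq I) (P : pred I) (F : I -> R) :
  RtoC (\big[Rplus/0%R]_(i <- r | P i) F i) = \big[Cplus/RtoC 0]_(i <- r | P i) RtoC (F i).
Proof. by elim/big_rec2: _ => [|i x y _ <-] //; rewrite RtoC_plus. Qed.

Lemma sum_n_big (a : nat -> C) n :
  sum_n (a : nat -> C_NormedModule) n = \csum_(0 <= k < n.+1) a k.
Proof.
elim: n => [|n IH]; first by rewrite sum_O big_nat1.
by rewrite sum_Sn IH [RHS]big_nat_recr.
Qed.

Lemma sum_n_bigR (a : nat -> R) n : sum_n a n = \rsum_(0 <= k < n.+1) a k.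
Proof.
elim: n => [|n IH]; first by rewrite sum_O big_nat1.
by rewrite sum_Sn IH [RHS]big_nat_recr.
Qed.

(** * Limits and series of complex numbers *)

(** The limit as a real limit of the distance, so that the theory of real sequences
    applies; [Clim_filterlim] relates it to filters. *)
Definition Clim (u : nat -> C) (l : C) := is_lim_seq (fun n => Cmod (u n - l)) 0%R.

Lemma Clim_eps u l : Clim u l <->
  forall eps, (0 < eps)%R -> exists N, forall n, (N <= n)%N -> (Cmod (u n - l) < eps)%R.
Proof.
split.
  move=> /is_lim_seq_spec H eps He; have [N HN] := H (mkposreal _ He).
  exists N => n Hn; have := HN n ltac:(apply/leP; exact: Hn).
  by rewrite /= Rminus_0_r Rabs_pos_eq //; apply: Cmod_ge_0.
move=> H; apply/is_lim_seq_spec => eps; have [N HN] := H _ (cond_pos eps).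
exists N => n /leP Hn; rewrite Rminus_0_r Rabs_pos_eq; [exact: HN | exact: Cmod_ge_0].
Qed.

Lemma Clim_dom u l (v : nat -> R) : is_lim_seq v 0%R ->
  (exists N, forall n, (N <= n)%N -> (Cmod (u n - l) <= v n)%R) -> Clim u l.
Proof.
move=> Hv [N HN]; apply: (is_lim_seq_le_le_loc (fun=> 0%R) _ v) => //.
  by exists N => n /leP Hn; split; [exact: Cmod_ge_0 | exact: HN].
exact: is_lim_seq_const.
Qed.

Lemma Clim_ext_loc u v l : (exists N, forall n, (N <= n)%N -> u n = v n) -> Clim u l -> Clim v l.
Proof.
move=> [N HN] H; apply: (Clim_dom H); exists N => n Hn.
by rewrite -HN //; lra.
Qed.

Lemma Clim_ext u v l : (forall n, u n = v n) -> Clim u l -> Clim v l.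
Proof. by move=> H; apply: Clim_ext_loc; exists 0%N. Qed.

Lemma Clim_const l : Clim (fun=> l) l.
Proof.
apply: (is_lim_seq_ext (fun=> 0%R)); last exact: is_lim_seq_const.
by move=> n; rewrite (_ : l - l = 0) ?Cmod_0 //; ring.
Qed.

Lemma Clim_add u v l m : Clim u l -> Clim v m -> Clim (fun n => u n + v n) (l + m).
Proof.
move=> Hu Hv; have := is_lim_seq_plus' _ _ _ _ Hu Hv; rewrite Rplus_0_l => H.
apply: (Clim_dom H); exists 0%N => n _.
by rewrite (_ : _ - _ = (u n - l) + (v n - m)); [exact: Cmod_triangle | ring].
Qed.

Lemma Clim_mul u v l m : Clim u l -> Clim v m -> Clim (fun n => u n * v n) (l * m).
Proof.
move=> Hu Hv.
have H1 := is_lim_seq_mult' _ _ _ _ Hu Hv.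
have H2 := is_lim_seq_scal_r _ (Cmod m) _ Hu.
have H3 := is_lim_seq_scal_l _ (Cmod l) _ Hv.
move: H2 H3; rewrite /Rbar_mult /= => H2 H3.
have := is_lim_seq_plus' _ _ _ _ (is_lim_seq_plus' _ _ _ _ H1 H2) H3.
rewrite !Rmult_0_l Rmult_0_r !Rplus_0_r => H; apply: (Clim_dom H); exists 0%N => n _.
rewrite (_ : _ - _ = (u n - l) * (v n - m) + (u n - l) * m + l * (v n - m)); last by ring.
by rewrite -!Cmod_mult; apply: Rle_trans (Cmod_triangle _ _) _;
   apply: Rplus_le_compat_r; apply: Cmod_triangle.
Qed.

Lemma Clim_scal c u l : Clim u l -> Clim (fun n => c * u n) (c * l).
Proof. exact: Clim_mul (Clim_const c). Qed.

Lemma Clim_opp u l : Clim u l -> Clim (fun n => - u n) (- l).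
Proof.
move=> H; apply: is_lim_seq_ext H => n.
by rewrite -Cmod_opp; congr Cmod; ring.
Qed.

Lemma Clim_sub u v l m : Clim u l -> Clim v m -> Clim (fun n => u n - v n) (l - m).
Proof. by move=> Hu Hv; apply: Clim_add Hu (Clim_opp Hv). Qed.

Lemma Clim_shift u l : Clim (fun n => u n.+1) l <-> Clim u l.
Proof. by symmetry; apply: is_lim_seq_incr_1. Qed.

Lemma Clim_subseq u l (phi : nat -> nat) : (forall n, (n <= phi n)%N) -> Clim u l ->
  Clim (fun n => u (phi n)) l.
Proof.
move=> Hphi /Clim_eps H; apply/Clim_eps => eps /H [N HN]; exists N => n Hn.
by apply: HN; apply: leq_trans (Hphi n).
Qed.

Lemma Clim_uniq u l m : Clim u l -> Clim u m -> l = m.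
Proof.
move=> Hl Hm; have := Clim_sub Hl Hm; rewrite /Clim => H.
have H' : is_lim_seq (fun n => Cmod (l - m)) 0%R.
  apply: is_lim_seq_ext H => n; rewrite -Cmod_opp; congr Cmod; ring.
have := is_lim_seq_unique _ _ H'; rewrite Lim_seq_const => -[] /Cmod_eq_0 H0.
have -> : l = (l - m) + m by ring.
by rewrite H0; ring.
Qed.

Lemma Clim_le u l M : (exists N, forall n, (N <= n)%N -> (Cmod (u n) <= M)%R) -> Clim u l ->
  (Cmod l <= M)%R.
Proof.
move=> [N HN] /Clim_eps H; apply: Rle_plus_epsilon => eps He.
have [N' HN'] := H _ He; have /HN : (N <= maxn N N')%N by lia.
have := HN' (maxn N N') ltac:(lia).
set w := u _ => h1 h2.
have := Cmod_triangle w (- (w - l)); rewrite Cmod_opp (_ : w + - (w - l) = l); last by ring.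
by lra.
Qed.

Lemma Clim_mod u l : Clim u l -> is_lim_seq (fun n => Cmod (u n)) (Cmod l).
Proof.
move=> H; apply/is_lim_seq_spec => eps.
have [N HN] := (Clim_eps u l).1 H _ (cond_pos eps).
exists N => n /leP /HN Hn; apply: Rle_lt_trans Hn.
have h1 := Cmod_triangle (u n - l) l; have h2 := Cmod_triangle (- (u n - l)) (u n).
have e1 : u n - l + l = u n by ring.
have e2 : - (u n - l) + u n = l by ring.
by move: h1 h2; rewrite Cmod_opp e1 e2 => h1 h2; apply: Rabs_le; lra.
Qed.

Lemma Clim_bounded u l : Clim u l -> exists M, forall n, (Cmod (u n) <= M)%R.
Proof.
move=> /Clim_mod H.
have [M HM] : exists M, forall n, (Rabs (Cmod (u n)) <= M)%R.
  have [|M [_ HM]] := maj_by_pos (fun n => Cmod (u n)); last by exists M.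
  by exists (Cmod l); apply/is_lim_seq_Reals.
by exists M => n; have := HM n; rewrite Rabs_pos_eq //; exact: Cmod_ge_0.
Qed.

Lemma Clim_inv u (l : C) : l <> 0 -> Clim u l -> Clim (fun n => / u n) (/ l).
Proof.
move=> Hl Hu.
have Hl0 : (0 < Cmod l)%R := proj1 (Cmod_gt_0 l) Hl.
have [N HN] := (Clim_eps u l).1 Hu (Cmod l / 2)%R ltac:(lra).
have Hlow n : (N <= n)%N -> (Cmod l / 2 <= Cmod (u n))%R.
  move=> /HN h; have := Cmod_triangle (- (u n - l)) (u n).
  by rewrite Cmod_opp (_ : - (u n - l) + u n = l); [lra | ring].
have := is_lim_seq_scal_r _ (/ Cmod l * / (Cmod l / 2))%R _ Hu.
rewrite /= Rmult_0_l => H; apply: (Clim_dom H); exists N => n Hn.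
have Hlo := Hlow n Hn.
have Hu0 : u n <> 0 by apply: (proj2 (Cmod_gt_0 (u n))); lra.
rewrite (_ : / u n - / l = - ((u n - l) * (/ l * / u n))); last by field; split.
rewrite Cmod_opp !Cmod_mult !Cmod_inv //.
apply: Rmult_le_compat_l; first exact: Cmod_ge_0.
apply: Rmult_le_compat_l; first by left; apply: Rinv_0_lt_compat.
by apply: Rinv_le_contravar; lra.
Qed.

Lemma Clim_csum I (r : seq I) (P : pred I) (u : I -> nat -> C) (l : I -> C) :
  (forall i, P i -> Clim (u i) (l i)) ->
  Clim (fun n => \big[Cplus/RtoC 0]_(i <- r | P i) u i n) (\big[Cplus/RtoC 0]_(i <- r | P i) l i).
Proof.
move=> H; elim: r => [|i r IH].
  by apply: Clim_ext (Clim_const _) => n; rewrite !big_nil.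
rewrite big_cons; case: ifP => Pi.
  by apply: Clim_ext (Clim_add (H i Pi) IH) => n; rewrite big_cons Pi.
by apply: Clim_ext IH => n; rewrite big_cons Pi.
Qed.

Lemma Clim_re u l : Clim u l -> is_lim_seq (fun n => Re (u n)) (Re l).
Proof.
move=> /Clim_eps H; apply/is_lim_seq_spec => eps; have [N HN] := H _ (cond_pos eps).
exists N => n /leP /HN h; apply: Rle_lt_trans h.
exact: (re_le_Cmod (u n - l)).
Qed.

Lemma im_le_Cmod (c : C) : (Rabs (Im c) <= Cmod c)%R.
Proof. exact: Rle_trans (Rmax_r _ _) (Rmax_Cmod c). Qed.

Lemma Cmod_le_re_im (c : C) : (Cmod c <= Rabs (Re c) + Rabs (Im c))%R.
Proof.
case: c => x y /=.
rewrite -{1}[(x, y)](_ : RtoC x + Ci * RtoC y = (x, y)); last first.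
  by rewrite /Ci /RtoC /Cplus /Cmult /=; congr pair; ring.
apply: Rle_trans (Cmod_triangle _ _) _.
by rewrite Cmod_mult Cmod_Ci !Cmod_R; lra.
Qed.

Lemma Clim_im u l : Clim u l -> is_lim_seq (fun n => Im (u n)) (Im l).
Proof.
move=> /Clim_eps H; apply/is_lim_seq_spec => eps; have [N HN] := H _ (cond_pos eps).
exists N => n /leP /HN h; apply: Rle_lt_trans h.
exact: (im_le_Cmod (u n - l)).
Qed.

Lemma Clim_reim u l : is_lim_seq (fun n => Re (u n)) (Re l) -> is_lim_seq (fun n => Im (u n)) (Im l) ->
  Clim u l.
Proof.
move=> H1 H2.
have h (v : nat -> R) (x : R) : is_lim_seq v x -> is_lim_seq (fun n => Rabs (v n - x)) 0%R.
  move=> hv; have := is_lim_seq_minus' _ _ _ _ hv (is_lim_seq_const x).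
  by rewrite Rminus_diag => /is_lim_seq_abs_0.
have := is_lim_seq_plus' _ _ _ _ (h _ _ H1) (h _ _ H2); rewrite Rplus_0_r => H.
by apply: (Clim_dom H); exists 0%N => n _; exact: Cmod_le_re_im.
Qed.

Lemma Clim_RtoC (u : nat -> R) (l : R) : is_lim_seq u l -> Clim (fun n => RtoC (u n)) (RtoC l).
Proof. by move=> H; apply: Clim_reim => //=; exact: is_lim_seq_const. Qed.

Definition Csum (a : nat -> C) (l : C) := Clim (fun n => \csum_(0 <= k < n) a k) l.
(** Absolute convergence, with an explicit bound: the bounds are the norms of the
    Banach algebra of power series. *)
Definition asum (a : nat -> C) (M : R) := forall n, (\rsum_(0 <= k < n) Cmod (a k) <= M)%R.

Lemma Clim_filterlim (u : nat -> C) (l : C) :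
  Clim u l <-> filterlim u eventually (locally (l : C_UniformSpace)).
Proof.
rewrite Clim_eps; split.
  move=> H P /locally_C [eps HP].
  have [N HN] := H _ (cond_pos eps).
  by exists N => n /leP Hn; apply: HP; exact: HN.
move=> H eps He.
have [|N HN] := H (fun z : C => (Cmod (z - l) < eps)%R).
  by apply/locally_C; exists (mkposreal _ He) => y; apply.
by exists N => n /leP; exact: HN.
Qed.

Lemma is_series_Csum (a : nat -> C) (l : C) :
  is_series (a : nat -> C_NormedModule) l <-> Csum a l.
Proof.
have E : Csum a l <-> Clim (fun n => \csum_(0 <= k < n.+1) a k) l.
  by rewrite /Csum -Clim_shift.
rewrite E Clim_filterlim; split => H.
  apply: filterlim_ext H => n; exact: sum_n_big.
apply: filterlim_ext H => n; symmetry; exact: sum_n_big.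
Qed.

Lemma bounded_series (a : nat -> R) M : (forall n, (0 <= a n)%R) ->
  (forall n, (\rsum_(0 <= k < n) a k <= M)%R) -> ex_series a.
Proof.
move=> H0 HM.
suff [l Hl] : ex_finite_lim_seq (sum_n a) by exists l.
apply: (ex_finite_lim_seq_incr _ M) => n.
  by rewrite sum_Sn /plus /=; have := H0 n.+1; lra.
by rewrite sum_n_bigR; exact: HM.
Qed.

Lemma series_tail (a : nat -> R) M : (forall n, (0 <= a n)%R) ->
  (forall n, (\rsum_(0 <= k < n) a k <= M)%R) ->
  forall eps, (0 < eps)%R -> exists N, forall n m, (N <= n)%N -> (\rsum_(n <= k < m) a k <= eps)%R.
Proof.
move=> H0 HM eps He.
have /Cauchy_ex_series H := bounded_series H0 HM.
have [N HN] := H (mkposreal _ He); exists N => n m Hn.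
case: (ltnP n m) => Hm; last by rewrite big_geq //; lra.
case: m Hm => // m Hm.
have := HN n m ltac:(lia) ltac:(lia).
have -> : sum_n_m a n m = \rsum_(n <= k < m.+1) a k.
  move: Hm; rewrite ltnS => Hm; elim: m Hm => [|m IH] Hm.
    have -> : n = 0%N by lia.
    by rewrite sum_n_n big_nat1.
  case: (leqP n m) => Hnm.
    rewrite sum_n_Sm; last by lia.
    by rewrite IH // [RHS]big_nat_recr //; lia.
  have -> : n = m.+1 by lia.
  by rewrite sum_n_n big_nat1.
rewrite /norm /= /abs /= Rabs_pos_eq; first by lra.
exact: rsum_ge0.
Qed.

Lemma asum_conv a M : asum a M -> exists l, Csum a l.
Proof.
move=> HM.
have Ha : ex_series (fun n => Cmod (a n)).
  by apply: bounded_series HM => n; exact: Cmod_ge_0.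
have [l1 H1] : ex_series (fun n => Re (a n)).
  by apply: ex_series_le Ha => n; exact: re_le_Cmod.
have [l2 H2] : ex_series (fun n => Im (a n)).
  by apply: ex_series_le Ha => n; exact: im_le_Cmod.
have H1' : is_lim_seq (sum_n (fun n => Re (a n))) l1 := H1.
have H2' : is_lim_seq (sum_n (fun n => Im (a n))) l2 := H2.
exists (l1, l2); apply/Clim_shift; apply: Clim_reim => /=.
  apply: is_lim_seq_ext H1' => n; rewrite sum_n_bigR.
  by elim/big_rec2: _ => [|i x y _ ->].
apply: is_lim_seq_ext H2' => n; rewrite sum_n_bigR.
by elim/big_rec2: _ => [|i x y _ ->].
Qed.

Lemma asum_le a M l : asum a M -> Csum a l -> (Cmod l <= M)%R.
Proof.
move=> HM; apply: Clim_le; exists 0%N => n _.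
exact: Rle_trans (Cmod_csum _ _ _) (HM n).
Qed.

Lemma Csum_ext a b l : (forall n, a n = b n) -> Csum a l -> Csum b l.
Proof. by move=> H; apply: Clim_ext => n; apply: eq_bigr. Qed.

Lemma Csum_add a b l m : Csum a l -> Csum b m -> Csum (fun n => a n + b n) (l + m).
Proof. by move=> Ha Hb; apply: Clim_ext (Clim_add Ha Hb) => n; rewrite big_split. Qed.

Lemma Csum_scal c a l : Csum a l -> Csum (fun n => c * a n) (c * l).
Proof. by move=> Ha; apply: Clim_ext (Clim_scal c Ha) => n; rewrite csum_mull. Qed.

Lemma Csum_zero : Csum (fun=> RtoC 0) 0.
Proof. by apply: Clim_ext (Clim_const _) => n; rewrite big1. Qed.

Lemma Csum_csum I (r : seq I) (P : pred I) (u : I -> nat -> C) (l : I -> C) :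
  (forall i, P i -> Csum (u i) (l i)) ->
  Csum (fun n => \big[Cplus/RtoC 0]_(i <- r | P i) u i n) (\big[Cplus/RtoC 0]_(i <- r | P i) l i).
Proof.
by move=> H; apply: Clim_ext (Clim_csum r H) => n; rewrite exchange_big.
Qed.

Lemma Csum_uniq a l m : Csum a l -> Csum a m -> l = m.
Proof. exact: Clim_uniq. Qed.

Lemma Csum_shift a l : Csum (fun n => a n.+1) l <-> Csum a (a 0%N + l).
Proof.
rewrite /Csum -(Clim_shift (fun n => \csum_(0 <= k < n) a k)); split => H.
  by apply: Clim_ext (Clim_add (Clim_const (a 0%N)) H) => n; rewrite big_nat_recl.
have := Clim_add (Clim_const (- a 0%N)) H.
rewrite (_ : - a 0%N + (a 0%N + l) = l); last by ring.
by apply: Clim_ext => n; rewrite big_nat_recl //=; ring.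
Qed.

Lemma Csum_shift0 (a : nat -> C) l : a 0%N = 0 -> Csum (fun n => a n.+1) l -> Csum a l.
Proof. by move=> h H; have := (Csum_shift a l).1 H; rewrite h Cplus_0_l. Qed.

Lemma asum_ext a b M : (forall n, Cmod (a n) = Cmod (b n)) -> asum a M -> asum b M.
Proof. by move=> H Ha n; apply: Rle_trans (Ha n); apply: rsum_le => k _; rewrite H; lra. Qed.

Lemma asum_dom a (g : nat -> R) M : (forall n, (Cmod (a n) <= g n)%R) ->
  (forall n, (\rsum_(0 <= k < n) g k <= M)%R) -> asum a M.
Proof. by move=> H HM n; apply: Rle_trans (HM n); apply: rsum_le. Qed.

Lemma asum_add a b M1 M2 : asum a M1 -> asum b M2 -> asum (fun n => a n + b n) (M1 + M2).
Proof.
move=> H1 H2 n.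
apply: Rle_trans (_ : (\rsum_(0 <= k < n) (Cmod (a k) + Cmod (b k)) <= _)%R).
  by apply: rsum_le => k _; exact: Cmod_triangle.
by rewrite big_split /=; have := H1 n; have := H2 n; lra.
Qed.

Lemma asum_ge0 a M : asum a M -> (0 <= M)%R.
Proof. by move=> /(_ 0%N); rewrite big_geq. Qed.

(** Tannery's theorem, applied to Abel's limit on the unit circle and to both sides of
    the discrete Lipschitz formula. *)
Lemma tannery (a : nat -> nat -> C) (b : nat -> C) (g : nat -> R) M (l : nat -> C) L :
  (forall n, (0 <= g n)%R) -> (forall n, (\rsum_(0 <= k < n) g k <= M)%R) ->
  (exists N0, forall N k, (N0 <= N)%N -> (Cmod (a N k) <= g k)%R) ->
  (forall k, Clim (fun N => a N k) (b k)) ->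
  (forall N, Csum (a N) (l N)) -> Csum b L -> Clim l L.
Proof.
move=> Hg0 HM [N0 Hdom] Hab Hl HL; apply/Clim_eps => eps He.
have Hbg k : (Cmod (b k) <= g k)%R.
  by apply: (Clim_le _ (Hab k)); exists N0 => N /Hdom.
have [X HX] := series_tail Hg0 HM (eps := (eps / 4)%R) ltac:(lra).
have tailb (c : nat -> C) l' : (forall k, (Cmod (c k) <= g k)%R) -> Csum c l' ->
    (Cmod (l' - \csum_(0 <= k < X) c k) <= eps / 4)%R.
  move=> Hc Hcl; apply: (Clim_le _ (Clim_sub Hcl (Clim_const (\csum_(0 <= k < X) c k)))).
  exists X => n Hn; rewrite (@big_cat_nat _ _ _ X) //=.
  rewrite (_ : forall x y : C, x + y - x = y); last by move=> x y; ring.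
  apply: Rle_trans (Cmod_csum _ _ _) _; apply: Rle_trans (HX X n (leqnn _)).
  exact: rsum_le.
have [N1 HN1] := (Clim_eps _ _).1 (Clim_csum (index_iota 0 X) (fun k (_ : xpredT k) => Hab k)) (eps/4)%R ltac:(lra).
exists (maxn N0 N1) => N HN.
have h1 := tailb _ _ (fun k => Hdom N k ltac:(lia)) (Hl N).
have h2 := tailb _ _ Hbg HL.
have := HN1 N ltac:(lia).
set s1 := \csum_(0 <= k < X) _ in h1 |- *; set s2 := \csum_(0 <= k < X) _ in h2 |- *.
move=> h3; rewrite (_ : l N - L = (l N - s1) + (s1 - s2) - (L - s2)); last by ring.
have := Cmod_triangle (l N - s1 + (s1 - s2)) (- (L - s2)); rewrite Cmod_opp.
have := Cmod_triangle (l N - s1) (s1 - s2).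
by rewrite /Cminus in h1 h2 h3 *; lra.
Qed.

(** * Rearrangement of absolutely convergent multiple series *)

Lemma rsum3_box (F : nat -> nat -> nat -> R) X N : (X <= N)%N ->
  \rsum_(0 <= x < X) \rsum_(0 <= y < X) \rsum_(0 <= z < X) F x y z =
  \rsum_(0 <= x < N) \rsum_(0 <= y < N) \rsum_(0 <= z < N)
     (if (x < X)%N && (y < X)%N && (z < X)%N then F x y z else 0).
Proof.
move=> HX.
rewrite (big_nat_widen _ _ _ _ _ HX) big_mkcond /=; apply: eq_bigr => x _.
case: (ltnP x X) => Hx /=; last by rewrite big1 // => y _; rewrite big1.
rewrite (big_nat_widen _ _ _ _ _ HX) big_mkcond /=; apply: eq_bigr => y _.
case: (ltnP y X) => Hy /=; last by rewrite big1.
by rewrite (big_nat_widen _ _ _ _ _ HX) big_mkcond.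
Qed.

(** An absolutely convergent triple series may be summed along any sequence of regions
    that exhausts the octant: the difference with the sum over the cube is bounded by
    the part of the absolute series outside a smaller cube. *)
Lemma Csum3_exhaust (f : nat -> nat -> nat -> C) (P : nat -> nat -> nat -> nat -> bool) L M :
  (forall n, (\rsum_(0 <= x < n) \rsum_(0 <= y < n) \rsum_(0 <= z < n) Cmod (f x y z) <= M)%R) ->
  Clim (fun n => \csum_(0 <= x < n) \csum_(0 <= y < n) \csum_(0 <= z < n) f x y z) L ->
  (forall X, exists N0, forall N, (N0 <= N)%N ->
     forall x y z, (x < X)%N -> (y < X)%N -> (z < X)%N -> P N x y z) ->
  Clim (fun N => \csum_(0 <= x < N) \csum_(0 <= y < N) \csum_(0 <= z < N | P N x y z) f x y z) L.
Proof.
move=> HM HL HP; pose S n := \rsum_(0 <= x < n) \rsum_(0 <= y < n) \rsum_(0 <= z < n) Cmod (f x y z).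
have S_incr n : (S n <= S n.+1)%R.
  rewrite /S (rsum3_box _ (leqnSn n)); do 3 (apply: rsum_le => ? _).
  by case: ifP => _; [lra | exact: Cmod_ge_0].
have [l Hl] := ex_finite_lim_seq_incr S M S_incr HM.
have S_le n : (S n <= l)%R by apply: (is_lim_seq_incr_compare S l Hl S_incr).
have HD : Clim (fun N => \csum_(0 <= x < N) \csum_(0 <= y < N) \csum_(0 <= z < N | P N x y z) f x y z
   - \csum_(0 <= x < N) \csum_(0 <= y < N) \csum_(0 <= z < N) f x y z) 0.
  apply/Clim_eps => eps He.
  have /is_lim_seq_spec /(_ (mkposreal _ He)) [X /= HX] := Hl.
  have {}HX := HX X (le_n X).
  have [N0 HN0] := HP X; exists (maxn N0 X) => N HN.
  rewrite Csub_0_r.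
  apply: Rle_lt_trans (_ : (S N - S X < eps)%R); last first.
    have h1 := S_le N; have h2 := S_le X; move: HX; rewrite Rabs_minus_sym Rabs_pos_eq; [move=> HX; lra | lra].
  rewrite /S (rsum3_box _ (_ : X <= N)%N); last by lia.
  have cmb (u v w : R) : (u + v <= w -> u <= w - v)%R by lra.
  apply: cmb; rewrite csum_sub.
  apply: Rle_trans (Rplus_le_compat_r _ _ _ (Cmod_csum _ _ _)) _.
  rewrite -big_split /= !big_nat; apply: rsum_le => x Hx.
  rewrite csum_sub.
  apply: Rle_trans (Rplus_le_compat_r _ _ _ (Cmod_csum _ _ _)) _.
  rewrite -big_split /= !big_nat; apply: rsum_le => y Hy.
  rewrite big_mkcond csum_sub.
  apply: Rle_trans (Rplus_le_compat_r _ _ _ (Cmod_csum _ _ _)) _.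
  rewrite -big_split /= !big_nat; apply: rsum_le => z Hz.
  have := HN0 N ltac:(lia) x y z.
  have f0 := Cmod_ge_0 (f x y z).
  case: (ltnP x X) => h1; case: (ltnP y X) => h2; case: (ltnP z X) => h3 /= h;
  (try by rewrite h // Csub_diag Cmod_0; lra);
  by case: ifP => _; rewrite ?Csub_diag ?Csub_0_l ?Cmod_opp ?Cmod_0; lra.
have := Clim_add HD HL; rewrite Cplus_0_l; apply: Clim_ext => N; ring.
Qed.

(** With regions [xyz <= N] this is the product of three Dirichlet series; with a
    trivial third factor and [x + y < N] it is the Cauchy product. *)
Lemma Csum3_prod (p q r : nat -> C) P Q R Mp Mq Mr (E : nat -> nat -> nat -> nat -> bool) :
  asum p Mp -> asum q Mq -> asum r Mr -> Csum p P -> Csum q Q -> Csum r R ->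
  (forall X, exists N0, forall N, (N0 <= N)%N ->
     forall x y z, (x < X)%N -> (y < X)%N -> (z < X)%N -> E N x y z) ->
  Clim (fun N => \csum_(0 <= x < N) \csum_(0 <= y < N) \csum_(0 <= z < N | E N x y z)
                   (p x * q y * r z)) (P * Q * R).
Proof.
move=> Ap Aq Ar Hp Hq Hr HE; apply: (@Csum3_exhaust _ _ _ (Mp * Mq * Mr)%R) HE.
  move=> n.
  have -> : \rsum_(0 <= x < n) \rsum_(0 <= y < n) \rsum_(0 <= z < n) Cmod (p x * q y * r z)
    = ((\rsum_(0 <= x < n) Cmod (p x)) * (\rsum_(0 <= y < n) Cmod (q y)) * (\rsum_(0 <= z < n) Cmod (r z)))%R.
    rewrite !rsum_mulr; apply: eq_bigr => x _.
    rewrite [X in (X * _)%R]rsum_mull rsum_mulr; apply: eq_bigr => y _.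
    by rewrite rsum_mull; apply: eq_bigr => z _; rewrite !Cmod_mult.
  have pos (a : nat -> C) : (0 <= \rsum_(0 <= x < n) Cmod (a x))%R.
    by apply: rsum_ge0 => k _; exact: Cmod_ge_0.
  apply: Rmult_le_compat => //; first exact: Rmult_le_pos.
  exact: Rmult_le_compat.
apply: Clim_ext (Clim_mul (Clim_mul Hp Hq) Hr) => n.
rewrite !csum_mulr; apply: eq_bigr => x _.
rewrite [X in X * _]csum_mull csum_mulr; apply: eq_bigr => y _.
by rewrite csum_mull.
Qed.

Lemma triangle_sum T (idx : T) (op : Monoid.com_law idx) (F : nat -> nat -> T) N :
  \big[op/idx]_(0 <= k < N) \big[op/idx]_(0 <= x < k.+1) F x (k - x)%N =
  \big[op/idx]_(0 <= x < N) \big[op/idx]_(0 <= y < N | (x + y < N)%N) F x y.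
Proof.
transitivity (\big[op/idx]_(0 <= k < N) \big[op/idx]_(0 <= x < N | (x < k.+1)%N) F x (k - x)%N).
  apply: eq_big_nat => k Hk; rewrite (big_nat_widen _ _ N) //; lia.
rewrite (exchange_big_dep predT) //=; apply: eq_big_nat => x Hx.
have -> : \big[op/idx]_(0 <= y < N | (x + y < N)%N) F x y = \big[op/idx]_(0 <= y < N - x) F x y.
  rewrite [RHS](big_nat_widen _ _ N) //; last by lia.
  by apply: eq_bigl => y; rewrite /=; lia.
rewrite (big_cat_nat (n := x)) //=; last by lia.
rewrite big_nat_cond big_pred0 ?Monoid.mul1m; last by move=> k /=; lia.
rewrite -{1}(add0n x) big_addn; apply: congr_big_nat => // k Hk; first by lia.
by rewrite addnK.
Qed.

Definition cauchy (a b : nat -> C) (k : nat) : C := \csum_(0 <= x < k.+1) (a x * b (k - x)%N).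

Lemma Csum_cauchy a b A B Ma Mb : asum a Ma -> asum b Mb -> Csum a A -> Csum b B ->
  Csum (cauchy a b) (A * B).
Proof.
move=> Aa Ab Ha Hb.
pose r z := if z == 0%N then RtoC 1 else 0.
have hr n : (0 < n)%N -> \csum_(0 <= z < n) r z = 1.
  by case: n => // n _; rewrite big_nat_recl // big1 /r //=; ring.
have Hr : Csum r 1.
  by apply: Clim_ext_loc (Clim_const 1); exists 1%N => n /hr.
have Ar : asum r 1.
  case=> [|n]; first by rewrite big_geq //; lra.
  rewrite big_nat_recl // big1 /r /= ?Cmod_1 //; first by lra.
  by move=> i _; exact: Cmod_0.
have := @Csum3_prod a b r A B 1 _ _ _ (fun N x y z => (x + y < N)%N) Aa Ab Ar Ha Hb Hr.
rewrite Cmult_1_r => /(_ _) H.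
apply: Clim_ext_loc (H _); last by move=> X; exists (X + X)%N => N HN x y z; lia.
exists 1%N => N HN; rewrite [RHS](triangle_sum Cplus (fun x y => a x * b y)); apply: eq_bigr => x _.
rewrite [RHS]big_mkcond /=; apply: eq_bigr => y _.
case: ifP => _; last by rewrite big_pred0.
by rewrite -csum_mull hr // Cmult_1_r.
Qed.

Lemma asum_cauchy a b Ma Mb : asum a Ma -> asum b Mb -> asum (cauchy a b) (Ma * Mb).
Proof.
move=> Aa Ab N.
apply: Rle_trans (_ : (\rsum_(0 <= k < N) \rsum_(0 <= x < k.+1) (Cmod (a x) * Cmod (b (k - x)%N)) <= _)%R).
  apply: rsum_le => k _; apply: Rle_trans (Cmod_csum _ _ _) _.
  by apply: rsum_le => x _; rewrite Cmod_mult; lra.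
rewrite (triangle_sum Rplus (fun x y => Cmod (a x) * Cmod (b y))%R).
apply: Rle_trans (_ : ((\rsum_(0 <= x < N) Cmod (a x)) * (\rsum_(0 <= x < N) Cmod (b x)) <= _)%R).
  rewrite rsum_mulr; apply: rsum_le => x _; rewrite rsum_mull big_mkcond /=.
  apply: rsum_le => y _; case: ifP => _; first by lra.
  by apply: Rmult_le_pos; exact: Cmod_ge_0.
by apply: Rmult_le_compat (Aa N) (Ab N); apply: rsum_ge0 => k _; exact: Cmod_ge_0.
Qed.

(** * The complex exponential *)

Lemma Cexp_add z w : Cexp (z + w) = Cexp z * Cexp w.
Proof.
case: z => a b; case: w => c d; rewrite /Cexp /= exp_plus cos_plus sin_plus /RtoC /Cmult /=.
by congr pair; ring.
Qed.

Lemma Cexp_0 : Cexp 0 = 1.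
Proof. by rewrite /Cexp /= exp_0 cos_0 sin_0 /RtoC /Cmult /=; congr pair; ring. Qed.

Lemma Cmod_Cexp z : Cmod (Cexp z) = exp (Re z).
Proof.
rewrite /Cexp Cmod_mult Cmod_R Rabs_pos_eq; last by left; exact: exp_pos.
rewrite (_ : Cmod _ = 1%R); first by ring.
rewrite /Cmod /= -[RHS]sqrt_1; congr sqrt.
by have := sin2_cos2 (Im z); rewrite /Rsqr; lra.
Qed.

Lemma Cexp_neq0 z : Cexp z <> 0.
Proof. by move=> h; have := Cmod_Cexp z; rewrite h Cmod_0; have := exp_pos (Re z); lra. Qed.

Lemma Cexp_opp z : Cexp (- z) = / Cexp z.
Proof.
have h := Cexp_add (- z) z; rewrite (_ : - z + z = 0) in h; last by ring.
rewrite Cexp_0 in h.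
rewrite -[LHS]Cmult_1_r -(Cinv_r (Cexp z)); last exact: Cexp_neq0.
by rewrite Cmult_assoc -h Cmult_1_l.
Qed.

Lemma Cexp_pow z n : Cpow (Cexp z) n = Cexp (RtoC (INR n) * z).
Proof.
elim: n => [|n IH]; first by rewrite /= Cmult_0_l Cexp_0.
by rewrite Cpow_S IH -Cexp_add S_INR RtoC_plus; congr Cexp; ring.
Qed.

Lemma Cexp_RtoC x : Cexp (RtoC x) = RtoC (exp x).
Proof. by rewrite /Cexp /= cos_0 sin_0 /RtoC /Cmult /=; congr pair; ring. Qed.

Definition expc (z : C) (k : nat) : C := Cpow z k / RtoC (INR (k`!)).

Lemma INR_fact_neq0 k : INR k`! <> 0%R.
Proof. by apply: not_0_INR; have := fact_gt0 k; lia. Qed.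

Lemma INR_fact_pos k : (0 < INR k`!)%R.
Proof. by apply: lt_0_INR; have := fact_gt0 k; lia. Qed.

Lemma Cmod_expc z k : Cmod (expc z k) = (Cmod z ^ k / INR k`!)%R.
Proof.
rewrite /expc Cmod_div ?Cmod_pow ?Cmod_R ?Rabs_pos_eq //; first by left; exact: INR_fact_pos.
by move=> /RtoC_inj; exact: INR_fact_neq0.
Qed.

Lemma factE k : fact k = k`!.
Proof. by elim: k => [|k IH] //=; rewrite IH factS; lia. Qed.

Lemma exp_partial_le x n : (0 <= x)%R -> (\rsum_(0 <= k < n) (x ^ k / INR k`!) <= exp x)%R.
Proof.
move=> Hx.
have H : is_lim_seq (fun n => \rsum_(0 <= k < n) (x ^ k / INR k`!)) (exp x).
  apply/is_lim_seq_incr_1; have := exp_in; rewrite /exp.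
  case: (exist_exp x) => l /= Hl _.
  apply: is_lim_seq_ext (_ : is_lim_seq (sum_f_R0 (fun i => / INR (fact i) * x ^ i)%R) l).
    move=> m; rewrite -sum_n_Reals sum_n_bigR; apply: eq_bigr => k _.
    by rewrite factE /Rdiv Rmult_comm.
  by apply/is_lim_seq_Reals.
apply: (is_lim_seq_incr_compare _ _ H) => m.
rewrite big_nat_recr //=.
have : (0 <= x ^ m / INR m`!)%R.
  apply: Rmult_le_pos; first exact: pow_le.
  by left; apply: Rinv_0_lt_compat; exact: INR_fact_pos.
by lra.
Qed.

Lemma asum_expc z : asum (expc z) (exp (Cmod z)).
Proof.
move=> n; rewrite (eq_bigr (fun k => Cmod z ^ k / INR k`!)%R); last by move=> k _; rewrite Cmod_expc.
exact/exp_partial_le/Cmod_ge_0.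
Qed.

Lemma cauchy_expc z w k : cauchy (expc z) (expc w) k = expc (z + w) k.
Proof.
have bin n : \csum_(0 <= x < n.+1) (RtoC (INR 'C(n, x)) * (Cpow z x * Cpow w (n - x))) = Cpow (z + w) n.
  elim: n => [|n IH]; first by rewrite big_nat1 /=; ring.
  rewrite Cpow_S -IH csum_mull.
  rewrite [RHS](eq_bigr (fun i => z * (RtoC (INR 'C(n, i)) * (Cpow z i * Cpow w (n - i))) +
    w * (RtoC (INR 'C(n, i)) * (Cpow z i * Cpow w (n - i))))); last by move=> i _; ring.
  rewrite big_split /= [X in _ = X + _]big_nat_recr // [X in _ = _ + X]big_nat_recl //=.
  rewrite [LHS]big_nat_recl // [X in _ + X = _]big_nat_recr //= !bin0 !binn !subn0 !subnn.
  rewrite [X in _ + (X + _)](eq_big_nat _ _ (F2 := fun i => z * (RtoC (INR 'C(n, i)) * (Cpow z i * Cpow w (n - i))) +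
     w * (RtoC (INR 'C(n, i.+1)) * (Cpow z i.+1 * Cpow w (n - i.+1))))); last first.
    move=> i Hi; rewrite binS plus_INR RtoC_plus subSS.
    have -> : (n - i = (n - i.+1).+1)%N by lia.
    by rewrite !Cpow_S; ring.
  by rewrite big_split /=; ring.
rewrite /cauchy /expc -bin /Cdiv csum_mulr; apply: eq_big_nat => x Hx.
have hb : (k`! = 'C(k, x) * (x`! * (k - x)`!))%N by rewrite bin_fact //; lia.
rewrite hb !mult_INR !RtoC_mult.
have h1 : RtoC (INR x`!) <> 0 by move=> /RtoC_inj; exact: INR_fact_neq0.
have h2 : RtoC (INR (k - x)`!) <> 0 by move=> /RtoC_inj; exact: INR_fact_neq0.
have h3 : RtoC (INR 'C(k, x)) <> 0.
  by move=> /RtoC_inj; apply: not_0_INR; have := bin_gt0 k x; lia.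
by field; do !split.
Qed.

Lemma Csum_exp z : Csum (expc z) (Cexp z).
Proof.
have Hre x : Csum (expc (RtoC x)) (RtoC (exp x)).
  apply/Clim_shift; rewrite /exp; case: (exist_exp x) => l /= Hl.
  apply: Clim_ext (Clim_RtoC (_ : is_lim_seq (sum_f_R0 (fun i => / INR (fact i) * x ^ i)%R) l)).
    move=> m; rewrite -sum_n_Reals sum_n_bigR rsum_RtoC; apply: eq_bigr => k _.
    by rewrite factE /expc -RtoC_pow RtoC_mult RtoC_inv /Cdiv; [rewrite Cmult_comm | exact: INR_fact_neq0].
  by apply/is_lim_seq_Reals.
have him y : Csum (expc (Ci * RtoC y)) (cos y, sin y).
  have [l Hl] := asum_conv (asum_expc (Ci * RtoC y)).
  have dbl k : Cpow (Ci * RtoC y) k.*2 = RtoC ((-1) ^ k * Rsqr y ^ k).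
    rewrite -Rpow_mult_distr RtoC_pow; elim: k => [|k IH] //.
    rewrite doubleS !Cpow_S IH Cmult_assoc; congr Cmult.
    by rewrite /Rsqr /Ci /Cmult /RtoC /=; congr pair; ring.
  have ev k : expc (Ci * RtoC y) (k.*2) = RtoC ((-1) ^ k / INR (k.*2)`! * Rsqr y ^ k).
    rewrite /expc dbl -RtoC_div; last exact: INR_fact_neq0.
    by congr RtoC; rewrite /Rdiv; ring.
  have od k : expc (Ci * RtoC y) (k.*2.+1) = Ci * RtoC ((-1) ^ k / INR (k.*2.+1)`! * Rsqr y ^ k * y).
    rewrite /expc Cpow_S dbl /Cdiv -RtoC_inv; last exact: INR_fact_neq0.
    by rewrite /Rdiv !RtoC_mult; ring.
  have sp m : \csum_(0 <= k < m.*2) expc (Ci * RtoC y) k =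
     (\rsum_(0 <= k < m) ((-1) ^ k / INR (k.*2)`! * Rsqr y ^ k),
      \rsum_(0 <= k < m) ((-1) ^ k / INR (k.*2.+1)`! * Rsqr y ^ k) * y)%R.
    elim: m => [|m IH]; first by rewrite !big_geq //; rewrite /RtoC; congr pair; ring.
    rewrite doubleS !big_nat_recr // IH ev od /= /Cplus /Ci /Cmult /RtoC /=.
    by congr pair; ring.
  have Hs : Clim (fun m => \csum_(0 <= k < m.*2) expc (Ci * RtoC y) k) l.
    by apply: Clim_subseq Hl => n; lia.
  suff <- : l = (cos y, sin y) by [].
  have h1 := Clim_re Hs; have h2 := Clim_im Hs.
  have c1 : is_lim_seq (fun n => Re (\csum_(0 <= k < n.*2) expc (Ci * RtoC y) k)) (cos y).
    apply/is_lim_seq_incr_1; rewrite /cos; case: (exist_cos _) => c /= Hc.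
    apply: is_lim_seq_ext (_ : is_lim_seq (sum_f_R0 (fun i => cos_n i * Rsqr y ^ i)%R) c); last by apply/is_lim_seq_Reals.
    move=> m; rewrite -sum_n_Reals sum_n_bigR sp /=; apply: eq_bigr => k _.
    by rewrite /cos_n factE -muln2 -multE (Nat.mul_comm k).
  have c2 : is_lim_seq (fun n => Im (\csum_(0 <= k < n.*2) expc (Ci * RtoC y) k)) (sin y).
    apply/is_lim_seq_incr_1; rewrite /sin; case: (exist_sin _) => c /= Hc.
    have Hc' : is_lim_seq (sum_f_R0 (fun i => sin_n i * Rsqr y ^ i)%R) c by apply/is_lim_seq_Reals.
    have := is_lim_seq_scal_l _ y _ Hc'; rewrite /Rbar_mult /=.
    apply: is_lim_seq_ext => m; rewrite -sum_n_Reals sum_n_bigR sp /= rsum_mull.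
    apply: eq_bigr => k _.
    by rewrite /sin_n factE -muln2 -multE (Nat.mul_comm k) Nat.add_1_r; ring.
  have := is_lim_seq_unique _ _ h1; rewrite (is_lim_seq_unique _ _ c1) => -[e1].
  have := is_lim_seq_unique _ _ h2; rewrite (is_lim_seq_unique _ _ c2) => -[e2].
  by rewrite e1 e2; case: (l).
case: z => x y; rewrite /Cexp /=.
apply: Csum_ext (Csum_cauchy (asum_expc _) (asum_expc _) (Hre x) (him y)) => k.
rewrite cauchy_expc; congr expc.
by rewrite /RtoC /Ci /Cmult /Cplus /=; congr pair; ring.
Qed.

(** * Power series with a bound on their majorant *)

Lemma choice_fun S T (P : S -> T -> Prop) : (forall m, exists x, P m x) ->
  exists f, forall m, P m (f m).
Proof.
move=> H; exists (fun m => proj1_sig (constructive_indefinite_description _ (H m))) => m.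
by case: constructive_indefinite_description.
Qed.

Definition pterm (a : nat -> C) (h : C) (k : nat) : C := a k * Cpow h k.

(** [f] is the sum of a power series on the closed disc of radius [r], and [M] bounds
    the sum of the absolute values of its terms at distance [r]. For fixed [z0] and [r]
    the least such [M] is a Banach algebra norm. *)
Definition nps (f : C -> C) (z0 : C) (r M : R) := exists a,
  asum (pterm a (RtoC r)) M /\
  forall z, (Cmod (z - z0) <= r)%R -> Csum (pterm a (z - z0)) (f z).

Lemma Cmod_pterm a h k : Cmod (pterm a h k) = (Cmod (a k) * Cmod h ^ k)%R.
Proof. by rewrite Cmod_mult Cmod_pow. Qed.

Lemma Cmod_RtoC_pos r : (0 <= r)%R -> Cmod (RtoC r) = r.
Proof. by move=> h; rewrite Cmod_R Rabs_pos_eq. Qed.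

Lemma asum_pterm a h h' M : (Cmod h <= Cmod h')%R -> asum (pterm a h') M -> asum (pterm a h) M.
Proof.
move=> Hh; have H := fun k => Cmod_ge_0 (a k); have Hh0 := Cmod_ge_0 h.
move=> HM; apply: (asum_dom _ HM) => k; rewrite !Cmod_pterm.
by apply: Rmult_le_compat_l => //; apply: pow_incr.
Qed.

Lemma asum_pterm_r a h r M : (Cmod h <= r)%R -> asum (pterm a (RtoC r)) M -> asum (pterm a h) M.
Proof.
move=> Hh; apply: asum_pterm; rewrite Cmod_RtoC_pos //.
exact: Rle_trans (Cmod_ge_0 h) Hh.
Qed.

Lemma nps_weaken f z0 r M M' : (M <= M')%R -> nps f z0 r M -> nps f z0 r M'.
Proof. by move=> HM [a [Ha Hf]]; exists a; split=> // n; apply: Rle_trans (Ha n) HM. Qed.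

Lemma nps_shrink f z0 r r' M : (0 <= r' <= r)%R -> nps f z0 r M -> nps f z0 r' M.
Proof.
move=> Hr [a [Ha Hf]]; exists a; split.
  by apply: asum_pterm_r Ha; rewrite Cmod_RtoC_pos; lra.
by move=> z Hz; apply: Hf; lra.
Qed.

Lemma nps_ext f g z0 r M : (forall z, (Cmod (z - z0) <= r)%R -> f z = g z) ->
  nps f z0 r M -> nps g z0 r M.
Proof. by move=> H [a [Ha Hf]]; exists a; split=> // z Hz; rewrite -H //; exact: Hf. Qed.

Lemma nps_val f z0 r M z : (Cmod (z - z0) <= r)%R -> nps f z0 r M -> (Cmod (f z) <= M)%R.
Proof. by move=> Hz [a [Ha Hf]]; apply: asum_le (Hf z Hz); exact: asum_pterm_r Ha. Qed.

Lemma Csum_single (c : C) k0 : Csum (fun k => if k == k0 then c else 0) c.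
Proof.
apply: Clim_ext_loc (Clim_const c); exists k0.+1 => n Hn.
rewrite -big_mkcond big_nat1_eq leq0n /=.
by rewrite (_ : (k0 < n)%N = true).
Qed.

Lemma asum_single (c : C) k0 : asum (fun k => if k == k0 then c else 0) (Cmod c).
Proof.
move=> n; rewrite (eq_bigr (fun k => if k == k0 then Cmod c else 0%R)); last first.
  by move=> k _; case: ifP; rewrite ?Cmod_0.
rewrite -big_mkcond big_nat1_eq; case: ifP => _; first by lra.
exact: Cmod_ge_0.
Qed.

Lemma nps_monomial c k0 z0 r : (0 <= r)%R ->
  nps (fun z => c * Cpow (z - z0) k0) z0 r (Cmod c * r ^ k0).
Proof.
move=> Hr; have E h : (fun k => if k == k0 then c * Cpow h k0 else 0) =1
    pterm (fun k => if k == k0 then c else 0) h.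
  by move=> k; rewrite /pterm; case: eqP => [->|_] //; ring.
exists (fun k => if k == k0 then c else 0); split.
  rewrite -[X in (_ * X ^ _)%R](Cmod_RtoC_pos Hr) -Cmod_pow -Cmod_mult.
  by apply: asum_ext (asum_single _ k0) => k; rewrite E.
by move=> z _; apply: Csum_ext (E _) (Csum_single _ _).
Qed.

Lemma nps_const c z0 r : (0 <= r)%R -> nps (fun=> c) z0 r (Cmod c).
Proof.
move=> Hr; have := nps_monomial c 0 z0 Hr; rewrite Rmult_1_r.
by apply: nps_ext => z _ /=; ring.
Qed.

Lemma pterm_add a b h k : pterm a h k + pterm b h k = pterm (fun k => a k + b k) h k.
Proof. by rewrite /pterm; ring. Qed.

Lemma nps_add f g z0 r M1 M2 : nps f z0 r M1 -> nps g z0 r M2 ->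
  nps (fun z => f z + g z) z0 r (M1 + M2).
Proof.
move=> [a [Ha Hf]] [b [Hb Hg]]; exists (fun k => a k + b k); split.
  by apply: asum_ext (asum_add Ha Hb) => k; rewrite pterm_add.
by move=> z Hz; apply: Csum_ext (Csum_add (Hf z Hz) (Hg z Hz)) => k; rewrite pterm_add.
Qed.

Lemma cauchy_pterm a b h k : cauchy (pterm a h) (pterm b h) k = pterm (cauchy a b) h k.
Proof.
rewrite /cauchy /pterm csum_mulr; apply: eq_big_nat => x Hx.
have -> : Cpow h k = Cpow h x * Cpow h (k - x).
  by rewrite -Cpow_add_r; congr Cpow; lia.
by ring.
Qed.

Lemma nps_mul f g z0 r M1 M2 : nps f z0 r M1 -> nps g z0 r M2 ->
  nps (fun z => f z * g z) z0 r (M1 * M2).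
Proof.
move=> [a [Ha Hf]] [b [Hb Hg]]; exists (cauchy a b); split.
  by apply: asum_ext (asum_cauchy Ha Hb) => k; rewrite cauchy_pterm.
move=> z Hz.
apply: Csum_ext (Csum_cauchy (asum_pterm_r Hz Ha) (asum_pterm_r Hz Hb) (Hf z Hz) (Hg z Hz)) => k.
by rewrite cauchy_pterm.
Qed.

Lemma nps_scal c f z0 r M : (0 <= r)%R -> nps f z0 r M -> nps (fun z => c * f z) z0 r (Cmod c * M).
Proof. by move=> Hr; apply: nps_mul; exact: nps_const. Qed.

Lemma nps_id z0 r : (0 <= r)%R -> nps (fun z => z) z0 r (Cmod z0 + r).
Proof.
move=> Hr; have := nps_add (nps_const z0 z0 Hr) (nps_monomial 1 1 z0 Hr).
rewrite Cmod_1 Rmult_1_l pow_1.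
by apply: nps_ext => z _ /=; ring.
Qed.

Lemma nps_pow f z0 r M k : (0 <= r)%R -> nps f z0 r M -> nps (fun z => Cpow (f z) k) z0 r (M ^ k).
Proof.
move=> Hr Hf; elim: k => [|k IH] /=.
  by have := nps_const 1 z0 Hr; rewrite Cmod_1.
exact: nps_mul.
Qed.

(** Completeness of the algebra: a series of functions with summable norms is
    analytic. The coefficients are summed index by index. *)
Lemma nps_sum (f : nat -> C -> C) (g : C -> C) z0 r (M : nat -> R) L : (0 < r)%R ->
  (forall m, nps (f m) z0 r (M m)) -> (forall n, (\rsum_(0 <= m < n) M m <= L)%R) ->
  (forall z, (Cmod (z - z0) <= r)%R -> Csum (fun m => f m z) (g z)) -> nps g z0 r L.
Proof.
move=> Hr /choice_fun [a Ha] HM Hg.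
have M0 m : (0 <= M m)%R by exact: asum_ge0 (Ha m).1.
have rk j : (0 < r ^ j)%R by apply: pow_lt.
have Hterm m j : (Cmod (a m j) * r ^ j <= M m)%R.
  have := (Ha m).1 j.+1; rewrite big_nat_recr //= Cmod_pterm Cmod_RtoC_pos; last by lra.
  have : (0 <= \rsum_(0 <= i < j) Cmod (pterm (a m) (RtoC r) i))%R.
    by apply: rsum_ge0 => i _; exact: Cmod_ge_0.
  by lra.
have partial J n1 n2 : (\rsum_(0 <= j < J) (Cmod (\csum_(n1 <= m < n2) a m j) * r ^ j) <=
     \rsum_(n1 <= m < n2) M m)%R.
  apply: Rle_trans (_ : (\rsum_(n1 <= m < n2) \rsum_(0 <= j < J) Cmod (pterm (a m) (RtoC r) j) <= _)%R); last first.
    by apply: rsum_le => m _; exact: (Ha m).1.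
  rewrite exchange_big /=; apply: rsum_le => j _.
  rewrite (eq_bigr (fun m => Cmod (a m j) * r ^ j)%R); last first.
    by move=> m _; rewrite Cmod_pterm Cmod_RtoC_pos //; lra.
  rewrite -rsum_mulr; apply: Rmult_le_compat_r; first by left.
  exact: Cmod_csum.
have /choice_fun [b Hb] : forall j, exists b, Csum (fun m => a m j) b.
  move=> j; apply: (@asum_conv _ (L / r ^ j)%R) => n.
  apply: (Rmult_le_reg_r (r ^ j)) => //; rewrite (_ : L / r ^ j * r ^ j = L)%R; last by field; have := rk j; lra.
  rewrite rsum_mulr; apply: Rle_trans (HM n); exact: rsum_le.
have lim J n (B : R) : (forall n', (\rsum_(n <= m < n') M m <= B)%R) ->
   (\rsum_(0 <= j < J) Cmod (pterm (fun j => b j - \csum_(0 <= m < n) a m j)%C (RtoC r) j) <= B)%R.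
  move=> HB.
  have H : is_lim_seq (fun n' => \rsum_(0 <= j < J) (Cmod (\csum_(0 <= m < n') a m j - \csum_(0 <= m < n) a m j) * r ^ j))%R
     (\rsum_(0 <= j < J) (Cmod (b j - \csum_(0 <= m < n) a m j) * r ^ j))%R.
    elim: J => [|J IH].
      by rewrite big_geq //; apply: is_lim_seq_ext (is_lim_seq_const 0) => n'; rewrite big_geq.
    rewrite big_nat_recr //=.
    apply: is_lim_seq_ext (_ : is_lim_seq (fun n' => (\rsum_(0 <= j < J) (Cmod (\csum_(0 <= m < n') a m j - \csum_(0 <= m < n) a m j) * r ^ j)) + Cmod (\csum_(0 <= m < n') a m J - \csum_(0 <= m < n) a m J) * r ^ J)%R _).
      by move=> n'; rewrite big_nat_recr.
    apply: is_lim_seq_plus' => //.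
    have := is_lim_seq_scal_r _ (r ^ J) _ (Clim_mod (Clim_sub (Hb J) (Clim_const (\csum_(0 <= m < n) a m J)))).
    by apply.
  rewrite (eq_bigr (fun j => Cmod (b j - \csum_(0 <= m < n) a m j) * r ^ j)%R); last first.
    by move=> j _; rewrite Cmod_pterm Cmod_RtoC_pos //; lra.
  apply: (is_lim_seq_le_loc _ _ _ _ _ H (is_lim_seq_const B)).
  exists n => n' /leP Hn; apply: Rle_trans (HB n'); apply: Rle_trans (partial J n n').
  apply: rsum_le => j _; rewrite (@big_cat_nat _ _ _ n 0 n') //=.
  by rewrite (_ : forall x y : C, x + y - x = y); [lra | move=> x y; ring].
exists b; split.
  move=> J; have := lim J 0%N L HM; rewrite (eq_bigr (fun j => Cmod (pterm b (RtoC r) j))) //.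
  by move=> j _; rewrite /pterm big_geq // Csub_0_r.
move=> z Hz.
have [l Hl] : exists l, Csum (pterm b (z - z0)) l.
  apply: (@asum_conv _ L); apply: asum_pterm_r Hz _ => J.
  have := lim J 0%N L HM; rewrite (eq_bigr (fun j => Cmod (pterm b (RtoC r) j))) //.
  by move=> j _; rewrite /pterm big_geq // Csub_0_r.
suff -> : g z = l by [].
apply: (Clim_uniq (Hg z Hz)); apply/Clim_eps => eps He.
have [N HN] := series_tail M0 HM (eps := (eps / 2)%R) ltac:(lra).
exists N => n Hn.
have Hs : Csum (pterm (fun j => b j - \csum_(0 <= m < n) a m j) (z - z0)) (l - \csum_(0 <= m < n) f m z).
  have h : Csum (fun j => \csum_(0 <= m < n) pterm (a m) (z - z0) j) (\csum_(0 <= m < n) f m z).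
    by apply: Csum_csum => m _; exact: (Ha m).2.
  have := Clim_sub Hl h; apply: Clim_ext => J; rewrite csum_sub; apply: eq_bigr => j _.
  by rewrite /pterm -csum_mulr; ring.
rewrite -Cmod_opp (_ : - _ = l - \csum_(0 <= m < n) f m z); last by ring.
apply: Rle_lt_trans (asum_le (asum_pterm_r Hz (_ : asum _ (eps / 2)%R)) Hs) _; last by lra.
by move=> J; apply: lim => n'; exact: HN.
Qed.

(** Removing the first terms of the exponential series improves the norm; the cases
    [j = 1] and [j = 2] give the decay of the factors of infinite products. *)
Lemma nps_exp_from f z0 r M j : (0 < r)%R -> nps f z0 r M ->
  nps (fun z => Cexp (f z) - \csum_(0 <= k < j) expc (f z) k) z0 r
      (exp M - \rsum_(0 <= k < j) (M ^ k / INR k`!)).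
Proof.
move=> Hr Hf; have M0 : (0 <= M)%R by have [a [Ha _]] := Hf; exact: asum_ge0 Ha.
apply: (@nps_sum (fun m z => expc (f z) (m + j)) _ _ _ (fun m => M ^ (m + j) / INR (m + j)`!)%R) => //.
- move=> m; have := nps_scal (/ RtoC (INR (m + j)`!)) (Rlt_le _ _ Hr) (nps_pow (m + j) (Rlt_le _ _ Hr) Hf).
  rewrite -RtoC_inv ?Cmod_RtoC_pos; try exact: INR_fact_neq0; last first.
    by left; apply: Rinv_0_lt_compat; exact: INR_fact_pos.
  rewrite Rmult_comm; apply: nps_ext => z _.
  by rewrite /expc /Cdiv RtoC_inv; [rewrite Cmult_comm | exact: INR_fact_neq0].
- move=> n; have := exp_partial_le (n + j) M0.
  rewrite (@big_cat_nat _ _ _ j 0) //=; last by lia.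
  by rewrite big_nat_shift; lra.
move=> z _; have := Clim_sub (Csum_exp (f z)) (Clim_const (\csum_(0 <= k < j) expc (f z) k)).
move=> /(@Clim_subseq _ _ (fun n => n + j)%N) H.
apply: Clim_ext (H _); last by move=> n; lia.
move=> n; rewrite (@big_cat_nat _ _ _ j 0) //=; last by lia.
rewrite big_nat_shift.
by rewrite (_ : forall x y : C, x + y - x = y) // => x y; ring.
Qed.

Lemma nps_exp f z0 r M : (0 < r)%R -> nps f z0 r M -> nps (fun z => Cexp (f z)) z0 r (exp M).
Proof.
move=> Hr Hf; have := nps_exp_from 0 Hr Hf; rewrite big_geq // Rminus_0_r.
by apply: nps_ext => z _; rewrite big_geq // Csub_0_r.
Qed.

Lemma nps_expm1 f z0 r M : (0 < r)%R -> nps f z0 r M -> nps (fun z => Cexp (f z) - 1) z0 r (exp M - 1).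
Proof.
move=> Hr Hf; have := nps_exp_from 1 Hr Hf; rewrite big_nat1 /= Rdiv_1_r.
by apply: nps_ext => z _; rewrite big_nat1 /expc /=; congr Cminus; field.
Qed.

Lemma nps_expm1x f z0 r M : (0 < r)%R -> nps f z0 r M ->
  nps (fun z => Cexp (f z) - 1 - f z) z0 r (exp M - 1 - M).
Proof.
move=> Hr Hf; have := nps_exp_from 2 Hr Hf; rewrite !big_nat_recr //= big_geq //.
rewrite (_ : exp M - _ = exp M - 1 - M)%R; last by field.
by apply: nps_ext => z _; rewrite !big_nat_recr //= big_geq // /expc /=; field.
Qed.

Lemma Clim_pow (u : C) : (Cmod u < 1)%R -> Clim (fun n => Cpow u n) 0.
Proof.
move=> Hu; apply: (Clim_dom (is_lim_seq_geom (Cmod u) _)).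
  by rewrite Rabs_pos_eq //; exact: Cmod_ge_0.
by exists 0%N => n _; rewrite Csub_0_r Cmod_pow; lra.
Qed.

Lemma Csum_geom (u : C) : (Cmod u < 1)%R -> Csum (Cpow u) (/ (1 - u)).
Proof.
move=> Hu.
have H1 : 1 - u <> 0.
  move=> h; have : u = 1 by rewrite -[u](Cplus_0_r) -h; ring.
  by move=> E; move: Hu; rewrite E Cmod_1; lra.
have := Clim_scal (/ (1 - u)) (Clim_sub (Clim_const 1) (Clim_pow Hu)).
rewrite Csub_0_r Cmult_1_r; apply: Clim_ext => n.
have E : (1 - u) * (\csum_(0 <= k < n) Cpow u k) = 1 - Cpow u n.
  elim: n => [|n IH]; first by rewrite big_geq //=; ring.
  by rewrite big_nat_recr //= Cmult_plus_distr_l IH; ring.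
by rewrite -E; field.
Qed.

Lemma rgeom_le M n : (0 <= M < 1)%R -> (\rsum_(0 <= k < n) M ^ k <= / (1 - M))%R.
Proof.
move=> HM; apply: (Rmult_le_reg_l (1 - M)); first by lra.
rewrite Rinv_r; last by move=> h; lra.
have -> : ((1 - M) * (\rsum_(0 <= k < n) M ^ k) = 1 - M ^ n)%R.
  elim: n => [|n IH]; first by rewrite big_geq //=; ring.
  by rewrite big_nat_recr //= Rmult_plus_distr_l IH; ring.
have : (0 <= M ^ n)%R by apply: pow_le; lra.
by lra.
Qed.

Lemma nps_geom f z0 r M : (0 < r)%R -> (M < 1)%R -> nps f z0 r M ->
  nps (fun z => / (1 - f z)) z0 r (/ (1 - M)).
Proof.
move=> Hr HM Hf; have M0 : (0 <= M)%R by have [a [Ha _]] := Hf; exact: asum_ge0 Ha.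
apply: (@nps_sum (fun m z => Cpow (f z) m) _ _ _ (fun m => M ^ m)%R) => //.
- by move=> m; apply: nps_pow => //; lra.
- by move=> n; apply: rgeom_le.
by move=> z Hz; apply: Csum_geom; apply: Rle_lt_trans HM; exact: nps_val Hf.
Qed.

(** Each monomial [(z - z0)^m] has norm at most [r^m] on the smaller disc, so
    [nps_sum] applies to the power series itself. *)
Lemma nps_recenter f z0 z1 r r1 M : (0 < r1)%R -> (Cmod (z1 - z0) + r1 <= r)%R ->
  nps f z0 r M -> nps f z1 r1 M.
Proof.
move=> Hr1 Hr [a [Ha Hf]]; have h0 := Cmod_ge_0 (z1 - z0).
have tri z : (Cmod (z - z1) <= r1)%R -> (Cmod (z - z0) <= r)%R.
  move=> Hz; rewrite (_ : z - z0 = (z - z1) + (z1 - z0)); last by ring.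
  by have := Cmod_triangle (z - z1) (z1 - z0); lra.
apply: (@nps_sum (fun m z => pterm a (z - z0) m) _ _ _ (fun m => Cmod (pterm a (RtoC r) m))) => //.
  move=> m; rewrite Cmod_pterm Cmod_RtoC_pos; last by lra.
  have Hz : nps (fun z => z - z0) z1 r1 r.
    have := nps_add (nps_const (z1 - z0) z1 (Rlt_le _ _ Hr1)) (nps_monomial 1 1 z1 (Rlt_le _ _ Hr1)).
    rewrite Cmod_1 Rmult_1_l pow_1 => /(nps_weaken Hr).
    by apply: nps_ext => z _ /=; ring.
  by apply: nps_scal (nps_pow m _ Hz); lra.
by move=> z /tri; exact: Hf.
Qed.

Lemma nps_order f z0 r M : (0 < r)%R -> nps f z0 r M ->
  (forall z, (Cmod (z - z0) <= r)%R -> f z = 0) \/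
  exists k g, nps g z0 r (M / r ^ k) /\ g z0 <> 0 /\
    forall z, (Cmod (z - z0) <= r)%R -> f z = Cpow (z - z0) k * g z.
Proof.
move=> Hr [a [Ha Hf]].
case: (classic (exists k, a k <> 0)); last first.
  move=> H; left => z Hz; apply: (Csum_uniq (Hf z Hz)); apply: Csum_ext Csum_zero => k.
  rewrite /pterm; case: (classic (a k = 0)) => [->|h]; first by ring.
  by case: H; exists k.
move=> Hex; right.
have [k [Hk Hmin]] : exists k, a k <> 0 /\ forall j, (j < k)%N -> a j = 0.
  case: Hex => k; elim/ltn_ind: k => k IH Hk.
  case: (classic (exists2 j, (j < k)%N & a j <> 0)); first by case=> j; exact: IH.
  move=> H; exists k; split=> // j Hj; apply: NNPP => h; apply: H; by exists j.
have rk : (0 < r ^ k)%R by apply: pow_lt.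
pose b j := a (j + k)%N.
have Hb : asum (pterm b (RtoC r)) (M / r ^ k).
  move=> n; apply: (Rmult_le_reg_r (r ^ k)) => //.
  rewrite (_ : M / r ^ k * r ^ k = M)%R; last by field; lra.
  rewrite rsum_mulr; apply: Rle_trans (Ha (n + k)%N).
  rewrite (@big_cat_nat _ _ _ k 0 (n + k)) //=; last by lia.
  rewrite big_nat_shift.
  have : (0 <= \rsum_(0 <= i < k) Cmod (pterm a (RtoC r) i))%R.
    by apply: rsum_ge0 => i _; exact: Cmod_ge_0.
  move=> h0; rewrite (eq_bigr (fun i => Cmod (pterm a (RtoC r) (i + k)))); first by lra.
  move=> i _; rewrite !Cmod_pterm /b Cmod_RtoC_pos; last by lra.
  by rewrite -plusE pow_add; ring.
have shift h l : Csum (pterm b h) l -> Csum (pterm a h) (Cpow h k * l).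
  move=> Hl; rewrite /Csum.
  have H : Clim (fun n => \csum_(0 <= j < n + k) pterm a h j) (Cpow h k * l).
    apply: Clim_ext (Clim_scal (Cpow h k) Hl) => n.
    rewrite csum_mull (@big_cat_nat _ _ _ k 0 (n + k)) //=; last by lia.
    rewrite [X in _ = X + _]big_nat [X in _ = X + _]big1; last by move=> j Hj; rewrite /pterm Hmin; [ring | lia].
    rewrite big_nat_shift Cplus_0_l; apply: eq_bigr => j _.
    by rewrite /pterm /b -plusE Cpow_add_r; ring.
  elim: {Hmin Hb b Hl Hk rk}k H => [|k IH] H.
    by apply: Clim_ext H => n; rewrite addn0.
  apply/Clim_eps => eps He; have [N HN] := (Clim_eps _ _).1 H _ He.
  exists (N + k.+1)%N => n Hn; have := HN (n - k.+1)%N ltac:(lia).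
  by rewrite subnK //; lia.
have /choice_fun [g Hg] : forall z, exists l, (Cmod (z - z0) <= r)%R -> Csum (pterm b (z - z0)) l.
  move=> z; case: (Rle_dec (Cmod (z - z0)) r) => Hz; last by exists 0.
  by have [l Hl] := asum_conv (asum_pterm_r Hz Hb); exists l.
exists k, g; split; first by exists b.
split.
  have := Hg z0; rewrite Csub_diag Cmod_0 => /(_ (Rlt_le _ _ Hr)) h.
  have h' : Csum (pterm b 0) (a k).
    apply: (Csum_ext _ (Csum_single (a k) 0%N)) => -[|j]; rewrite /pterm /b /= ?add0n; ring.
  by rewrite (Csum_uniq h h').
by move=> z Hz; apply: (Csum_uniq (Hf z Hz)); apply: shift; exact: Hg.
Qed.

(** * Analytic and weakly meromorphic functions *)

Definition near_pt (P : C -> Prop) (z0 : C) :=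
  exists r, (0 < r)%R /\ forall z, (Cmod (z - z0) <= r)%R -> P z.
Definition punct (P : C -> Prop) (z0 : C) := near_pt (fun z => z <> z0 -> P z) z0.

Lemma near_pt_locally P z0 : near_pt P z0 <-> locally (z0 : C_UniformSpace) P.
Proof.
split.
  move=> [r [Hr H]]; apply/locally_C; exists (mkposreal _ Hr) => z Hz.
  by apply: H; left; exact: Hz.
move=> /locally_C [eps H]; exists (eps / 2)%R; have he := cond_pos eps; split; first by lra.
by move=> z Hz; apply: H; apply: Rle_lt_trans Hz _; lra.
Qed.

Lemma punct_locally P z0 : punct P z0 <-> locally' (z0 : C_UniformSpace) P.
Proof. exact: near_pt_locally. Qed.

Lemma near_pt_and P Q z0 : near_pt P z0 -> near_pt Q z0 -> near_pt (fun z => P z /\ Q z) z0.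
Proof.
move=> [r [Hr HP]] [r' [Hr' HQ]]; exists (Rmin r r'); split; first exact: Rmin_glb_lt.
move=> z Hz; have := Rmin_l r r'; have := Rmin_r r r' => h1 h2.
by split; [apply: HP | apply: HQ]; lra.
Qed.

Lemma near_pt_imp (P Q : C -> Prop) z0 : (forall z, P z -> Q z) -> near_pt P z0 -> near_pt Q z0.
Proof. by move=> H [r [Hr HP]]; exists r; split=> // z /HP; exact: H. Qed.

Lemma punct_and P Q z0 : punct P z0 -> punct Q z0 -> punct (fun z => P z /\ Q z) z0.
Proof.
move=> hP hQ; apply: near_pt_imp (near_pt_and hP hQ) => z [h1 h2] hz.
by split; [exact: h1 | exact: h2].
Qed.

Lemma punct_imp (P Q : C -> Prop) z0 : (forall z, P z -> Q z) -> punct P z0 -> punct Q z0.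
Proof. by move=> H; apply: near_pt_imp => z h hz; apply: H; exact: h. Qed.

Lemma near_punct P z0 : near_pt P z0 -> punct P z0.
Proof. exact: near_pt_imp. Qed.

Lemma punct_true (P : C -> Prop) z0 : (forall z, P z) -> punct P z0.
Proof. by move=> H; exists 1%R; split; [lra | move=> z _ _; exact: H]. Qed.

Lemma punct_ex P z0 : punct P z0 -> exists z, P z.
Proof.
move=> [r [Hr H]]; exists (z0 + RtoC r); apply: H.
  rewrite (_ : z0 + RtoC r - z0 = RtoC r); last by ring.
  by rewrite Cmod_RtoC_pos; lra.
move=> h; have : RtoC r = 0 by rewrite -(Csub_diag z0) -{1}h; ring.
by move=> /RtoC_inj; lra.
Qed.

Lemma punct_near P z0 : punct P z0 -> punct (fun z => near_pt P z) z0.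
Proof.
move=> [r [Hr H]]; exists (r / 2)%R; split; first by lra.
move=> z Hz Hne; have hm : (0 < Cmod (z - z0))%R.
  by apply: (proj1 (Cmod_gt_0 _)) => h; apply: Hne; rewrite -(Cplus_0_l z0) -h; ring.
exists (Cmod (z - z0) / 2)%R; split; first by lra.
move=> w Hw; apply: H.
  rewrite (_ : w - z0 = (w - z) + (z - z0)); last by ring.
  by have := Cmod_triangle (w - z) (z - z0); lra.
move=> h; move: Hw; rewrite h -Cmod_opp (_ : - (z0 - z) = z - z0); [lra | ring].
Qed.

Definition ana f z0 := exists r M, (0 < r)%R /\ nps f z0 r M.

Lemma ana_common f g z0 : ana f z0 -> ana g z0 ->
  exists r M1 M2, (0 < r)%R /\ nps f z0 r M1 /\ nps g z0 r M2.
Proof.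
move=> [r1 [M1 [H1 F]]] [r2 [M2 [H2 G]]]; exists (Rmin r1 r2), M1, M2.
have h := Rmin_glb_lt _ _ _ H1 H2; split=> //.
by split; [apply: nps_shrink F | apply: nps_shrink G]; split; try lra; [exact: Rmin_l | exact: Rmin_r].
Qed.

Lemma ana_const c z0 : ana (fun=> c) z0.
Proof. by exists 1%R, (Cmod c); split; [lra | apply: nps_const; lra]. Qed.

Lemma ana_id z0 : ana (fun z => z) z0.
Proof. by exists 1%R, (Cmod z0 + 1)%R; split; [lra | apply: nps_id; lra]. Qed.

Lemma ana_add f g z0 : ana f z0 -> ana g z0 -> ana (fun z => f z + g z) z0.
Proof.
move=> Hf Hg; have [r [M1 [M2 [Hr [F G]]]]] := ana_common Hf Hg.
by exists r, (M1 + M2)%R; split=> //; exact: nps_add.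
Qed.

Lemma ana_mul f g z0 : ana f z0 -> ana g z0 -> ana (fun z => f z * g z) z0.
Proof.
move=> Hf Hg; have [r [M1 [M2 [Hr [F G]]]]] := ana_common Hf Hg.
by exists r, (M1 * M2)%R; split=> //; exact: nps_mul.
Qed.

Lemma ana_pow f z0 k : ana f z0 -> ana (fun z => Cpow (f z) k) z0.
Proof. by move=> [r [M [Hr F]]]; exists r, (M ^ k)%R; split=> //; apply: nps_pow => //; lra. Qed.

Lemma ana_ext (f g : C -> C) z0 : near_pt (fun z => f z = g z) z0 -> ana f z0 -> ana g z0.
Proof.
move=> [r1 [H1 E]] [r [M [Hr F]]]; exists (Rmin r r1), M; split; first exact: Rmin_glb_lt.
have [h1 h2] := (Rmin_l r r1, Rmin_r r r1).
apply: nps_ext (nps_shrink _ F); first by move=> z Hz; apply: E; lra.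
by split; [have := Rmin_glb_lt _ _ _ Hr H1; lra |].
Qed.

Lemma ana_opp f z0 : ana f z0 -> ana (fun z => - f z) z0.
Proof.
move=> H; apply: ana_ext (ana_mul (ana_const (- (1)) z0) H); exists 1%R; split; first by lra.
by move=> z _; ring.
Qed.

Lemma ana_sub f g z0 : ana f z0 -> ana g z0 -> ana (fun z => f z - g z) z0.
Proof. by move=> Hf Hg; apply: ana_add => //; exact: ana_opp. Qed.

Lemma ana_exp f z0 : ana f z0 -> ana (fun z => Cexp (f z)) z0.
Proof. by move=> [r [M [Hr F]]]; exists r, (exp M); split=> //; exact: nps_exp. Qed.

(** A zero factors out a power of [z - z0], whose norm is small on a small disc. *)
Lemma ana_small (f : C -> C) z0 eps : (0 < eps)%R -> f z0 = 0 -> ana f z0 ->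
  exists r, (0 < r)%R /\ nps f z0 r eps.
Proof.
move=> He H0 [r [M [Hr F]]].
have [Hz|[k [g [Hg [Hg0 Hfg]]]]] := nps_order Hr F.
  exists r; split=> //; apply: nps_ext (nps_weaken _ (nps_const 0 z0 (Rlt_le _ _ Hr))).
    by move=> z /Hz ->.
  by rewrite Cmod_0; lra.
have [k' Ek] : exists k', k = k'.+1.
  case: k Hg Hfg => [|k] Hg Hfg; last by exists k.
  by case: Hg0; rewrite -H0 Hfg /= ?Csub_diag ?Cmod_0 ?Cmult_1_l //; lra.
have M0 : (0 <= M / r ^ k)%R by have [a [Ha _]] := Hg; exact: asum_ge0 Ha.
set B := (M / r ^ k)%R in Hg M0.
pose q := Rmin (Rmin r 1) (eps / (B + 1)).
have q0 : (0 < q)%R.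
  by do !apply: Rmin_glb_lt => //; [lra | apply: Rdiv_lt_0_compat; lra].
have [q1 q2 q3] : [/\ q <= r, q <= 1 & q <= eps / (B + 1)]%R.
  split; [apply: Rle_trans (Rmin_l _ _) (Rmin_l _ _) | apply: Rle_trans (Rmin_l _ _) (Rmin_r _ _) | exact: Rmin_r].
exists q; split=> //.
have h1 := nps_monomial 1 k z0 (Rlt_le _ _ q0).
have h2 : nps g z0 q B by apply: nps_shrink Hg; lra.
apply: nps_ext (nps_weaken _ (nps_mul h1 h2)).
  by move=> z Hz; rewrite Hfg; [ring | lra].
rewrite Cmod_1 Rmult_1_l Ek /=.
have qk : (0 <= q ^ k' <= 1)%R.
  by split; [apply: pow_le; lra | rewrite -(pow1 k'); apply: pow_incr; lra].
have := Rmult_le_compat_r (B + 1) _ _ ltac:(lra) q3.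
rewrite (_ : eps / (B + 1) * (B + 1) = eps)%R; last by field; lra.
have : (q * q ^ k' * B <= q * 1 * B)%R by apply: Rmult_le_compat_r => //; apply: Rmult_le_compat_l; lra.
by lra.
Qed.

(** Geometric series: [1 - f / f z0] vanishes at [z0], so it has norm at most [1/2] on a
    small disc. *)
Lemma ana_inv (f : C -> C) z0 : f z0 <> 0 -> ana f z0 -> ana (fun z => / f z) z0.
Proof.
move=> Hf0 Hf.
pose u z := 1 - / f z0 * f z.
have Hu : ana u z0 by apply: ana_sub; [exact: ana_const | apply: ana_mul => //; exact: ana_const].
have u0 : u z0 = 0 by rewrite /u; field.
have [r [Hr U]] := ana_small (eps := (1/2)%R) ltac:(lra) u0 Hu.
have G := nps_geom Hr (ltac:(lra) : (1 / 2 < 1)%R) U.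
have : ana (fun z => / (1 - u z)) z0.
  by exists r, (/ (1 - 1 / 2))%R.
move=> /(ana_mul (ana_const (/ f z0) z0)); apply: ana_ext; exists r; split=> // z Hz.
have E : 1 - u z = / f z0 * f z by rewrite /u; ring.
have : 1 - u z <> 0.
  move=> h; have := nps_val Hz U.
  rewrite (_ : u z = 1 - (1 - u z)); last by ring.
  by rewrite h Csub_0_r Cmod_1; lra.
rewrite E => h; have h2 : f z <> 0 by move=> h3; apply: h; rewrite h3; ring.
by field.
Qed.

Lemma ana_continuous f z0 eps : (0 < eps)%R -> ana f z0 ->
  near_pt (fun z => (Cmod (f z - f z0) <= eps)%R) z0.
Proof.
move=> He Hf; have Hg : ana (fun z => f z - f z0) z0 by apply: ana_sub => //; exact: ana_const.
have [r [Hr G]] := @ana_small (fun z => f z - f z0) z0 eps He (Csub_diag _) Hg.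
by exists r; split=> // z Hz; exact: (nps_val Hz G).
Qed.

Lemma ana_neq0 (f : C -> C) z0 : f z0 <> 0 -> ana f z0 -> near_pt (fun z => f z <> 0) z0.
Proof.
move=> H0 Hf; have h := proj1 (Cmod_gt_0 _) H0.
apply: near_pt_imp (ana_continuous (eps := (Cmod (f z0) / 2)%R) ltac:(lra) Hf) => z.
by move=> + h1; rewrite h1 Csub_0_l Cmod_opp; lra.
Qed.

Lemma ana_near f z0 : ana f z0 -> near_pt (ana f) z0.
Proof.
move=> [r [M [Hr F]]]; exists (r / 2)%R; split; first by lra.
move=> z Hz; exists (r / 2)%R, M; split; first by lra.
by apply: nps_recenter F; lra.
Qed.

(** Only the substitutions [s + a] and [1 - s] occur; a slope of modulus one leaves
    discs and norms unchanged. *)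
Lemma ana_comp f c z0 (sg : C) : Cmod sg = 1%R -> ana f (sg * z0 + c) -> ana (fun z => f (sg * z + c)) z0.
Proof.
move=> Hs [r [M [Hr [a [Ha Hf]]]]]; exists r, M; split=> //.
exists (fun k => a k * Cpow sg k); split.
  by apply: asum_ext Ha => k; rewrite !Cmod_pterm Hs pow1; ring.
move=> z Hz; have := Hf (sg * z + c); rewrite (_ : sg * z + c - (sg * z0 + c) = sg * (z - z0)); last by ring.
rewrite Cmod_mult Hs Rmult_1_l => /(_ Hz); apply: Csum_ext => k.
by rewrite /pterm Cpow_mult_l; ring.
Qed.

Lemma ana_order f z0 : ana f z0 -> near_pt (fun z => f z = 0) z0 \/
  exists k g, ana g z0 /\ g z0 <> 0 /\ near_pt (fun z => f z = Cpow (z - z0) k * g z) z0.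
Proof.
move=> [r [M [Hr F]]]; have [H|[k [g [Hg [Hg0 H]]]]] := nps_order Hr F; [left|right].
  by exists r.
exists k, g; split; first by exists r, (M / r ^ k)%R.
by split=> //; exists r.
Qed.

(** Meromorphy at [z0] up to the value at [z0]. Unlike [meromorphic], it is visibly
    closed under sums and products, whose values at a common pole are accidental. *)
Definition wm f z0 := exists n g, ana g z0 /\ punct (fun z => Cpow (z - z0) n * f z = g z) z0.

Lemma ana_wm f z0 : ana f z0 -> wm f z0.
Proof. by move=> H; exists 0%N, f; split=> //; apply: punct_true => z /=; ring. Qed.

Lemma ana_Xn z0 n : ana (fun z => Cpow (z - z0) n) z0.
Proof. by apply: ana_pow; apply: ana_sub; [exact: ana_id | exact: ana_const]. Qed.

Lemma wm_ext (f g : C -> C) z0 : punct (fun z => f z = g z) z0 -> wm f z0 -> wm g z0.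
Proof.
move=> E [n [h [Hh H]]]; exists n, h; split=> //.
by apply: punct_imp (punct_and E H) => z [<-].
Qed.

Lemma wm_add f g z0 : wm f z0 -> wm g z0 -> wm (fun z => f z + g z) z0.
Proof.
move=> [n1 [h1 [A1 H1]]] [n2 [h2 [A2 H2]]].
exists (n1 + n2)%N, (fun z => Cpow (z - z0) n2 * h1 z + Cpow (z - z0) n1 * h2 z); split.
  by apply: ana_add; apply: ana_mul => //; exact: ana_Xn.
apply: punct_imp (punct_and H1 H2) => z [<- <-].
by rewrite -plusE Cpow_add_r; ring.
Qed.

Lemma wm_mul f g z0 : wm f z0 -> wm g z0 -> wm (fun z => f z * g z) z0.
Proof.
move=> [n1 [h1 [A1 H1]]] [n2 [h2 [A2 H2]]].
exists (n1 + n2)%N, (fun z => h1 z * h2 z); split; first exact: ana_mul.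
apply: punct_imp (punct_and H1 H2) => z [<- <-].
by rewrite -plusE Cpow_add_r; ring.
Qed.

Lemma wm_const c z0 : wm (fun=> c) z0. Proof. exact/ana_wm/ana_const. Qed.

Lemma wm_opp f z0 : wm f z0 -> wm (fun z => - f z) z0.
Proof.
move=> H; apply: wm_ext (wm_mul (wm_const (- (1)) z0) H); apply: punct_true => z; ring.
Qed.

Lemma wm_sub f g z0 : wm f z0 -> wm g z0 -> wm (fun z => f z - g z) z0.
Proof. by move=> Hf Hg; apply: wm_add => //; exact: wm_opp. Qed.

Lemma wm_csum I (r : seq I) (P : pred I) (F : I -> C -> C) z0 : (forall i, wm (F i) z0) ->
  wm (fun z => \big[Cplus/RtoC 0]_(i <- r | P i) F i z) z0.
Proof.
move=> H; elim: r => [|i r IH].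
  by apply: wm_ext (wm_const 0 z0); apply: punct_true => z; rewrite big_nil.
case: (boolP (P i)) => Pi.
  by apply: wm_ext (wm_add (H i) IH); apply: punct_true => z; rewrite big_cons Pi.
by apply: wm_ext IH; apply: punct_true => z; rewrite big_cons (negbTE Pi).
Qed.

Lemma wm_comp f c z0 (sg : C) : Cmod sg = 1%R -> wm f (sg * z0 + c) -> wm (fun z => f (sg * z + c)) z0.
Proof.
move=> Hs [n [g [Hg [r [Hr H]]]]]; exists n, (fun z => / Cpow sg n * g (sg * z + c)).
have Hs0 : sg <> 0 by move=> h; move: Hs; rewrite h Cmod_0; lra.
split; first by apply: ana_mul; [exact: ana_const | exact: ana_comp].
exists r; split=> // z Hz Hne; rewrite -H.
- rewrite (_ : sg * z + c - (sg * z0 + c) = sg * (z - z0)); last by ring.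
  by rewrite Cpow_mult_l; field; exact: Cpow_nz.
- rewrite (_ : sg * z + c - (sg * z0 + c) = sg * (z - z0)); last by ring.
  by rewrite Cmod_mult Hs Rmult_1_l.
move=> h; apply: Hne.
have E : sg * z = sg * z0 by rewrite (_ : sg * z = sg * z + c - c); [rewrite h; ring | ring].
by rewrite -(Cmult_1_l z) -(Cinv_l sg Hs0) -Cmult_assoc E Cmult_assoc Cinv_l // Cmult_1_l.
Qed.

Lemma neq_sub (z z0 : C) : z <> z0 -> z - z0 <> 0.
Proof. by move=> H h; apply: H; rewrite -(Cplus_0_l z0) -h; ring. Qed.

Lemma wm_order f z0 : wm f z0 -> punct (fun z => f z = 0) z0 \/
  exists n k g, ana g z0 /\ g z0 <> 0 /\
    punct (fun z => Cpow (z - z0) n * f z = Cpow (z - z0) k * g z) z0.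
Proof.
move=> [n [g [Hg H]]]; have [h|[k [g1 [Hg1 [Hg10 h]]]]] := ana_order Hg; [left|right].
  have := near_pt_and (near_punct h) H; apply: near_pt_imp => z [h1 h2] hz.
  have := h2 hz; rewrite (h1 hz) => E.
  have hn := Cpow_nz _ n (neq_sub hz).
  by rewrite -(Cmult_1_l (f z)) -(Cinv_l _ hn) -Cmult_assoc E; ring.
exists n, k, g1; split=> //; split=> //.
by apply: punct_imp (punct_and (near_punct h) H) => z [<-].
Qed.

Lemma wm_dichotomy f z0 : wm f z0 -> punct (fun z => f z = 0) z0 \/ punct (fun z => f z <> 0) z0.
Proof.
move=> /wm_order [h|[n [k [g [Hg [Hg0 H]]]]]]; [by left|right].
have := near_pt_and (near_punct (ana_neq0 Hg0 Hg)) H; apply: near_pt_imp => z [h1 h2] hz h.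
have := h2 hz; rewrite h Cmult_0_r => E.
have := Cmult_neq_0 _ _ (Cpow_nz _ k (neq_sub hz)) (h1 hz); by rewrite -E.
Qed.

Lemma wm_inv f z0 : wm f z0 -> ~ punct (fun z => f z = 0) z0 -> wm (fun z => / f z) z0.
Proof.
move=> /wm_order [h|[n [k [g [Hg [Hg0 H]]]]]] Hne; first by case: Hne.
exists k, (fun z => Cpow (z - z0) n * / g z); split.
  by apply: ana_mul; [exact: ana_Xn | exact: ana_inv].
have := near_pt_and (near_punct (ana_neq0 Hg0 Hg)) H; apply: near_pt_imp => z [h1 h2] hz.
have E := h2 hz; have {}h1 := h1 hz.
have nk := Cpow_nz _ k (neq_sub hz); have nn := Cpow_nz _ n (neq_sub hz).
have nf : f z <> 0.
  by move=> h; have := Cmult_neq_0 _ _ nk h1; rewrite -E h Cmult_0_r.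
rewrite (_ : Cpow (z - z0) n = Cpow (z - z0) k * g z * / f z); last by rewrite -E; field.
by field; split.
Qed.

(** * The identity theorem *)

(** Let [Z] be the set of points near which [f] vanishes. By [wm_dichotomy] every point
    has either a neighbourhood inside [Z] or a punctured neighbourhood outside of [Z].
    Hence the initial part of the segment from [z1] to [z0] that lies in [Z] cannot end
    before [z0]. *)
Lemma wm_identity f z1 z0 : (forall z, wm f z) -> punct (fun z => f z = 0) z1 ->
  punct (fun z => f z = 0) z0.
Proof.
move=> Hf H1; pose Z z := punct (fun z => f z = 0) z.
pose p (t : R) := z1 + RtoC t * (z0 - z1).
case: (classic (z0 = z1)) => [->|Hne] //.
have L0 : (0 < Cmod (z0 - z1))%R by apply: (proj1 (Cmod_gt_0 _)); exact: neq_sub.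
have dist t t' : Cmod (p t - p t') = (Rabs (t - t') * Cmod (z0 - z1))%R.
  by rewrite -Cmod_R -Cmod_mult /p RtoC_minus; congr Cmod; ring.
have pneq t t' : t <> t' -> p t <> p t'.
  move=> ht h; have := dist t t'; rewrite h Csub_diag Cmod_0.
  have := Rabs_pos_lt (t - t') ltac:(lra) => h1.
  by have := Rmult_lt_0_compat _ _ h1 L0; lra.
have alt t : near_pt Z (p t) \/ punct (fun z => ~ Z z) (p t).
  have [h|h] := wm_dichotomy (Hf (p t)); [left|right].
    have [r [Hr h2]] := punct_near h; exists r; split=> // z Hz.
    case: (classic (z = p t)) => [->|hz] //.
    by have := h2 z Hz hz; exact: near_punct.
  apply: punct_imp (punct_near h) => z hz hZ.
  have [w [hw1 hw2]] := punct_ex (punct_and (near_punct hz) hZ); by apply: hw1.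
pose E t := (0 <= t <= 1)%R /\ forall t', (0 <= t' <= t)%R -> Z (p t').
have E0 : E 0%R.
  split; first by lra.
  by move=> t' ht'; rewrite (_ : p t' = z1) // /p (_ : t' = 0%R); [ring | lra].
have bE : bound E by exists 1%R => t [ht _]; lra.
have [s [Hub Hlub]] := completeness E bE (ex_intro _ _ E0).
have s0 : (0 <= s)%R := Hub _ E0.
have s1 : (s <= 1)%R by apply: Hlub => t [ht _]; lra.
have below t : (0 <= t < s)%R -> Z (p t).
  move=> ht; apply: NNPP => hZ; have : (s <= t)%R; last by lra.
  apply: Hlub => t' [ht' Ht']; case: (Rle_dec t' t) => // h; case: hZ; apply: Ht'; lra.
have tl d : (0 < d)%R -> forall t t', (Rabs (t - t') <= d / Cmod (z0 - z1))%R -> (Cmod (p t - p t') <= d)%R.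
  move=> hd t t' h; rewrite dist; have := Rmult_le_compat_r _ _ _ (Rlt_le _ _ L0) h.
  by rewrite (_ : d / Cmod (z0 - z1) * Cmod (z0 - z1) = d)%R //; field; lra.
have near_s : near_pt Z (p s).
  have [//|[r [Hr hr]]] := alt s; exfalso.
  case: (Rle_lt_or_eq_dec _ _ s0) => hs.
    pose d := Rmin s (r / Cmod (z0 - z1)).
    have d0 : (0 < d)%R by apply: Rmin_glb_lt => //; exact: Rdiv_lt_0_compat.
    have d1 : (d <= s)%R := Rmin_l _ _.
    have d2 : (d <= r / Cmod (z0 - z1))%R := Rmin_r _ _.
    apply: (hr (p (s - d)%R)); [|apply: pneq; lra | apply: below; lra].
    by apply: tl => //; rewrite (_ : s - d - s = - d)%R ?Rabs_Ropp ?Rabs_pos_eq; [|lra|ring].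
  have [r' [Hr' hr']] : punct (fun z => f z = 0) (p 0%R).
    by apply: (proj2 E0); lra.
  rewrite -hs in hr.
  have := punct_near (ex_intro _ r' (conj Hr' hr') : punct (fun z => f z = 0) (p 0%R)).
  move=> h; have [z [hz1 hz2]] := punct_ex (punct_and h (ex_intro _ r (conj Hr hr) : punct _ (p 0%R))).
  by apply: hz2; exact: near_punct.
have [r [Hr hr]] := near_s.
case: (Rle_lt_or_eq_dec _ _ s1) => hs; last first.
  have := hr (p s); rewrite Csub_diag Cmod_0 => /(_ (Rlt_le _ _ Hr)).
  by rewrite hs (_ : p 1%R = z0) // /p; ring.
exfalso; pose d := Rmin (1 - s) (r / Cmod (z0 - z1)).
have d0 : (0 < d)%R by apply: Rmin_glb_lt; [lra | exact: Rdiv_lt_0_compat].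
have d1 : (d <= 1 - s)%R := Rmin_l _ _.
have d2 : (d <= r / Cmod (z0 - z1))%R := Rmin_r _ _.
have : (s + d <= s)%R; last by lra.
apply: Hub; split; first by lra.
move=> t' ht'; case: (Rlt_le_dec t' s) => h; first by apply: below; lra.
by apply: hr; apply: tl => //; rewrite Rabs_pos_eq; lra.
Qed.

Lemma wm_eq_identity f g z1 : (forall z, wm f z) -> (forall z, wm g z) ->
  punct (fun z => f z = g z) z1 -> mero_eq f g.
Proof.
move=> Hf Hg H z0; apply/punct_locally.
have h z : wm (fun z => f z - g z) z by exact: wm_sub.
have := @wm_identity _ z1 z0 h; have sub0 (x y : C) : x - y = 0 -> x = y.
  by move=> e; rewrite -(Cplus_0_l y) -e; ring.
move=> /(_ _) h2; apply: punct_imp (h2 _) => [z /sub0 //|].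
by apply: punct_imp H => z ->; exact: Csub_diag.
Qed.

(** * Analytic and meromorphic functions in terms of power series *)

Lemma is_pseries_Csum a h l :
  is_pseries (a : nat -> C_NormedModule) (h : C_AbsRing) l <-> Csum (pterm a h) l.
Proof.
rewrite -is_series_Csum /is_pseries.
have E k : scal (pow_n (h : C_AbsRing) k) (a k : C_NormedModule) = pterm a h k.
  have P j : pow_n (h : C_AbsRing) j = Cpow h j by elim: j => [|j IH] //=; rewrite IH.
  by rewrite P /pterm Cmult_comm.
by split; apply: is_series_ext => k; rewrite E.
Qed.

(** Convergence at distance [r] bounds the terms, which gives absolute convergence at
    distance [r/2]. *)
Lemma ana_of_series f z0 a r : (0 < r)%R ->
  (forall z, (Cmod (z - z0) <= r)%R -> Csum (pterm a (z - z0)) (f z)) -> ana f z0.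
Proof.
move=> Hr Hf.
have := Hf (z0 + RtoC r); rewrite (_ : z0 + RtoC r - z0 = RtoC r); last by ring.
rewrite Cmod_RtoC_pos; last by lra.
move=> /(_ (Rle_refl _)) H.
have [B HB] : exists B, forall k, (Cmod (pterm a (RtoC r) k) <= B)%R.
  have [M HM] := Clim_bounded H; exists (M + M)%R => k.
  have h1 := HM k.+1; have h2 := HM k; move: h1; rewrite big_nat_recr //= => h1.
  move: h2 h1; set S := \csum_(0 <= i < k) _ => h2 h1.
  have := Cmod_triangle (S + pterm a (RtoC r) k) (- S); rewrite Cmod_opp.
  by rewrite (_ : S + pterm a (RtoC r) k + - S = pterm a (RtoC r) k); [lra | ring].
exists (r / 2)%R, (B * 2)%R; split; first by lra.
exists a; split; last by move=> z Hz; apply: Hf; lra.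
move=> n; apply: Rle_trans (_ : (\rsum_(0 <= k < n) (B * (1 / 2) ^ k) <= _)%R).
  apply: rsum_le => k _; have := HB k; rewrite !Cmod_pterm !Cmod_RtoC_pos; try lra.
  rewrite (_ : r / 2 = r * (1 / 2))%R; last by field.
  rewrite Rpow_mult_distr -Rmult_assoc => h; apply: Rmult_le_compat_r => //.
  by apply: pow_le; lra.
rewrite -rsum_mull; apply: Rmult_le_compat_l; first exact: Rle_trans (Cmod_ge_0 _) (HB 0%N).
by apply: Rle_trans (rgeom_le n _) _; lra.
Qed.

Lemma analytic_atP f z0 : analytic_at f z0 <-> ana f z0.
Proof.
split.
  move=> [a /near_pt_locally [r [Hr H]]]; apply: (ana_of_series (a := a) Hr) => z Hz.
  by apply/is_pseries_Csum; exact: H.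
move=> [r [M [Hr [a [_ H]]]]]; exists a; apply/near_pt_locally; exists r; split=> // z Hz.
by apply/is_pseries_Csum; exact: H.
Qed.

Lemma meromorphic_wm f z0 : meromorphic f -> wm f z0.
Proof.
move=> /(_ z0) [/analytic_atP /ana_wm //|[m [a [_ [_ /punct_locally [r [Hr H]]]]]]].
pose g z := if excluded_middle_informative (z = z0) then a 0%N else Cpow (z - z0) m * f z.
exists m, g; split.
  apply: (ana_of_series (a := a) Hr) => z Hz; rewrite /g.
  case: excluded_middle_informative => h; last by apply/is_pseries_Csum; exact: H.
  subst z; rewrite /= Csub_diag; apply: (Csum_ext _ (Csum_single (a 0%N) 0%N)) => -[|k]; rewrite /pterm /=; ring.
by exists 1%R; split; [lra | move=> z _ hz; rewrite /g; case: excluded_middle_informative].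
Qed.

(** Filling in removable singularities. *)
Definition normalized (f : C -> C) (z0 : C) : C :=
  epsilon (inhabits (RtoC 0)) (fun l => exists g, ana g z0 /\ g z0 = l /\ punct (fun z => f z = g z) z0).

Lemma normalized_ana (f g : C -> C) z0 : ana g z0 -> punct (fun z => f z = g z) z0 -> normalized f z0 = g z0.
Proof.
move=> Hg H; rewrite /normalized.
have := epsilon_spec (inhabits (RtoC 0)) (fun l => exists g, ana g z0 /\ g z0 = l /\ punct (fun z => f z = g z) z0).
case; first by exists (g z0), g.
move=> g1 [Hg1 [<- H1]]; apply: NNPP => h.
have hd : ana (fun z => g1 z - g z) z0 by exact: ana_sub.
have /near_punct h2 := @ana_neq0 (fun z => g1 z - g z) z0 (neq_sub h) hd.
have [z [[h3 h4] h5]] := punct_ex (punct_and (punct_and H H1) h2).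
by apply: h5; rewrite -h3 -h4 Csub_diag.
Qed.

Lemma normalized_near (f g : C -> C) z0 : ana g z0 -> punct (fun z => f z = g z) z0 ->
  near_pt (fun z => normalized f z = g z) z0.
Proof.
move=> Hg H; have [r [Hr H2]] := near_pt_and (ana_near Hg : near_pt (fun z => ana g z) z0) (punct_near H).
exists r; split=> // z Hz; have [h1 h2] := H2 z Hz.
case: (classic (z = z0)) => hz; first by subst z; exact: normalized_ana.
by apply: normalized_ana => //; apply: near_punct; exact: h2.
Qed.

(** At a pole [meromorphic] asks for a power series of [(z - z0)^m f] with nonzero
    constant term, whence the order of vanishing [k] is subtracted from [n]; the values
    near [z0] are the analytic ones because [f] is analytic in a punctured disc. *)
Lemma normalized_meromorphic f : (forall z, wm f z) -> meromorphic (normalized f).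
Proof.
move=> Hf z0; have [h|[n [k [g [Hg [Hg0 H]]]]]] := wm_order (Hf z0).
  left; apply/analytic_atP; have := normalized_near (ana_const 0 z0) h.
  by move=> h2; apply: ana_ext (ana_const 0 z0); apply: near_pt_imp h2 => z ->.
case: (leqP n k) => hnk.
  left; apply/analytic_atP; pose g1 z := Cpow (z - z0) (k - n) * g z.
  have Hg1 : ana g1 z0 by apply: ana_mul => //; exact: ana_Xn.
  have E : punct (fun z => f z = g1 z) z0.
    apply: near_pt_imp H => z h hz; have nn := Cpow_nz _ n (neq_sub hz).
    rewrite -(Cmult_1_l (f z)) -(Cinv_l _ nn) -Cmult_assoc (h hz) -(subnK hnk) -plusE Cpow_add_r /g1.
    by field.
  have h := normalized_near Hg1 E.
  by apply: ana_ext Hg1; apply: near_pt_imp h => z ->.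
right; exists (n - k)%N.
have [r [M [Hr [a [Ha Hga]]]]] := Hg.
have a0 : a 0%N = g z0.
  have := Hga z0; rewrite Csub_diag Cmod_0 => /(_ (Rlt_le _ _ Hr)) h.
  symmetry; apply: (Csum_uniq h).
  by apply: (Csum_ext _ (Csum_single (a 0%N) 0%N)) => -[|j]; rewrite /pterm /=; ring.
exists a; split; first by lia.
split; first by rewrite a0.
apply/punct_locally.
have Hpole : punct (fun z => f z = / Cpow (z - z0) (n - k) * g z) z0.
  apply: near_pt_imp H => z h hz; have nn := Cpow_nz _ n (neq_sub hz).
  have nk := Cpow_nz _ k (neq_sub hz); have nnk := Cpow_nz _ (n - k)%N (neq_sub hz).
  rewrite -(Cmult_1_l (f z)) -(Cinv_l _ nn) -Cmult_assoc (h hz).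
  rewrite (_ : Cpow (z - z0) n = Cpow (z - z0) (n - k) * Cpow (z - z0) k); first by field; split.
  by rewrite -Cpow_add_r; congr Cpow; lia.
have [r2 [Hr2 H2]] := punct_near Hpole; have [r3 [Hr3 H3]] := ana_near Hg.
exists (Rmin r (Rmin r2 r3)); split; first by do !apply: Rmin_glb_lt.
move=> z Hz hz.
have [m1 m2 m3] : [/\ Cmod (z - z0) <= r, Cmod (z - z0) <= r2 & Cmod (z - z0) <= r3]%R.
  split; apply: Rle_trans Hz _; first exact: Rmin_l.
    exact: Rle_trans (Rmin_r _ _) (Rmin_l _ _).
  exact: Rle_trans (Rmin_r _ _) (Rmin_r _ _).
have -> : normalized f z = / Cpow (z - z0) (n - k) * g z.
  apply: (@normalized_ana f (fun w => / Cpow (w - z0) (n - k) * g w)); last by apply: near_punct; exact: H2.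
  apply: ana_mul; last exact: H3.
  apply: ana_inv; first by apply: Cpow_nz; exact: neq_sub.
  by apply: ana_pow; apply: ana_sub; [exact: ana_id | exact: ana_const].
apply/is_pseries_Csum; rewrite Cmult_assoc Cinv_r ?Cmult_1_l; first exact: Hga.
by apply: Cpow_nz; exact: neq_sub.
Qed.

Lemma normalized_eq f z : ana f z -> normalized f z = f z.
Proof. by move=> H; apply: normalized_ana => //; apply: punct_true. Qed.

(** * Powers of positive integers *)

Lemma Rcpow_add x s t : Rcpow x (s + t) = Rcpow x s * Rcpow x t.
Proof. by rewrite /Rcpow -Cexp_add; congr Cexp; ring. Qed.

Lemma Rcpow_opp x s : Rcpow x (- s) = / Rcpow x s.
Proof. by rewrite /Rcpow -Cexp_opp; congr Cexp; ring. Qed.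

Lemma Rcpow_neq0 x s : Rcpow x s <> 0.
Proof. exact: Cexp_neq0. Qed.

Lemma Rcpow_mul x y s : (0 < x)%R -> (0 < y)%R -> Rcpow (x * y) s = Rcpow x s * Rcpow y s.
Proof. by move=> hx hy; rewrite /Rcpow -Cexp_add ln_mult // RtoC_plus; congr Cexp; ring. Qed.

Lemma Rcpow_0 x : Rcpow x 0 = 1.
Proof. by rewrite /Rcpow Cmult_0_l Cexp_0. Qed.

Lemma Rcpow_1 x : (0 < x)%R -> Rcpow x 1 = RtoC x.
Proof. by move=> hx; rewrite /Rcpow Cmult_1_l Cexp_RtoC exp_ln. Qed.

Lemma Cmod_Rcpow x s : Cmod (Rcpow x s) = exp (Re s * ln x).
Proof. by rewrite /Rcpow Cmod_Cexp; congr exp; case: s => a b /=; ring. Qed.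

Lemma INR_gt0 n : (0 < n)%N -> (0 < INR n)%R.
Proof. by move=> h; apply: lt_0_INR; lia. Qed.

Lemma ncpow_add n s t : ncpow n (s + t) = ncpow n s * ncpow n t.
Proof. exact: Rcpow_add. Qed.
Lemma ncpow_opp n s : ncpow n (- s) = / ncpow n s.
Proof. exact: Rcpow_opp. Qed.
Lemma ncpow_neq0 n s : ncpow n s <> 0.
Proof. exact: Rcpow_neq0. Qed.
Lemma ncpow_mul m n s : (0 < m)%N -> (0 < n)%N -> ncpow (m * n) s = ncpow m s * ncpow n s.
Proof. by move=> hm hn; rewrite /ncpow mult_INR Rcpow_mul //; exact: INR_gt0. Qed.
Lemma ncpow_0 n : ncpow n 0 = 1.
Proof. exact: Rcpow_0. Qed.
Lemma ncpow_1 n : (0 < n)%N -> ncpow n 1 = RtoC (INR n).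
Proof. by move=> h; apply: Rcpow_1; exact: INR_gt0. Qed.
Lemma ncpow_1l s : ncpow 1 s = 1.
Proof. by rewrite /ncpow /Rcpow /= ln_1 Cmult_0_r Cexp_0. Qed.
Lemma Cmod_ncpow n s : Cmod (ncpow n s) = exp (Re s * ln (INR n)).
Proof. exact: Cmod_Rcpow. Qed.

Lemma Rcpow_ana x z0 : ana (Rcpow x) z0.
Proof. by apply: ana_exp; apply: ana_mul; [exact: ana_id | exact: ana_const]. Qed.
Lemma ncpow_ana n z0 : ana (ncpow n) z0.
Proof. exact: Rcpow_ana. Qed.

(** * Elementary real inequalities and the p-series *)

Lemma exp_ge_1x x : (1 + x <= exp x)%R.
Proof.
case: (Req_dec x 0) => [->|h]; first by rewrite exp_0; lra.
by left; exact: exp_ineq1.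
Qed.

Lemma expm1_le t : (0 <= t)%R -> (exp t - 1 <= t * exp t)%R.
Proof.
move=> ht; have h := exp_ge_1x (- t); rewrite exp_Ropp in h.
have e0 := exp_pos t; have := Rmult_le_compat_r (exp t) _ _ (Rlt_le _ _ e0) h.
by rewrite Rinv_l; lra.
Qed.

Lemma expm1x_le t : (0 <= t)%R -> (exp t - 1 - t <= t * t * exp t)%R.
Proof.
move=> ht; have h := expm1_le ht.
have := Rmult_le_compat_l t _ _ ht h; lra.
Qed.

Lemma ln_le_sub1 x : (0 < x)%R -> (ln x <= x - 1)%R.
Proof.
move=> hx; apply: Rnot_lt_le => h; have := exp_increasing _ _ h.
by rewrite exp_ln //; have := exp_ge_1x (x - 1); lra.
Qed.

Lemma ln_ge_1sub x : (0 < x)%R -> (1 - / x <= ln x)%R.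
Proof.
move=> hx; have := ln_le_sub1 (Rinv_0_lt_compat _ hx); rewrite ln_Rinv //; lra.
Qed.

(** Telescoping: [k^(-p)] is at most a constant times [k^(1-p) - (k+1)^(1-p)]. *)
Lemma pseries_bound p : (1 < p)%R ->
  exists B, forall n, (\rsum_(0 <= k < n) exp (- p * ln (INR k.+1)) <= B)%R.
Proof.
move=> hp; pose q := (p - 1)%R; have hq : (0 < q)%R by rewrite /q; lra.
pose T k := exp (- q * ln (INR k.+1)).
pose c := (2 * (q + 1) / q)%R.
have c0 : (0 <= c)%R by apply: Rlt_le; apply: Rdiv_lt_0_compat; lra.
have Tpos k : (0 < T k)%R by exact: exp_pos.
have step k : (exp (- p * ln (INR k.+1)) <= c * (T k - T k.+1))%R.
  have hx : (0 < INR k.+1)%R by apply: INR_gt0.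
  set x := INR k.+1 in hx *.
  have x1 : (1 <= x)%R by rewrite /x S_INR; have := pos_INR k; lra.
  have -> : T k.+1 = (T k * exp (- q * ln (1 + / x)))%R.
    rewrite /T -exp_plus; congr exp; rewrite (S_INR k.+1) -/x.
    have -> : (x + 1 = x * (1 + / x))%R by field; lra.
    rewrite ln_mult //; last by have := Rinv_0_lt_compat _ hx; lra.
    by ring.
  have -> : exp (- p * ln x) = (T k * / x)%R.
    by rewrite /T -/x -{3}(exp_ln x hx) -exp_Ropp -exp_plus; congr exp; rewrite /q; ring.
  set l := ln (1 + / x).
  have ix : (0 < / x)%R := Rinv_0_lt_compat _ hx.
  have ix1 : (/ x <= 1)%R by rewrite -Rinv_1; apply: Rinv_le_contravar; lra.
  have hl : (/ x / 2 <= l)%R.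
    have := @ln_ge_1sub (1 + / x)%R ltac:(lra); rewrite -/l => h; apply: Rle_trans h.
    have -> : (1 - / (1 + / x) = / x * / (1 + / x))%R by field; split; lra.
    rewrite /Rdiv; apply: Rmult_le_compat_l; first by lra.
    by apply: Rinv_le_contravar; lra.
  have hl1 : (l <= 1)%R by have := @ln_le_sub1 (1 + / x)%R ltac:(lra); rewrite -/l; lra.
  have he : (q * l / (1 + q) <= 1 - exp (- q * l))%R.
    have hql : (0 <= q * l)%R by apply: Rmult_le_pos; lra.
    have hE := exp_ge_1x (q * l).
    have : (exp (- q * l) <= / (1 + q * l))%R.
      by rewrite (_ : - q * l = - (q * l))%R ?exp_Ropp; [apply: Rinv_le_contravar; lra | ring].
    move=> h; suff : (q * l / (1 + q) <= 1 - / (1 + q * l))%R by lra.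
    have -> : (1 - / (1 + q * l) = q * l * / (1 + q * l))%R by field; lra.
    rewrite /Rdiv; apply: Rmult_le_compat_l => //.
    apply: Rinv_le_contravar; first by lra.
    by have := Rmult_le_compat_l q _ _ (Rlt_le _ _ hq) hl1; lra.
  have -> : (c * (T k - T k * exp (- q * l)) = T k * (c * (1 - exp (- q * l))))%R by ring.
  apply: Rmult_le_compat_l; first by left.
  apply: Rle_trans (Rmult_le_compat_l _ _ _ c0 he).
  have -> : (c * (q * l / (1 + q)) = 2 * l)%R by rewrite /c; field; lra.
  by lra.
exists (c * 1)%R => n; apply: Rle_trans (_ : (\rsum_(0 <= k < n) (c * (T k - T k.+1)) <= _)%R).
  exact: rsum_le.
rewrite -rsum_mull; apply: Rmult_le_compat_l => //.
have -> : \rsum_(0 <= k < n) (T k - T k.+1) = (T 0%N - T n)%R.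
  elim: n => [|n IH]; first by rewrite big_geq //; ring.
  by rewrite big_nat_recr // IH /=; ring.
have T0 : T 0%N = 1%R by rewrite /T /= ln_1 Rmult_0_r exp_0.
by have := Tpos n; lra.
Qed.

Lemma inv_sq_bound : exists B, forall n, (\rsum_(0 <= k < n) (/ (INR k.+1 * INR k.+1)) <= B)%R.
Proof.
have [B HB] := @pseries_bound 2 ltac:(lra); exists B => n; apply: Rle_trans (HB n).
apply: rsum_le => k _; have hx : (0 < INR k.+1)%R by apply: INR_gt0.
rewrite (_ : - (2) * ln (INR k.+1) = - (ln (INR k.+1) + ln (INR k.+1)))%R; last by ring.
by rewrite exp_Ropp exp_plus exp_ln //; lra.
Qed.

(** * Infinite products *)

(** The partial products are bounded in norm by [exp] of the sum of the [D m], and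
    their successive differences [P m * d m] are therefore summable in norm. *)
Lemma nps_prod (P d : nat -> C -> C) z0 r (D : nat -> R) S M0 : (0 < r)%R ->
  (forall m, nps (d m) z0 r (D m)) -> (forall n, (\rsum_(0 <= m < n) D m <= S)%R) ->
  nps (P 0%N) z0 r M0 -> (forall m z, P m.+1 z = P m z * (1 + d m z)) ->
  exists Q M, nps Q z0 r M /\ forall z, (Cmod (z - z0) <= r)%R -> Clim (fun m => P m z) (Q z).
Proof.
move=> Hr Hd HS H0 Hrec.
have D0 m : (0 <= D m)%R by have [a [Ha _]] := Hd m; exact: asum_ge0 Ha.
have M00 : (0 <= M0)%R by have [a [Ha _]] := H0; exact: asum_ge0 Ha.
have HP m : nps (P m) z0 r (M0 * exp (\rsum_(0 <= k < m) D k)).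
  elim: m => [|m IH]; first by rewrite big_geq // exp_0 Rmult_1_r.
  have h1 := nps_add (nps_const 1 z0 (Rlt_le _ _ Hr)) (Hd m).
  apply: nps_ext (nps_weaken _ (nps_mul IH h1)); first by move=> z _; rewrite Hrec.
  rewrite big_nat_recr //= exp_plus -Rmult_assoc; apply: Rmult_le_compat_l.
    by apply: Rmult_le_pos => //; left; exact: exp_pos.
  by rewrite Cmod_1; exact: exp_ge_1x.
pose B := (M0 * exp S)%R.
have HPB m : nps (P m) z0 r B.
  apply: nps_weaken (HP m); apply: Rmult_le_compat_l => //.
  by case: (Req_dec (\rsum_(0 <= k < m) D k) S) => [->|h]; [lra | left; apply: exp_increasing; have := HS m; lra].
have B0 : (0 <= B)%R by apply: Rmult_le_pos => //; left; exact: exp_pos.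
have HF m : nps (fun z => P m z * d m z) z0 r (B * D m) by exact: nps_mul.
have HBS n : (\rsum_(0 <= m < n) (B * D m) <= B * S)%R.
  by rewrite -rsum_mull; apply: Rmult_le_compat_l.
have part z n : \csum_(0 <= m < n) (P m z * d m z) = P n z - P 0%N z.
  elim: n => [|n IH]; first by rewrite big_geq //; ring.
  by rewrite big_nat_recr //= IH Hrec; ring.
have /choice_fun [G HG] : forall z, exists g, (Cmod (z - z0) <= r)%R -> Csum (fun m => P m z * d m z) g.
  move=> z; case: (Rle_dec (Cmod (z - z0)) r) => Hz; last by exists 0.
  have [g Hg] := @asum_conv (fun m => P m z * d m z) (B * S) (asum_dom (fun m => nps_val Hz (HF m)) HBS).
  by exists g.
exists (fun z => P 0%N z + G z), (M0 + B * S)%R; split.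
  by apply: nps_add => //; exact: (nps_sum Hr HF HBS HG).
move=> z Hz; apply: Clim_ext (Clim_add (Clim_const (P 0%N z)) (HG z Hz)) => n.
by rewrite part; ring.
Qed.

(** From an index on, where the tail of [D] is at most [1/2], the partial products
    lose at most half of their modulus. *)
Lemma prod_neq0 (u d : nat -> C) (D : nat -> R) S l : (forall m, (0 <= D m)%R) ->
  (forall n, (\rsum_(0 <= m < n) D m <= S)%R) -> (forall m, (Cmod (d m) <= D m)%R) ->
  (forall m, u m.+1 = u m * (1 + d m)) -> (forall m, u m <> 0) -> Clim u l -> l <> 0.
Proof.
move=> D0 HS Hd Hrec Hu Hl.
have [X HX] := series_tail D0 HS (eps := (1/2)%R) ltac:(lra).
have uX := proj1 (Cmod_gt_0 _) (Hu X).
have low n : (X <= n)%N -> (Cmod (u X) * (1 - \rsum_(X <= m < n) D m) <= Cmod (u n))%R.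
  move=> Hn; rewrite -(subnKC Hn); elim: (n - X)%N => [|k IH].
    by rewrite addn0 big_geq //; lra.
  rewrite addnS big_nat_recr /=; last by lia.
  have hs := HX X (X + k)%N (leqnn _); set s := \rsum_(X <= i < X + k) D i in IH hs *.
  rewrite Hrec Cmod_mult.
  have h1 : (1 - D (X + k)%N <= Cmod (1 + d (X + k)%N))%R.
    have := Cmod_triangle (1 + d (X + k)%N) (- d (X + k)%N); rewrite Cmod_opp.
    rewrite (_ : 1 + d (X + k)%N + - d (X + k)%N = 1); last by ring.
    by rewrite Cmod_1; have := Hd (X + k)%N; lra.
  have s0 : (0 <= s)%R by apply: rsum_ge0.
  have Dk := D0 (X + k)%N; have HD2 := HX (X + k)%N (X + k).+1 ltac:(lia).
  rewrite big_nat1 in HD2.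
  apply: Rle_trans (Rmult_le_compat _ _ _ _ _ _ IH h1); try lra.
    rewrite Rmult_assoc; apply: Rmult_le_compat_l; first by lra.
    by have := Rmult_le_pos _ _ s0 Dk; lra.
  by apply: Rmult_le_pos; lra.
move=> h0; have h := Clim_mod Hl; rewrite h0 Cmod_0 in h.
have := is_lim_seq_le_loc (fun=> Cmod (u X) / 2)%R _ (Cmod (u X) / 2)%R 0%R _ (is_lim_seq_const _) h.
rewrite /= => /(_ _) h2; have : (Cmod (u X) / 2 <= 0)%R; last by lra.
apply: h2; exists X => n /leP Hn; have := low n Hn; have := HX X n (leqnn _).
have tr (s : R) : (s <= 1/2 -> Cmod (u X) * (1 - s) <= Cmod (u n) -> Cmod (u X) / 2 <= Cmod (u n))%R.
  move=> a b; apply: Rle_trans b; rewrite /Rdiv; apply: Rmult_le_compat_l; lra.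
exact: tr.
Qed.

(** * The Gamma function *)

(** The inverse of Gauss's product, whose limit is entire. *)
Definition rgamma_seq (z : C) (n : nat) : C :=
  \big[Cmult/RtoC 1]_(0 <= k < n.+1) (z + RtoC (INR k)) * ncpow n (- z) / RtoC (INR n`!).

Lemma RtoC_INR_neq0 n : (0 < n)%N -> RtoC (INR n) <> 0.
Proof. by move=> h /RtoC_inj; have := INR_gt0 h; lra. Qed.

Lemma RtoC_fact_neq0 n : RtoC (INR n`!) <> 0.
Proof. by apply: RtoC_INR_neq0; exact: fact_gt0. Qed.

(** The relative increment of [rgamma_seq]: [1 + gdel] is
    [(1 + z/(n+1)) (n/(n+1))^z], which is [1 + O(1/n^2)]. *)
Definition gdel (m : nat) (z : C) : C :=
  (1 + z / RtoC (INR m.+2)) * Cexp (z * RtoC (ln (INR m.+1) - ln (INR m.+2))) - 1.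

Lemma rgamma_seq_rec z m :
  rgamma_seq z m.+2 = rgamma_seq z m.+1 * (1 + gdel m z).
Proof.
rewrite /rgamma_seq /gdel big_nat_recr // factS mult_INR RtoC_mult.
set P := \big[Cmult/RtoC 1]_(0 <= k < m.+2) _.
have h1 := @RtoC_fact_neq0 m.+1; have h2 := @RtoC_INR_neq0 m.+2 isT.
have -> : ncpow m.+2 (- z) = ncpow m.+1 (- z) * Cexp (z * RtoC (ln (INR m.+1) - ln (INR m.+2))).
  by rewrite /ncpow /Rcpow -Cexp_add RtoC_minus; congr Cexp; ring.
by rewrite /=; field; split.
Qed.

(** With [L = ln (n/(n+1))], the increment splits as
    [(exp (zL) - 1 - zL) + z (L + 1/(n+1)) + z/(n+1) (exp (zL) - 1)], and each of the
    three parts is quadratically small. *)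
Lemma gdel_bound z0 r : (0 < r)%R -> exists K, (0 <= K)%R /\
  forall m, nps (gdel m) z0 r (K * / (INR m.+1 * INR m.+1)).
Proof.
move=> Hr; pose R0 := (Cmod z0 + r)%R.
have hR : (0 <= R0)%R by rewrite /R0; have := Cmod_ge_0 z0; lra.
pose E := exp R0; have hE : (0 < E)%R := exp_pos _.
pose K := (R0 * R0 * E + R0 + R0 * R0 * E)%R.
exists K; split.
  have h := Rmult_le_pos _ _ hR hR; have := Rmult_le_pos _ _ h (Rlt_le _ _ hE); rewrite /K; lra.
move=> m; have hx : (0 < INR m.+1)%R by apply: INR_gt0.
have x1 : (1 <= INR m.+1)%R by rewrite S_INR; have := pos_INR m; lra.
have hy : INR m.+2 = (INR m.+1 + 1)%R by rewrite S_INR.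
set x := INR m.+1 in hx x1 hy *; set L := (ln x - ln (INR m.+2))%R.
have ix : (0 < / x)%R := Rinv_0_lt_compat _ hx.
have ix1 : (/ x <= 1)%R by rewrite -Rinv_1; apply: Rinv_le_contravar; lra.
have EL : L = (- ln (1 + / x))%R.
  rewrite /L hy (_ : x + 1 = x * (1 + / x))%R; last by field; lra.
  by rewrite ln_mult //; lra.
have l1 : (ln (1 + / x) <= / x)%R by have := @ln_le_sub1 (1 + / x)%R ltac:(lra); lra.
have l2 : (/ (x + 1) <= ln (1 + / x))%R.
  have := @ln_ge_1sub (1 + / x)%R ltac:(lra).
  by have -> : (1 - / (1 + / x) = / (x + 1))%R by field; lra.
have iy : (0 < / (x + 1))%R by apply: Rinv_0_lt_compat; lra.
have absL : (Rabs L <= / x)%R by rewrite EL Rabs_Ropp Rabs_pos_eq; lra.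
have absL2 : (Rabs (L + / INR m.+2) <= / (x * x))%R.
  rewrite EL hy -Rabs_Ropp Rabs_pos_eq; last by lra.
  have : (/ x - / (x + 1) = / (x * (x + 1)))%R by field; lra.
  have : (/ (x * (x + 1)) <= / (x * x))%R.
    by apply: Rinv_le_contravar; [exact: Rmult_lt_0_compat | apply: Rmult_le_compat_l; lra].
  by lra.
have hr := Rlt_le _ _ Hr.
have Hz := nps_id z0 hr; rewrite -/R0 in Hz.
have HzL : nps (fun z => RtoC L * z) z0 r (/ x * R0).
  apply: nps_weaken (nps_scal (RtoC L) hr Hz); rewrite Cmod_R.
  exact: Rmult_le_compat_r.
have H1 := nps_expm1x Hr HzL; have H2 := nps_expm1 Hr HzL.
have H3 := nps_scal (RtoC (L + / INR m.+2)) hr Hz.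
have H4 := nps_mul (nps_scal (RtoC (/ INR m.+2)) hr Hz) H2.
apply: nps_ext (nps_weaken _ (nps_add (nps_add H1 H3) H4)).
  move=> z _; rewrite /gdel -/x -/L RtoC_plus (Cmult_comm z (RtoC L)) RtoC_inv; last first.
    by rewrite hy; lra.
  rewrite /Cdiv; set e := Cexp _; set w := RtoC L; set y := / RtoC _; ring.
rewrite !Cmod_R.
set t := (/ x * R0)%R.
have t0 : (0 <= t)%R by apply: Rmult_le_pos => //; lra.
have tR : (t <= R0)%R by rewrite /t -{2}(Rmult_1_l R0); apply: Rmult_le_compat_r.
have et : (exp t <= E)%R.
  by case: (Req_dec t R0) => [->|h]; [rewrite /E; lra | left; apply: exp_increasing; lra].
have b1 : (exp t - 1 - t <= R0 * R0 * E * / (x * x))%R.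
  apply: Rle_trans (expm1x_le t0) _.
  rewrite (_ : R0 * R0 * E * / (x * x) = t * t * E)%R; last by rewrite /t; field; lra.
  by apply: Rmult_le_compat_l => //; exact: Rmult_le_pos.
have b2 : (Rabs (L + / INR m.+2) * R0 <= R0 * / (x * x))%R.
  by rewrite (Rmult_comm R0); apply: Rmult_le_compat_r.
have b3 : (Rabs (/ INR m.+2) * R0 * (exp t - 1) <= R0 * R0 * E * / (x * x))%R.
  rewrite hy Rabs_pos_eq; last by lra.
  apply: Rle_trans (_ : (/ x * R0 * (t * E) <= _)%R).
    apply: Rmult_le_compat; [apply: Rmult_le_pos; lra | have := exp_ge_1x t; lra | |].
      by apply: Rmult_le_compat_r => //; apply: Rinv_le_contravar; lra.
    by apply: Rle_trans (expm1_le t0) _; apply: Rmult_le_compat_l.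
  by rewrite /t; right; field; lra.
by rewrite /K; lra.
Qed.

Lemma rgamma_ex : exists RG : C -> C, (forall z, ana RG z) /\
  (forall z, Clim (rgamma_seq z) (RG z)).
Proof.
have H z0 r : (0 < r)%R -> exists Q M, nps Q z0 r M /\
    forall z, (Cmod (z - z0) <= r)%R -> Clim (rgamma_seq z) (Q z).
  move=> Hr; have [K [K0 HK]] := gdel_bound z0 Hr.
  have [B HB] := inv_sq_bound.
  have [M0 H0] : exists M, nps (fun z => rgamma_seq z 1) z0 r M.
    have hr := Rlt_le _ _ Hr; have Hz := nps_id z0 hr.
    exists ((Cmod z0 + r) * (Cmod z0 + r + Cmod 1))%R.
    apply: nps_ext (nps_mul Hz (nps_add Hz (nps_const 1 z0 hr))) => z _.
    rewrite /rgamma_seq !big_nat_recr //= big_geq // ncpow_1l /=; field.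
  have HS n : (\rsum_(0 <= m < n) (K * / (INR m.+1 * INR m.+1)) <= K * B)%R.
    by rewrite -rsum_mull; apply: Rmult_le_compat_l.
  have [Q [M [HQ HL]]] := @nps_prod (fun m z => rgamma_seq z m.+1) gdel z0 r _ (K * B)%R M0 Hr HK HS H0
    (fun m z => rgamma_seq_rec z m).
  exists Q, M; split=> // z Hz.
  by apply/Clim_shift; exact: HL.
have /choice_fun [RG HRG] : forall z, exists l, Clim (rgamma_seq z) l.
  move=> z; have [Q [M [_ HQ]]] := H z 1%R ltac:(lra).
  by exists (Q z); apply: HQ; rewrite Csub_diag Cmod_0; lra.
exists RG; split=> // z0; have [Q [M [HQ HL]]] := H z0 1%R ltac:(lra).
exists 1%R, M; split; first by lra.
by apply: nps_ext HQ => z Hz; exact: Clim_uniq (HL z Hz) (HRG z).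
Qed.

Definition rgamma : C -> C := proj1_sig (constructive_indefinite_description _ rgamma_ex).

Lemma rgamma_ana z : ana rgamma z.
Proof. by rewrite /rgamma; case: constructive_indefinite_description => f /= []. Qed.

Lemma rgamma_lim z : Clim (rgamma_seq z) (rgamma z).
Proof. by rewrite /rgamma; case: constructive_indefinite_description => f /= []. Qed.

Lemma Gamma_eq z : rgamma z <> 0 -> Gamma z = / rgamma z.
Proof.
move=> h; have H : Clim (Gamma_seq z) (/ rgamma z).
  apply: Clim_ext (Clim_inv h (rgamma_lim z)) => n.
  rewrite /rgamma_seq /Gamma_seq ncpow_opp.
  set P := \big[Cmult/RtoC 1]_(0 <= k < n.+1) _.
  have h1 := @RtoC_fact_neq0 n; have h2 := @ncpow_neq0 n z.
  case: (classic (P = 0)) => hP; last by field; do !split.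
  by rewrite hP /Cdiv !Cmult_0_l /Cinv /= !Rmult_0_l Rplus_0_l /Rdiv Rinv_0 Ropp_0 !Rmult_0_r;
     rewrite /Cmult /=; congr pair; ring.
pose Q := fun l : C => filterlim (Gamma_seq z) eventually (locally (l : C_UniformSpace)).
have hQ : exists l, Q l by exists (/ rgamma z); apply/Clim_filterlim.
have /Clim_filterlim h2 := epsilon_spec (inhabits (RtoC 0)) Q hQ.
exact: Clim_uniq h2 H.
Qed.

Lemma rgamma_neq0 z : (forall k, z + RtoC (INR k) <> 0) -> rgamma z <> 0.
Proof.
move=> Hz; have [K [K0 HK]] := @gdel_bound z 1%R ltac:(lra); have [B HB] := inv_sq_bound.
apply: (@prod_neq0 (fun m => rgamma_seq z m.+1) (fun m => gdel m z) (fun m => K * / (INR m.+1 * INR m.+1))%R (K * B)%R).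
- move=> m; apply: Rmult_le_pos => //; left; apply: Rinv_0_lt_compat.
  by apply: Rmult_lt_0_compat; exact: INR_gt0.
- by move=> n; rewrite -rsum_mull; apply: Rmult_le_compat_l.
- by move=> m; apply: nps_val (HK m); rewrite Csub_diag Cmod_0; lra.
- by move=> m; exact: rgamma_seq_rec.
- move=> m; rewrite /rgamma_seq; apply: Cmult_neq_0; last by apply: Cinv_neq0; exact: RtoC_fact_neq0.
  apply: Cmult_neq_0; last exact: ncpow_neq0.
  elim/big_rec: _ => [|k x _ hx]; first by move=> /RtoC_inj; lra.
  exact: Cmult_neq_0.
by apply/(Clim_shift (rgamma_seq z)); exact: rgamma_lim.
Qed.

Lemma rgamma_neq0_pos z : (0 < Re z)%R -> rgamma z <> 0.
Proof.
move=> h; apply: rgamma_neq0 => k E; have : Re (z + RtoC (INR k)) = 0%R by rewrite E.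
by rewrite /=; have := pos_INR k; case: z h {E} => a b /=; lra.
Qed.

(** By the identity theorem [1/Gamma] has isolated zeros. *)
Lemma Gamma_wm z0 : wm Gamma z0.
Proof.
have Hr z : wm rgamma z by apply: ana_wm; exact: rgamma_ana.
have H : ~ punct (fun z => rgamma z = 0) z0.
  move=> h; have h1 := @wm_identity rgamma z0 1 Hr h.
  have h2 := near_punct (ana_neq0 (rgamma_neq0_pos (z := 1) Rlt_0_1) (rgamma_ana 1)).
  by have [z [e ne]] := punct_ex (punct_and h1 h2).
apply: wm_ext (wm_inv (Hr z0) H).
have [//|h] := wm_dichotomy (Hr z0).
by apply: punct_imp h => z hz; rewrite Gamma_eq.
Qed.

(** * Binomial coefficients *)

(** The coefficient of [u^j] in [(1 - u)^(-v)]. *)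
Definition bcoef (v : C) (j : nat) : C :=
  \big[Cmult/RtoC 1]_(0 <= i < j) (v + RtoC (INR i)) / RtoC (INR j`!).

Lemma bcoef_0 v : bcoef v 0 = 1.
Proof. by rewrite /bcoef big_geq //= ; field. Qed.

Lemma bcoef_S v j : RtoC (INR j.+1) * bcoef v j.+1 = (v + RtoC (INR j)) * bcoef v j.
Proof.
rewrite /bcoef cprod_recr factS mult_INR RtoC_mult.
have h1 := @RtoC_fact_neq0 j; have h2 := @RtoC_INR_neq0 j.+1 isT.
by field; split.
Qed.

Lemma bcoef_diff v j : bcoef (v + 1) j.+1 - bcoef (v + 1) j = bcoef v j.+1.
Proof.
have h1 := @RtoC_fact_neq0 j; have h2 := @RtoC_INR_neq0 j.+1 isT.
have E : bcoef v j.+1 = v * bcoef (v + 1) j / RtoC (INR j.+1).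
  rewrite /bcoef cprod_recl factS mult_INR RtoC_mult.
  rewrite (eq_bigr (fun i => v + 1 + RtoC (INR i))); last by move=> i _; rewrite S_INR RtoC_plus; ring.
  set P := \big[Cmult/RtoC 1]_(0 <= k < j) _; rewrite (_ : RtoC (INR 0) = 0) //.
  by field; split.
have E2 : bcoef (v + 1) j.+1 = (v + 1 + RtoC (INR j)) * bcoef (v + 1) j / RtoC (INR j.+1).
  by rewrite -bcoef_S; field.
rewrite E E2; move: h2; rewrite S_INR RtoC_plus => h2; by field.
Qed.

Lemma inv_INR_lim : is_lim_seq (fun n => / INR n)%R 0%R.
Proof.
have := is_lim_seq_inv _ _ is_lim_seq_INR; by apply.
Qed.

(** Gauss's limit for Gamma, up to the factor [n / (w + n)]. *)
Lemma bcoef_lim w : Clim (fun n => bcoef w n * ncpow n (1 - w)) (rgamma w).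
Proof.
pose q n := 1 + w * RtoC (/ INR n).
have hq : Clim q 1.
  have := Clim_add (Clim_const 1) (Clim_scal w (Clim_RtoC inv_INR_lim)).
  by rewrite Cmult_0_r Cplus_0_r.
have hqi := Clim_inv C1_nz hq.
have E1 : / 1 = 1 by field.
have := Clim_mul (rgamma_lim w) hqi; rewrite E1 Cmult_1_r; apply: Clim_ext_loc.
have [N HN] := (Clim_eps _ _).1 hq 1%R ltac:(lra).
exists N.+1 => n Hn.
have qn : q n <> 0.
  move=> h; have := HN n ltac:(lia).
  by rewrite h Csub_0_l Cmod_opp Cmod_1; lra.
have n0 : (0 < n)%N by lia.
have h1 := @RtoC_fact_neq0 n; have h2 := @RtoC_INR_neq0 n n0.
rewrite /rgamma_seq /bcoef cprod_recr /Cminus ncpow_add (ncpow_1 n0).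
have -> : w + RtoC (INR n) = RtoC (INR n) * q n.
  by rewrite /q RtoC_inv; [field | move=> h; apply: h2; rewrite h].
by field; split.
Qed.

Lemma bcoef_bound w : exists B, (0 <= B)%R /\
  forall n, (Cmod (bcoef w n.+1) <= B * exp ((Re w - 1) * ln (INR n.+1)))%R.
Proof.
have [B HB] := Clim_bounded (bcoef_lim w); exists B; split.
  exact: Rle_trans (Cmod_ge_0 _) (HB 0%N).
move=> n; have := HB n.+1; rewrite Cmod_mult Cmod_ncpow.
have -> : Re (1 - w) = (- (Re w - 1))%R by case: w {HB} => a b /=; ring.
rewrite Ropp_mult_distr_l_reverse exp_Ropp; set E := exp _.
have E0 : (0 < E)%R := exp_pos _.
move=> h; have := Rmult_le_compat_r E _ _ (Rlt_le _ _ E0) h.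
by rewrite Rmult_assoc Rinv_l; lra.
Qed.

Lemma bcoef_asum v : (Re v < 0)%R -> exists M, asum (bcoef v) M.
Proof.
move=> hv; have [B [B0 HB]] := bcoef_bound v; have [S HS] := @pseries_bound (1 - Re v) ltac:(lra).
exists (Cmod (bcoef v 0) + B * S)%R; case=> [|n].
  rewrite big_geq //; apply: Rplus_le_le_0_compat; first exact: Cmod_ge_0.
  by apply: Rmult_le_pos => //; have := HS 0%N; rewrite big_geq.
rewrite rsum_recl; apply: Rplus_le_compat_l.
apply: Rle_trans (_ : (\rsum_(0 <= k < n) (B * exp (- (1 - Re v) * ln (INR k.+1))) <= _)%R).
  apply: rsum_le => k _; apply: Rle_trans (HB k) _; right; congr (_ * exp (_ * _))%R; ring.
by rewrite -rsum_mull; apply: Rmult_le_compat_l.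
Qed.

(** * Derivatives of complex functions of a real variable *)

Definition Cderiv (f : R -> C) (x : R) (l : C) :=
  is_derive (fun t => Re (f t)) x (Re l) /\ is_derive (fun t => Im (f t)) x (Im l).

Lemma is_derive_eq (f : R -> R) (x l l' : R) : is_derive f x l -> l = l' -> is_derive f x l'.
Proof. by move=> H <-. Qed.

Lemma Cderiv_mul f g x l m : Cderiv f x l -> Cderiv g x m ->
  Cderiv (fun t => f t * g t) x (l * g x + f x * m).
Proof.
have aux (f1 f2 g1 g2 : R -> R) a b c d : is_derive f1 x a -> is_derive f2 x b ->
    is_derive g1 x c -> is_derive g2 x d ->
    is_derive (fun t => f1 t * g1 t + f2 t * g2 t)%R x (a * g1 x + f1 x * c + (b * g2 x + f2 x * d))%R.
  move=> h1 h2 h3 h4; auto_derive; first by do !split; eexists; eassumption.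
  by rewrite (is_derive_unique _ _ _ h1) (is_derive_unique _ _ _ h2) (is_derive_unique _ _ _ h3) (is_derive_unique _ _ _ h4); ring.
move=> [f1 f2] [g1 g2]; split.
  have h2 : is_derive (fun t => - Im (f t))%R x (- Im l)%R by apply: is_derive_opp.
  apply: is_derive_ext (is_derive_eq (aux _ _ _ _ _ _ _ _ f1 h2 g1 g2) _).
    by move=> t; rewrite /Re /Im /=; lra.
  by rewrite /Re /Im /=; ring.
apply: is_derive_ext (is_derive_eq (aux _ _ _ _ _ _ _ _ f1 f2 g2 g1) _).
  by move=> t; rewrite /Re /Im /=; lra.
by rewrite /Re /Im /=; ring.
Qed.

Lemma Cderiv_scal c f x l : Cderiv f x l -> Cderiv (fun t => c * f t) x (c * l).
Proof.
move=> H; have h0 : Cderiv (fun=> c) x 0 by split; exact: is_derive_const.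
have := Cderiv_mul h0 H; by rewrite Cmult_0_l Cplus_0_l.
Qed.

Lemma Cderiv_exp f x l : Cderiv f x l -> Cderiv (fun t => Cexp (f t)) x (l * Cexp (f x)).
Proof.
have aux (f1 f2 : R -> R) a b : is_derive f1 x a -> is_derive f2 x b ->
    is_derive (fun t => exp (f1 t) * cos (f2 t))%R x (exp (f1 x) * (a * cos (f2 x) - b * sin (f2 x)))%R /\
    is_derive (fun t => exp (f1 t) * sin (f2 t))%R x (exp (f1 x) * (a * sin (f2 x) + b * cos (f2 x)))%R.
  move=> h1 h2; split; (auto_derive; first by do !split; eexists; eassumption);
  by rewrite (is_derive_unique _ _ _ h1) (is_derive_unique _ _ _ h2); ring.
move=> [f1 f2]; have [h1 h2] := aux _ _ _ _ f1 f2; split.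
  apply: is_derive_ext (is_derive_eq h1 _).
    by move=> t; rewrite /Cexp /Re /Im /=; lra.
  by rewrite /Cexp /Re /Im /=; ring.
apply: is_derive_ext (is_derive_eq h2 _).
  by move=> t; rewrite /Cexp /Re /Im /=; lra.
by rewrite /Cexp /Re /Im /=; ring.
Qed.

Lemma Cderiv_zero_const f a b : (a < b)%R -> (forall t, (a <= t <= b)%R -> Cderiv f t 0) -> f a = f b.
Proof.
move=> hab H.
have h1 := eq_is_derive (fun t => Re (f t)) a b (fun t ht => (H t ht).1) hab.
have h2 := eq_is_derive (fun t => Im (f t)) a b (fun t ht => (H t ht).2) hab.
by case: (f a) (f b) h1 h2 => [x y] [x' y'] /= -> ->.
Qed.

Lemma real_series_deriv (a : nat -> R) M (g : R -> R) :
  (forall n, (\rsum_(0 <= k < n) Rabs (a k) <= M)%R) ->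
  (forall t, (Rabs t < 1)%R -> is_lim_seq (fun n => \rsum_(0 <= k < n) (a k * t ^ k)) (g t)) ->
  forall r, (Rabs r < 1)%R -> exists D : R,
    is_lim_seq (fun n => \rsum_(0 <= k < n) (INR k.+1 * a k.+1 * r ^ k)) D /\ is_derive g r D.
Proof.
move=> HM Hg r Hr.
have HCV t : (Rabs t < 1)%R -> Rbar_lt (Rabs t) (CV_radius a).
  move=> ht; apply: (Rbar_lt_le_trans _ 1%R) => //.
  have [ub _] := CV_radius_bounded a; apply: ub; exists M => n.
  rewrite pow1 Rmult_1_r; apply: Rle_trans (HM n.+1); rewrite rsum_recr.
  have : (0 <= \rsum_(0 <= i < n) Rabs (a i))%R by apply: rsum_ge0 => i _; exact: Rabs_pos.
  by lra.
have ser (b : nat -> R) x l : is_pseries b x l -> is_lim_seq (fun n => \rsum_(0 <= k < n) (b k * x ^ k)) l.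
  move=> h; apply/is_lim_seq_incr_1.
  have h' : is_lim_seq (sum_n (fun k => scal (pow_n x k) (b k))) l := h.
  apply: is_lim_seq_ext h' => n; rewrite sum_n_bigR; apply: eq_bigr => k _.
  by rewrite pow_n_pow /scal /= /mult /= Rmult_comm.
have gE t : (Rabs t < 1)%R -> g t = PSeries a t.
  move=> ht; have h1 := is_lim_seq_unique _ _ (Hg t ht).
  have h2 := is_lim_seq_unique _ _ (ser _ _ _ (PSeries_correct _ _ (CV_radius_inside _ _ (HCV t ht)))).
  by rewrite h1 in h2; case: h2.
exists (PSeries (PS_derive a) r); split.
  exact: (ser _ _ _ (PSeries_correct _ _ (ex_pseries_derive _ _ (HCV r Hr)))).
have He : locally r (fun t => PSeries a t = g t).
  exists (mkposreal (1 - Rabs r) ltac:(lra)) => t ht; symmetry; apply: gE.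
  have : (Rabs (t - r) < 1 - Rabs r)%R by exact: ht.
  by have := Rabs_triang (t - r) r; rewrite (_ : t - r + r = t)%R; [lra | ring].
exact: is_derive_ext_loc He (is_derive_PSeries _ _ (HCV r Hr)).
Qed.

Lemma Cderiv_series (a : nat -> C) M (G : R -> C) : asum a M ->
  (forall t, (Rabs t < 1)%R -> Csum (pterm a (RtoC t)) (G t)) ->
  forall r, (Rabs r < 1)%R ->
  exists D, Csum (pterm (fun j => RtoC (INR j.+1) * a j.+1) (RtoC r)) D /\ Cderiv G r D.
Proof.
move=> Ha HG r Hr.
have re_sum (F : nat -> C) n : Re (\csum_(0 <= k < n) F k) = \rsum_(0 <= k < n) Re (F k).
  by elim: n => [|n IH]; [rewrite !big_geq | rewrite csum_recr rsum_recr -IH].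
have im_sum (F : nat -> C) n : Im (\csum_(0 <= k < n) F k) = \rsum_(0 <= k < n) Im (F k).
  by elim: n => [|n IH]; [rewrite !big_geq | rewrite csum_recr rsum_recr -IH].
have re_mul (z : C) t k : Re (z * Cpow (RtoC t) k) = (Re z * t ^ k)%R.
  by rewrite -RtoC_pow /=; rewrite /Re /=; ring.
have im_mul (z : C) t k : Im (z * Cpow (RtoC t) k) = (Im z * t ^ k)%R.
  by rewrite -RtoC_pow /=; rewrite /Im /=; ring.
have re_n (n : nat) (z : C) : Re (RtoC (INR n) * z) = (INR n * Re z)%R by rewrite /Re /=; ring.
have im_n (n : nat) (z : C) : Im (RtoC (INR n) * z) = (INR n * Im z)%R by rewrite /Im /=; ring.
have Lre t : (Rabs t < 1)%R -> is_lim_seq (fun n => \rsum_(0 <= k < n) (Re (a k) * t ^ k)) (Re (G t)).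
  move=> /HG /Clim_re; apply: is_lim_seq_ext => n; rewrite re_sum; apply: eq_bigr => k _.
  by rewrite /pterm re_mul.
have Lim t : (Rabs t < 1)%R -> is_lim_seq (fun n => \rsum_(0 <= k < n) (Im (a k) * t ^ k)) (Im (G t)).
  move=> /HG /Clim_im; apply: is_lim_seq_ext => n; rewrite im_sum; apply: eq_bigr => k _.
  by rewrite /pterm im_mul.
have [D1 [h1 d1]] := @real_series_deriv (fun k => Re (a k)) M (fun t => Re (G t))
  (fun n => Rle_trans _ _ _ (rsum_le _ (fun k _ => re_le_Cmod (a k))) (Ha n)) Lre r Hr.
have [D2 [h2 d2]] := @real_series_deriv (fun k => Im (a k)) M (fun t => Im (G t))
  (fun n => Rle_trans _ _ _ (rsum_le _ (fun k _ => im_le_Cmod (a k))) (Ha n)) Lim r Hr.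
exists (D1, D2); split; last by split.
apply: Clim_reim.
  apply: is_lim_seq_ext h1 => n; rewrite re_sum; apply: eq_bigr => k _.
  by rewrite /pterm re_mul re_n.
apply: is_lim_seq_ext h2 => n; rewrite im_sum; apply: eq_bigr => k _.
by rewrite /pterm im_mul im_n.
Qed.

Lemma Clim_Cexp (w : nat -> C) (l : C) : Clim w l -> Clim (fun n => Cexp (w n)) (Cexp l).
Proof.
move=> H; apply/Clim_eps => eps He.
have [r [Hr hr]] := ana_continuous (eps := (eps/2)%R) ltac:(lra) (ana_exp (ana_id l)).
have [N HN] := (Clim_eps _ _).1 H _ Hr; exists N => n /HN h.
by apply: Rle_lt_trans (hr _ (Rlt_le _ _ h)) _; lra.
Qed.

(** * The binomial series on the unit circle *)

(** The principal logarithm of [1 - e(th)] for [0 < th < 1]; see [Cexp_clog1]. *)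
Definition clog1 (th : R) : C := (ln (2 * sin (PI * th)), PI * (th - 1 / 2))%R.

Lemma e_def x : e x = (cos (2 * PI * x), sin (2 * PI * x))%R.
Proof.
rewrite /e /Cexp /=.
have -> : ((2 * PI - 0 * 0) * 0 - (2 * 0 + 0 * PI) * 1)%R = 0%R by ring.
have -> : ((0 * x - ((2 * PI - 0 * 0) * 1 + (2 * 0 + 0 * PI) * 0) * 0) = 0)%R by ring.
have -> : ((0 * 0 + ((2 * PI - 0 * 0) * 1 + (2 * 0 + 0 * PI) * 0) * x) = 2 * PI * x)%R by ring.
by rewrite exp_0 /RtoC /Cmult /=; congr pair; ring.
Qed.

Lemma e_add x y : e (x + y) = e x * e y.
Proof. by rewrite /e -Cexp_add RtoC_plus; congr Cexp; ring. Qed.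

Lemma e_0 : e 0 = 1.
Proof. by rewrite /e Cmult_0_r Cexp_0. Qed.

Lemma e_opp x : e (- x) = / e x.
Proof. by rewrite /e -Cexp_opp RtoC_opp; congr Cexp; ring. Qed.

Lemma Cmod_e x : Cmod (e x) = 1%R.
Proof. by rewrite /e Cmod_Cexp /= (_ : _ - _ = 0)%R ?exp_0 //; ring. Qed.

Lemma e_INR n : e (INR n) = 1.
Proof.
elim: n => [|n IH]; first exact: e_0.
by rewrite S_INR e_add IH e_def Rmult_1_r cos_2PI sin_2PI /Cmult /RtoC /=; congr pair; ring.
Qed.

Lemma e_pow x n : Cpow (e x) n = e (INR n * x).
Proof. by rewrite /e Cexp_pow; congr Cexp; rewrite RtoC_mult; ring. Qed.

(** Inside the disc both sides satisfy the same first order differential equation along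
    the radius through [e(th)]; Abel's limit theorem, in the form of Tannery's theorem,
    extends the equality to the circle because the coefficients are absolutely summable
    for [Re v < 0]. *)
Lemma binomial_circle v th : (Re v < 0)%R -> (0 < th < 1)%R ->
  Csum (fun j => bcoef v j * e (INR j * th)) (Cexp (- v * clog1 th)).
Proof.
move=> hv hth; have [M HM] := bcoef_asum hv.
set u := e th; set c := cos (2 * PI * th); set s := sin (2 * PI * th).
have uE : u = (c, s) by exact: e_def.
have cs : (s * s + c * c = 1)%R by have := sin2_cos2 (2 * PI * th); rewrite /Rsqr.
have pi0 := PI_RGT_0.
have sp : (0 < sin (PI * th))%R.
  apply: sin_gt_0; first by apply: Rmult_lt_0_compat; lra.
  by rewrite -{2}(Rmult_1_r PI); apply: Rmult_lt_compat_l; lra.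
have cE : c = (1 - 2 * sin (PI * th) * sin (PI * th))%R.
  by rewrite /c Rmult_assoc cos_2a_sin.
have sE : s = (2 * sin (PI * th) * cos (PI * th))%R.
  by rewrite /s Rmult_assoc sin_2a.
have c1 : (c < 1)%R by rewrite cE; have := Rmult_lt_0_compat _ _ sp sp; lra.
have pos1 r : (0 <= r <= 1)%R -> (0 < 1 - r * c)%R.
  move=> hr; case: (Rle_dec c 0) => hc.
    by have := Rmult_le_compat_l r _ _ (proj1 hr) hc; lra.
  by have := Rmult_le_compat_r c _ _ ltac:(lra) (proj2 hr); lra.
pose a j := bcoef v j * Cpow u j.
have Ha : asum a M.
  by apply: asum_ext HM => j; rewrite /a Cmod_mult Cmod_pow Cmod_e pow1 Rmult_1_r.
have /choice_fun [G HG] : forall t, exists g, (Rabs t <= 1)%R -> Csum (pterm a (RtoC t)) g.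
  move=> t; case: (Rle_dec (Rabs t) 1) => ht; last by exists 0.
  have [|g Hg] := @asum_conv (pterm a (RtoC t)) M; last by exists g.
  apply: asum_pterm_r (_ : asum (pterm a (RtoC 1)) M); first by rewrite Cmod_R.
  by apply: asum_ext Ha => j; rewrite Cmod_pterm Cmod_1 pow1 Rmult_1_r.
pose Q r := ((1 - r * c) * (1 - r * c) + (r * s) * (r * s))%R.
have Qpos r : (0 <= r <= 1)%R -> (0 < Q r)%R.
  move=> /pos1 h; have := Rmult_lt_0_compat _ _ h h; have := Rle_0_sqr (r * s); rewrite /Q /Rsqr; lra.
(* a logarithm of [1 - r u]: the real part of [1 - r u] is positive, so the
   arctangent gives its argument for all [r] up to [1] *)
pose Lam (r : R) : C := (ln (Q r) / 2, atan (- (r * s) / (1 - r * c)))%R.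
have dLam r : (0 <= r <= 1)%R -> Cderiv Lam r (- u / (1 - RtoC r * u)).
  move=> hr; have h1 := pos1 r hr; have h2 := Qpos r hr.
  have -> : - u / (1 - RtoC r * u) = ((r - c) / Q r, - s / Q r)%R.
    rewrite uE /Cdiv /Cinv /Cmult /RtoC /Cminus /Cplus /Copp /=.
    have hrc : (r * (s * s + c * c) = r)%R by rewrite cs Rmult_1_r.
    have -> : ((1 + - (r * c - 0 * s)) * ((1 + - (r * c - 0 * s)) * 1) +
       (0 + - (r * s + 0 * c)) * ((0 + - (r * s + 0 * c)) * 1) = Q r)%R by rewrite /Q; ring.
    by rewrite /Rdiv; congr pair; [rewrite -[X in _ = ((X - c) * _)%R]hrc; ring | ring].
  split => /=.
    rewrite /Lam /Q /=; auto_derive; first by rewrite /Q in h2; lra.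
    rewrite /Q in h2 *; have hrc : (r * (s * s + c * c) = r)%R by rewrite cs Rmult_1_r.
    rewrite -[X in _ = ((X - c) / _)%R]hrc; field; lra.
  rewrite /Lam /Q /=; auto_derive; first by move=> h; lra.
  rewrite /Q in h2 *; field; split => h; lra.
pose F r := G r * Cexp (v * Lam r).
have dF r : (0 <= r < 1)%R -> Cderiv F r 0.
  move=> hr; have hr1 : (Rabs r < 1)%R by rewrite Rabs_pos_eq; lra.
  have hGt t : (Rabs t < 1)%R -> Csum (pterm a (RtoC t)) (G t) by move=> ht; apply: HG; lra.
  have [D [HD dG]] := Cderiv_series Ha hGt hr1.
  have dE := Cderiv_exp (Cderiv_scal v (dLam r ltac:(lra))).
  have := Cderiv_mul dG dE.
  have ne : 1 - RtoC r * u <> 0.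
    by have := pos1 r ltac:(lra) => h; rewrite uE => /(f_equal Re); rewrite /Re /=; lra.
  have -> : D * Cexp (v * Lam r) + G r * (v * (- u / (1 - RtoC r * u)) * Cexp (v * Lam r)) = 0; last by [].
  suff ode : D * (1 - RtoC r * u) = v * u * G r.
    have -> : D = v * u * G r / (1 - RtoC r * u) by rewrite -ode; field.
    by field.
  (* the coefficients satisfy (j+1) c_(j+1) = (v+j) c_j *)
  have h1 : Csum (fun j => RtoC (INR j) * a j * Cpow (RtoC r) j) (RtoC r * D).
    have h := Csum_scal (RtoC r) HD.
    rewrite (_ : RtoC r * D = RtoC (INR 0) * a 0%N * Cpow (RtoC r) 0 + RtoC r * D); last by rewrite /=; ring.
    apply/(Csum_shift (fun j => RtoC (INR j) * a j * Cpow (RtoC r) j)).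
    by apply: Csum_ext h => j; rewrite /pterm Cpow_S; ring.
  have h2 : Csum (pterm (fun j => RtoC (INR j.+1) * a j.+1) (RtoC r)) (v * u * G r + u * (RtoC r * D)).
    apply: Csum_ext (Csum_add (Csum_scal (v * u) (HG r ltac:(lra))) (Csum_scal u h1)) => j.
    by rewrite /pterm /a Cpow_S (Cmult_assoc (RtoC (INR j.+1))) bcoef_S; ring.
  have E := Csum_uniq HD h2.
  by transitivity (D - u * (RtoC r * D)); [ring | rewrite {1}E; ring].
have F0 : F 0%R = 1.
  have G0 : G 0%R = 1.
    have := HG 0%R; rewrite Rabs_R0 => /(_ ltac:(lra)) h.
    apply: (Csum_uniq h); apply: (Csum_ext _ (Csum_single 1 0%N)) => -[|j].
      by rewrite /pterm /a bcoef_0 /=; ring.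
    by rewrite /pterm Cpow_S /=; ring.
  have L0 : Lam 0%R = 0.
    rewrite /Lam /Q /RtoC Rmult_0_l Rmult_0_l Rminus_0_r Rmult_0_l Rplus_0_r Rmult_1_l ln_1 /Rdiv.
    by rewrite Rmult_0_l Ropp_0 Rmult_0_l atan_0.
  by rewrite /F G0 L0 Cmult_0_r Cexp_0 Cmult_1_r.
have F1 r : (0 <= r < 1)%R -> F r = 1.
  move=> hr; case: (Req_dec r 0) => [->|h] //.
  by rewrite -F0; symmetry; apply: (Cderiv_zero_const (a := 0) (b := r)); [lra | move=> t ht; apply: dF; lra].
pose rn (n : nat) := (1 - / (INR n + 1))%R.
have rn01 n : (0 <= rn n < 1)%R.
  have h := pos_INR n; have h2 : (0 < / (INR n + 1))%R by apply: Rinv_0_lt_compat; lra.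
  have h3 : (/ (INR n + 1) <= / 1)%R by apply: Rinv_le_contravar; lra.
  by rewrite Rinv_1 in h3; rewrite /rn; lra.
have rnl : is_lim_seq rn 1%R.
  have h : is_lim_seq (fun n => / (INR n + 1))%R 0%R.
    apply: is_lim_seq_ext (proj1 (is_lim_seq_incr_1 _ _) inv_INR_lim) => n.
    by rewrite S_INR.
  have := is_lim_seq_minus' _ _ _ _ (is_lim_seq_const 1) h; by rewrite Rminus_0_r.
have GL : Clim (fun n => G (rn n)) (G 1%R).
  have hab k : (0 <= Cmod (a k))%R by exact: Cmod_ge_0.
  apply: (@tannery (fun n => pterm a (RtoC (rn n))) (pterm a (RtoC 1)) (fun k => Cmod (a k)) M) => //.
  - exists 0%N => n k _; rewrite Cmod_pterm Cmod_RtoC_pos; last by have := rn01 n; lra.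
    rewrite -{2}(Rmult_1_r (Cmod (a k))) -(pow1 k); apply: Rmult_le_compat_l => //.
    by apply: pow_incr; have := rn01 n; lra.
  - move=> k; apply: Clim_scal; elim: k => [|k IH]; first exact: Clim_const.
    exact: (Clim_mul (Clim_RtoC rnl) IH).
  - by move=> n; apply: HG; rewrite Rabs_pos_eq; have := rn01 n; lra.
  - by apply: HG; rewrite Rabs_pos_eq; lra.
have LL : Clim (fun n => Lam (rn n)) (Lam 1%R).
  have [l1 l2] := dLam 1%R ltac:(lra).
  apply: Clim_reim.
    apply: (is_lim_seq_continuous (fun t => Re (Lam t))) rnl.
    have h : continuous (fun t => Re (Lam t)) 1%R by apply: ex_derive_continuous; eexists; exact: l1.
    by apply/continuity_pt_filterlim; exact: h.
  apply: (is_lim_seq_continuous (fun t => Im (Lam t))) rnl.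
  have h : continuous (fun t => Im (Lam t)) 1%R by apply: ex_derive_continuous; eexists; exact: l2.
  by apply/continuity_pt_filterlim; exact: h.
have FL : G 1%R * Cexp (v * Lam 1%R) = 1.
  apply: Clim_uniq (Clim_mul GL (Clim_Cexp (Clim_scal v LL))) _.
  by apply: Clim_ext (Clim_const 1) => n; rewrite -/(F (rn n)) F1.
have L1 : Lam 1%R = clog1 th.
  rewrite /Lam /clog1; congr pair.
    have -> : Q 1%R = (2 * sin (PI * th) * (2 * sin (PI * th)))%R.
      have h : (Q 1 = 1 - 2 * c + (s * s + c * c))%R by rewrite /Q; ring.
      by rewrite h cs cE; ring.
    by rewrite ln_mult; [field | lra | lra].
  have -> : (PI * (th - 1 / 2) = PI * th - PI / 2)%R by field.
  rewrite -[RHS]atan_tan.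
    congr atan; rewrite /tan sin_minus cos_minus sin_PI2 cos_PI2 !Rmult_1_l Rmult_1_r cE sE.
    by field; lra.
  have : (0 < PI * th)%R by apply: Rmult_lt_0_compat; lra.
  have : (PI * th < PI)%R by rewrite -{2}(Rmult_1_r PI); apply: Rmult_lt_compat_l; lra.
  by lra.
have G1 : G 1%R = Cexp (- v * clog1 th).
  rewrite -L1 (_ : - v * Lam 1%R = - (v * Lam 1%R)); last by ring.
  have hE := @Cexp_neq0 (v * Lam 1%R).
  by rewrite Cexp_opp -[RHS]Cmult_1_l -FL -Cmult_assoc Cinv_r // Cmult_1_r.
rewrite -G1; have := HG 1%R; rewrite Rabs_R1 => /(_ (Rle_refl _)); apply: Csum_ext => j.
by rewrite /pterm Cpow_1_l Cmult_1_r /a e_pow.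
Qed.

(** * A discrete form of the Lipschitz formula *)

(** Multiplication of a generating function by the [k]-th power of the variable. *)
Definition delay (k : nat) (f : nat -> C) (j : nat) : C := if (k <= j)%N then f (j - k)%N else 0.

Lemma delay0 f j : delay 0 f j = f j.
Proof. by rewrite /delay subn0. Qed.

Lemma delayS k f j : delay k.+1 f j.+1 = delay k f j.
Proof. by rewrite /delay ltnS subSS. Qed.

Lemma delay_delay a b f j : delay a (delay b f) j = delay (a + b) f j.
Proof.
rewrite /delay; case: (leqP a j) => h1; case: (leqP (a + b) j) => h2 //.
- by rewrite (_ : (b <= j - a)%N = true) ?subnDA //; lia.
- by rewrite (_ : (b <= j - a)%N = false) //; lia.
- by lia.
Qed.

Lemma delay_sub k f g j : delay k (fun i => f i - g i) j = delay k f j - delay k g j.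
Proof. by rewrite /delay; case: ifP => // _; ring. Qed.

Lemma Csum_delay k f l : Csum f l -> Csum (delay k f) l.
Proof.
move=> Hf; elim: k => [|k IH]; first by apply: Csum_ext Hf => j; rewrite delay0.
have := (Csum_shift (delay k.+1 f) l).1; rewrite {2}/delay Cplus_0_l; apply.
by apply: Csum_ext IH => j; rewrite delayS.
Qed.

Lemma delay_telescope N f j :
  \csum_(0 <= b < N) delay b (fun i => f i - delay 1 f i) j = f j - delay N f j.
Proof.
elim: N => [|N IH]; first by rewrite big_geq // delay0; ring.
by rewrite csum_recr IH delay_sub delay_delay addn1; ring.
Qed.

Lemma bcoef_delay v j : bcoef v j = bcoef (v + 1) j - delay 1 (bcoef (v + 1)) j.
Proof.
case: j => [|j]; first by rewrite /delay /= !bcoef_0; ring.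
by rewrite delayS delay0 bcoef_diff.
Qed.

(** The coefficients of [((1 - U^N)/(1 - U))^2 (1 - U)^(-v)]. *)
Definition bstep (v : C) (N j : nat) : C :=
  \csum_(0 <= a < N) \csum_(0 <= b < N) delay (a + b) (bcoef v) j.

Lemma delay_ext k f g j : (forall i, f i = g i) -> delay k f j = delay k g j.
Proof. by move=> H; rewrite /delay; case: ifP. Qed.

(** The denominator is absorbed in [(1 - U)^(-v)], which becomes [(1 - U)^(-v-2)], and
    [(1 - U^N)^2] is expanded. This form gives the limit as [N]
    grows, while the definition, a sum of [N^2] small terms, gives the dominating
    bound. *)
Lemma bstepE v N j : bstep v N j =
  bcoef (v + 2) j - 2 * delay N (bcoef (v + 2)) j + delay (N + N) (bcoef (v + 2)) j.
Proof.
have S1 u i : \csum_(0 <= b < N) delay b (bcoef u) i = bcoef (u + 1) i - delay N (bcoef (u + 1)) i.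
  rewrite -(delay_telescope N (bcoef (u + 1))); apply: eq_bigr => b _.
  by apply: delay_ext => k; exact: bcoef_delay.
rewrite /bstep; transitivity (\csum_(0 <= a < N) (delay a (bcoef (v + 1)) j - delay N (delay a (bcoef (v + 1))) j)).
  apply: eq_bigr => a _; rewrite delay_delay addnC -delay_delay -delay_sub.
  have -> : delay a (fun i => bcoef (v + 1) i - delay N (bcoef (v + 1)) i) j =
            delay a (fun i => \csum_(0 <= b < N) delay b (bcoef v) i) j.
    by apply: delay_ext => i; rewrite S1.
  rewrite {2}/delay; case: ifP => h.
    apply: eq_bigr => b _; rewrite -delay_delay /delay h //.
  rewrite big1 // => b _; rewrite /delay; case: ifP => //; lia.
rewrite -csum_sub S1.
have -> : \csum_(0 <= a < N) delay N (delay a (bcoef (v + 1))) j =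
   delay N (fun i => \csum_(0 <= a < N) delay a (bcoef (v + 1)) i) j.
  by rewrite /delay; case: ifP => // _; rewrite big1.
rewrite (delay_ext _ _ (fun i => S1 (v + 1) i)) delay_sub delay_delay.
have -> : v + 1 + 1 = v + 2 by ring.
by ring.
Qed.

Lemma bstep_series v N u g : Csum (fun j => bcoef v j * Cpow u j) g ->
  Csum (fun j => bstep v N j * Cpow u j)
       ((\csum_(0 <= a < N) Cpow u a) * (\csum_(0 <= a < N) Cpow u a) * g).
Proof.
move=> Hg.
have h a b : Csum (fun j => delay (a + b) (bcoef v) j * Cpow u j) (Cpow u a * Cpow u b * g).
  apply: Csum_ext (Csum_scal (Cpow u a * Cpow u b) (Csum_delay (a + b) Hg)) => j.
  rewrite /delay; case: ifP => hj; last by ring.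
  have -> : Cpow u j = Cpow u a * Cpow u b * Cpow u (j - (a + b)).
    by rewrite -!Cpow_add_r; congr Cpow; lia.
  by ring.
have := Csum_csum (index_iota 0 N) (fun a (_ : xpredT a) => Csum_csum (index_iota 0 N) (fun b (_ : xpredT b) => h a b)).
have -> : \csum_(0 <= i < N) \csum_(0 <= i0 < N) (Cpow u i * Cpow u i0 * g) =
   (\csum_(0 <= a < N) Cpow u a) * (\csum_(0 <= a < N) Cpow u a) * g.
  rewrite -Cmult_assoc csum_mulr; apply: eq_bigr => a _.
  by rewrite csum_mulr csum_mull; apply: eq_bigr => b _; ring.
apply: Csum_ext => j; rewrite /bstep csum_mulr; apply: eq_bigr => a _; by rewrite csum_mulr.
Qed.

Lemma Csum_subseq N (f : nat -> C) l : (0 < N)%N ->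
  Csum (fun j => if (N %| j)%N then f (j %/ N)%N else 0) l -> Csum f l.
Proof.
move=> HN H.
have E m : \csum_(0 <= j < m * N) (if (N %| j)%N then f (j %/ N)%N else 0) = \csum_(0 <= k < m) f k.
  elim: m => [|m IH]; first by rewrite mul0n !big_geq.
  rewrite mulSn (@big_cat_nat _ _ _ (m * N)) //=; last by rewrite leq_addl.
  rewrite IH csum_recr; congr Cplus.
  rewrite big_nat_shift.
  case: N HN {H IH} => // N _; rewrite csum_recl add0n dvdn_mull // mulnK //.
  rewrite big_nat big1 ?Cplus_0_r // => i Hi.
  rewrite addnC dvdn_addr ?dvdn_mull //.
  by case: ifP => // /dvdnP [q Hq]; case: q Hq => [|q]; lia.
apply: Clim_ext (Clim_subseq (phi := fun m => (m * N)%N) _ H) => n; first exact: E.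
by rewrite leq_pmulr.
Qed.

Lemma roots_sum N j : (0 < N)%N ->
  \csum_(0 <= n < N) e (INR j * (INR n / INR N)) = if (N %| j)%N then RtoC (INR N) else 0.
Proof.
move=> HN; have hN := INR_gt0 HN; have hN0 : INR N <> 0%R by lra.
pose q := e (INR j / INR N).
have Eq n : e (INR j * (INR n / INR N)) = Cpow q n.
  by rewrite /q e_pow; congr e; field.
rewrite (eq_bigr (fun n => Cpow q n)); last by move=> n _; rewrite Eq.
case: ifP => hd.
  have q1 : q = 1.
    rewrite /q; move/dvdnP: hd => [k ->]; rewrite mult_INR (_ : _ / _ = INR k)%R; first exact: e_INR.
    by field.
  by rewrite q1 (eq_bigr (fun=> RtoC 1)) ?csum_const ?Cmult_1_r // => n _; rewrite Cpow_1_l.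
have qN : Cpow q N = 1.
  by rewrite /q e_pow (_ : _ * _ = INR j)%R; [exact: e_INR | field].
have geo : (1 - q) * (\csum_(0 <= n < N) Cpow q n) = 1 - Cpow q N.
  elim: (N) => [|n IH]; first by rewrite big_geq //=; ring.
  by rewrite csum_recr Cmult_plus_distr_l IH Cpow_S; ring.
have q1 : 1 - q <> 0.
  have [h1 h2] : (j %% N)%N <> 0%N /\ (j %% N < N)%N by split; [move=> h; move: hd; rewrite /dvdn h | rewrite ltn_mod].
  have -> : q = e (INR (j %% N) / INR N).
    rewrite /q {1}(divn_eq j N) plus_INR mult_INR.
    rewrite (_ : _ / _ = INR (j %/ N) + INR (j %% N) / INR N)%R; last by field.
    by rewrite e_add e_INR Cmult_1_l.
  set x := (INR (j %% N) / INR N)%R.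
  have x01 : (0 < x < 1)%R.
    split; first by apply: Rdiv_lt_0_compat => //; apply: INR_gt0; lia.
    apply: (Rmult_lt_reg_r (INR N)) => //; rewrite /x /Rdiv Rmult_assoc Rinv_l // Rmult_1_r Rmult_1_l.
    by apply: lt_INR; lia.
  move=> h; have : Re (1 - e x) = 0%R by rewrite h.
  rewrite e_def /= Rmult_assoc cos_2a_sin.
  have pi0 := PI_RGT_0.
  have sp : (0 < sin (PI * x))%R.
    apply: sin_gt_0; first by apply: Rmult_lt_0_compat; lra.
    by rewrite -{2}(Rmult_1_r PI); apply: Rmult_lt_compat_l; lra.
  by have := Rmult_lt_0_compat _ _ sp sp; lra.
by rewrite -[LHS]Cmult_1_l -(Cinv_l _ q1) -Cmult_assoc geo qN Csub_diag; ring.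
Qed.

Lemma Cexp_clog1 th : (0 < th < 1)%R -> Cexp (clog1 th) = 1 - e th.
Proof.
move=> hth; have pi0 := PI_RGT_0.
have sp : (0 < sin (PI * th))%R.
  apply: sin_gt_0; first by apply: Rmult_lt_0_compat; lra.
  by rewrite -{2}(Rmult_1_r PI); apply: Rmult_lt_compat_l; lra.
rewrite /Cexp /clog1 /= exp_ln; last by lra.
rewrite e_def (_ : PI * (th - 1 / 2) = PI * th - PI / 2)%R; last by field.
rewrite cos_minus sin_minus cos_PI2 sin_PI2 !(Rmult_assoc 2 PI) cos_2a_sin sin_2a.
by rewrite /Cminus /Copp /Cplus /Cmult /RtoC /=; congr pair; ring.
Qed.

(** Here [v = w - 2] has negative real part, so the binomial series converges at each
    [u = e((x + n)/N)], and [(1 - e(x))/(1 - u)] is the geometric sum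
    [1 + u + ... + u^(N-1)]. Summing over [n] leaves the exponents divisible by
    [N]. *)
Lemma lipschitz_discrete w x N : (Re w < 2)%R -> (0 < x < 1)%R -> (0 < N)%N ->
  Csum (fun M => RtoC (INR N) * bstep (w - 2) N (M * N) * Cpow (e x) M)
    ((1 - e x) * (1 - e x) * (\csum_(0 <= n < N) Cexp (- w * clog1 ((x + INR n) / INR N)))).
Proof.
move=> hw hx HN; have hN := INR_gt0 HN; have hN0 : INR N <> 0%R by lra.
have hv : (Re (w - 2) < 0)%R by case: w hw => a b /=; lra.
pose th n := ((x + INR n) / INR N)%R.
have hth n : (n < N)%N -> (0 < th n < 1)%R.
  move=> hn; have h0 := pos_INR n; have h1 : (INR n + 1 <= INR N)%R.
    by rewrite -S_INR; apply: le_INR; lia.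
  split; first by apply: Rdiv_lt_0_compat; lra.
  apply: (Rmult_lt_reg_r (INR N)) => //; rewrite /th /Rdiv Rmult_assoc Rinv_l // Rmult_1_r Rmult_1_l; lra.
have one n : (n < N)%N -> Csum (fun j => bstep (w - 2) N j * Cpow (e (th n)) j)
    ((1 - e x) * (1 - e x) * Cexp (- w * clog1 (th n))).
  move=> hn; have h := hth n hn.
  have hb : Csum (fun j => bcoef (w - 2) j * Cpow (e (th n)) j) (Cexp (- (w - 2) * clog1 (th n))).
    by apply: Csum_ext (binomial_circle hv h) => j; rewrite e_pow.
  have := bstep_series N hb.
  set u := e (th n); set g := \csum_(0 <= a < N) Cpow u a.
  have geo : (1 - u) * g = 1 - e x.
    have -> : e x = Cpow u N.
      rewrite /u e_pow (_ : _ * _ = x + INR n)%R; last by rewrite /th; field.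
      by rewrite e_add e_INR Cmult_1_r.
    rewrite /g; elim: (N) => [|m IH]; first by rewrite big_geq //=; ring.
    by rewrite csum_recr Cmult_plus_distr_l IH Cpow_S; ring.
  have -> : g * g * Cexp (- (w - 2) * clog1 (th n)) = (1 - e x) * (1 - e x) * Cexp (- w * clog1 (th n)) => //.
  have -> : - (w - 2) * clog1 (th n) = - w * clog1 (th n) + (clog1 (th n) + clog1 (th n)) by ring.
  by rewrite !Cexp_add Cexp_clog1 // -/u -geo; ring.
apply: (@Csum_subseq N) => //.
have H := Csum_csum (index_iota 0 N) (u := fun n j => if (n < N)%N then bstep (w - 2) N j * Cpow (e (th n)) j else 0)
   (l := fun n => if (n < N)%N then (1 - e x) * (1 - e x) * Cexp (- w * clog1 (th n)) else 0) (P := xpredT).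
have {}H := H _; rewrite csum_mull.
have -> : \csum_(0 <= n < N) ((1 - e x) * (1 - e x) * Cexp (- w * clog1 ((x + INR n) / INR N))) =
  \csum_(0 <= n < N) (if (n < N)%N then (1 - e x) * (1 - e x) * Cexp (- w * clog1 (th n)) else 0).
  by apply: eq_big_nat => n hn; rewrite (_ : (n < N)%N = true) //; lia.
apply: Csum_ext (H _); last first.
  by move=> n _; case: ifP => hn; [exact: one | exact: Csum_zero].
move=> j; rewrite (eq_big_nat _ _ (F2 := fun n => bstep (w - 2) N j * e (INR j * (x / INR N)) * e (INR j * (INR n / INR N)))); last first.
  move=> n hn; rewrite (_ : (n < N)%N = true) ?e_pow; last by lia.
  rewrite (_ : INR j * th n = INR j * (x / INR N) + INR j * (INR n / INR N))%R; last by rewrite /th; field.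
  by rewrite e_add; ring.
rewrite -csum_mull roots_sum //; case: ifP => hd; last by ring.
have hj : j = (j %/ N * N)%N by rewrite divnK.
rewrite -hj e_pow.
have -> : (INR j * (x / INR N) = INR (j %/ N) * x)%R by rewrite {1}hj mult_INR; field.
by ring.
Qed.

(** * The functional equation in a strip *)

Definition pz (s : C) (k : nat) : C := if k == 0%N then RtoC 0 else ncpow k (- s).
(** The second difference of [M^(-s)], which is the coefficient of [z^M] in
    [(1 - z)^2 sum_k z^k k^(-s)]. *)
Definition d2 (s : C) (M : nat) : C := pz s M - 2 * delay 1 (pz s) M + delay 2 (pz s) M.

Lemma exp_mono x y : (x <= y)%R -> (exp x <= exp y)%R.
Proof. by case=> [h|->]; [left; exact: exp_increasing | right]. Qed.

Lemma ln_INR_mono m n : (0 < m)%N -> (m <= n)%N -> (ln (INR m) <= ln (INR n))%R.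
Proof. by move=> hm hmn; apply: ln_le; [exact: INR_gt0 | apply: le_INR; lia]. Qed.

Lemma ncpow_lim0 s : (Re s < 0)%R -> Clim (fun n => ncpow n s) 0.
Proof.
move=> hs.
have h1 : is_lim_seq (fun n => ln (INR n)) p_infty.
  apply: (is_lim_comp_seq ln INR p_infty p_infty is_lim_ln_p) is_lim_seq_INR.
  by exists 0%N.
have h2 : is_lim_seq (fun n => Re s * ln (INR n))%R m_infty.
  have := is_lim_seq_scal_l _ (Re s) _ h1.
  rewrite (_ : Rbar_mult (Re s) p_infty = m_infty) //.
  apply: is_Rbar_mult_unique; apply: is_Rbar_mult_sym.
  exact: is_Rbar_mult_p_infty_neg.
have h3 : is_lim_seq (fun n => exp (Re s * ln (INR n))) 0%R.
  apply: (is_lim_comp_seq exp _ m_infty 0%R is_lim_exp_m) h2.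
  by exists 0%N.
by apply: (Clim_dom h3); exists 0%N => n _; rewrite Csub_0_r Cmod_ncpow; lra.
Qed.

Lemma bcoef_step_lim w k : (1 < Re w)%R ->
  Clim (fun N => ncpow N (1 - w) * bcoef w (k * N)) (rgamma w * pz (1 - w) k).
Proof.
move=> hw; case: k => [|k]; rewrite /pz /=.
  rewrite Cmult_0_r; apply: Clim_ext (ncpow_lim0 (s := 1 - w) _); last by case: w hw => a b /=; lra.
  by move=> n; rewrite mul0n bcoef_0; ring.
have h := Clim_subseq (phi := fun N => (k.+1 * N)%N) _ (bcoef_lim w).
have {}h := h (fun n => leq_pmull n (ltn0Sn k)).
have := Clim_scal (ncpow k.+1 (- (1 - w))) h; rewrite (Cmult_comm (rgamma w)).
apply: Clim_ext_loc; exists 1%N => N hN.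
rewrite (@ncpow_mul k.+1 N) //.
rewrite ncpow_opp; have h0 := @ncpow_neq0 k.+1 (1 - w); by field.
Qed.

Lemma delay_mul k N f M : (0 < N)%N -> delay (k * N) f (M * N) = delay k (fun i => f (i * N)%N) M.
Proof. by move=> hN; rewrite /delay leq_pmul2r // mulnBl. Qed.

Lemma bstep_lim w M : (1 < Re w)%R ->
  Clim (fun N => ncpow N (1 - w) * bstep (w - 2) N (M * N)) (rgamma w * d2 (1 - w) M).
Proof.
move=> hw.
have hd k : Clim (fun N => ncpow N (1 - w) * delay k (fun i => bcoef w (i * N)) M)
                 (rgamma w * delay k (pz (1 - w)) M).
  rewrite /delay; case: ifP => hk; first exact: bcoef_step_lim.
  by rewrite Cmult_0_r; apply: Clim_ext (Clim_const 0) => N; ring.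
have := Clim_add (Clim_sub (hd 0%N) (Clim_scal 2 (hd 1%N))) (hd 2%N).
rewrite delay0 (_ : _ - _ + _ = rgamma w * d2 (1 - w) M); last by rewrite /d2; ring.
apply: Clim_ext_loc; exists 1%N => N hN.
rewrite bstepE (_ : w - 2 + 2 = w); last by ring.
have := delay_mul 1 (bcoef w) M hN; rewrite mul1n => ->.
have := delay_mul 2 (bcoef w) M hN; rewrite mul2n -addnn => ->.
by rewrite delay0; ring.
Qed.

(** For [k >= 3] every one of the [N^2] terms of [bstep] has index at least
    [(k - 2) N], so it is [O (((k - 2) N)^(Re w - 3))]; the first three values of [k]
    are bounded because they have limits. *)
Lemma bstep_dom w : (1 < Re w < 2)%R -> exists g B, (forall k, (0 <= g k)%R) /\
  (forall n, (\rsum_(0 <= k < n) g k <= B)%R) /\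
  (forall N k, (0 < N)%N -> (Cmod (ncpow N (1 - w) * bstep (w - 2) N (k * N)) <= g k)%R).
Proof.
move=> hw; have [B0 [B00 HB0]] := bcoef_bound (w - 2).
have [S HS] := @pseries_bound (3 - Re w) ltac:(lra).
have [K HK] : exists K, forall N k, (k < 3)%N -> (Cmod (ncpow N (1 - w) * bstep (w - 2) N (k * N)) <= K)%R.
  have [K0 h0] := Clim_bounded (@bstep_lim w 0 ltac:(lra)).
  have [K1 h1] := Clim_bounded (@bstep_lim w 1 ltac:(lra)).
  have [K2 h2] := Clim_bounded (@bstep_lim w 2 ltac:(lra)).
  exists (Rmax K0 (Rmax K1 K2)) => N [|[|[|//]]] _.
  - by apply: Rle_trans (h0 N) (Rmax_l _ _).
  - by apply: Rle_trans (h1 N) _; apply: Rle_trans (Rmax_r _ _); exact: Rmax_l.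
  - by apply: Rle_trans (h2 N) _; apply: Rle_trans (Rmax_r _ _); exact: Rmax_r.
have K0 : (0 <= K)%R by apply: Rle_trans (HK 0%N 0%N isT); exact: Cmod_ge_0.
pose g k := if k is m.+3 then (B0 * exp (- (3 - Re w) * ln (INR m.+1)))%R else K.
have g0 k : (0 <= g k)%R.
  by case: k => [|[|[|k]]] //=; apply: Rmult_le_pos => //; left; exact: exp_pos.
exists g, (3 * K + B0 * S)%R; split=> //; split.
  move=> n; apply: Rle_trans (@rsum_mono 0 n n.+3 g g0 _) _; first by lia.
  rewrite !rsum_recl /g -rsum_mull.
  by have := Rmult_le_compat_l _ _ _ B00 (HS n); lra.
move=> N k hN; case: k => [|[|[|m]]]; try by apply: HK.
rewrite /g Cmod_mult Cmod_ncpow.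
have hNp := INR_gt0 hN; have hm : (0 < INR m.+1)%R by exact: INR_gt0.
set E := (B0 * exp ((Re w - 3) * (ln (INR m.+1) + ln (INR N))))%R.
have hb : (Cmod (bstep (w - 2) N (m.+3 * N)) <= INR N * (INR N * E))%R.
  rewrite -!rsum_const; apply: Rle_trans (Cmod_csum _ _ _) _; apply: rsum_nat_le => a Ha.
  apply: Rle_trans (Cmod_csum _ _ _) _; apply: rsum_nat_le => b Hb.
  have hab : (m.+1 * N < m.+3 * N - (a + b))%N by rewrite !mulSn; lia.
  rewrite /delay (_ : (a + b <= m.+3 * N)%N = true); last by lia.
  case Ei : (m.+3 * N - (a + b))%N hab => [|i] // hab.
  apply: Rle_trans (HB0 i) _; apply: Rmult_le_compat_l => //; apply: exp_mono.
  have -> : (Re (w - 2) - 1 = Re w - 3)%R by case: (w) => ? ? /=; lra.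
  rewrite -ln_mult // -mult_INR multE; apply: Rmult_le_compat_neg_l; first by lra.
  by apply: ln_INR_mono; [rewrite muln_gt0 | lia].
apply: Rle_trans (Rmult_le_compat_l _ _ _ (Rlt_le _ _ (exp_pos _)) hb) _.
have eN : INR N = exp (ln (INR N)) by rewrite exp_ln.
rewrite {2 3}eN /E (_ : Re (1 - w) = (1 - Re w)%R); last by case: (w) => ? ? /=; ring.
right; set a := exp _; set b := exp _; set c := exp _.
transitivity (B0 * (a * (b * (b * c))))%R; first by ring.
by rewrite /a /b /c -!exp_plus; congr (_ * exp _)%R; ring.
Qed.

(** For [sg = 1] this is [N^(-w) (1 - e((y + n)/N))^(-w)], and for [sg = -1] the same
    with the conjugate of [1 - e((y + n)/N)]. *)
Definition half_term (w : C) (y sg : R) (N n : nat) : C :=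
  Cexp (- w * (ln (2 * INR N * sin (PI * ((y + INR n) / INR N))), sg * (PI * ((y + INR n) / INR N - 1 / 2)))%R).

Lemma sin_cubic t : (0 <= t <= 4)%R -> (t - t * t * t / 6 <= sin t <= t)%R.
Proof.
move=> ht; split.
  have [h _] := pre_sin_bound t 0 (proj1 ht) (proj2 ht).
  apply: Rle_trans h; rewrite /sin_approx /sin_term /=; right; field.
case: (Req_dec t 0) => [->|h]; first by rewrite sin_0; lra.
by left; apply: sin_lt_x; lra.
Qed.

(** The sum runs over half of the residues modulo the even number [N = 2(H + 1)], where
    [sin (pi q/N)] is at least [q/(2N)]; this yields a bound uniform in [N]. *)
Lemma half_limit w y sg Z : (1 < Re w)%R -> (0 < y < 1)%R -> (Rabs sg <= 1)%R ->
  Csum (fun n => Rcpow (y + INR n) (- w)) Z ->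
  Clim (fun H => \csum_(0 <= n < H.+1) half_term w y sg (H.+1).*2 n)
       (Rcpow (2 * PI) (- w) * Cexp (w * (0, sg * (PI / 2))%R) * Z).
Proof.
move=> hw hy hsg HZ.
have pi0 := PI_RGT_0; have pi4 := PI_4; have pi3 := PI2_3_2.
have [S HS] := pseries_bound hw.
pose E0 := exp (Rabs (Im w) * PI).
have E00 : (0 < E0)%R := exp_pos _.
pose g n := (E0 * exp (- Re w * ln (y + INR n)))%R.
have yn n : (0 < y + INR n)%R by have := pos_INR n; lra.
have lim_n n : Clim (fun H => if (n < H.+1)%N then half_term w y sg (H.+1).*2 n else 0)
    (Rcpow (2 * PI) (- w) * Cexp (w * (0, sg * (PI / 2))%R) * Rcpow (y + INR n) (- w)).
  apply: (@Clim_ext_loc (fun H => half_term w y sg (H.+1).*2 n)).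
    by exists n => H hH; rewrite ltnS hH.
  set q := (y + INR n)%R; have hq : (0 < q)%R by exact: yn.
  have -> : Rcpow (2 * PI) (- w) * Cexp (w * (0, sg * (PI / 2))%R) * Rcpow q (- w) =
      Cexp (- w * (ln (2 * PI * q), sg * (PI * (0 - 1 / 2)))%R).
    have -> : ln (2 * PI * q) = (ln (2 * PI) + ln q)%R by apply: ln_mult; lra.
    rewrite /Rcpow -!Cexp_add.
    congr Cexp; rewrite /Cmult /Cplus /Copp /RtoC /=; congr pair; field.
  have iN : is_lim_seq (fun H => / INR (H.+1).*2)%R 0%R.
    have h := is_lim_seq_subseq _ _ (fun H => (H.+1).*2) _ inv_INR_lim; apply: h.
    by move=> P [N HN]; exists N => k hk; apply: HN; lia.
  have tl : is_lim_seq (fun H => q / INR (H.+1).*2)%R 0%R.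
    by have := is_lim_seq_scal_l _ q _ iN; rewrite /= Rmult_0_r.
  have sl : is_lim_seq (fun H => 2 * INR (H.+1).*2 * sin (PI * (q / INR (H.+1).*2)))%R (2 * PI * q)%R.
    (* twice [N] times the cubic term of the sine at [PI q / N] is [C3 / N^2] *)
    pose C3 := (PI * q * (PI * q) * (PI * q) / 3)%R.
    apply: (is_lim_seq_le_le_loc (fun H => 2 * PI * q - C3 * (/ INR (H.+1).*2 * / INR (H.+1).*2))%R _ (fun=> 2 * PI * q)%R).
    - have [N HN] := nfloor_ex q ltac:(lra).
      exists N => H hH; set M := INR (H.+1).*2.
      have hM : (0 < M)%R by apply: INR_gt0; lia.
      have hqM : (q <= M)%R.
        have h : (INR N + 1 <= M)%R by rewrite -S_INR; apply: le_INR; lia.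
        by lra.
      have ht : (0 <= PI * (q / M) <= 4)%R.
        have h1 : (q / M <= 1)%R by apply: (Rmult_le_reg_r M) => //; rewrite /Rdiv Rmult_assoc Rinv_l; lra.
        have h2 : (0 <= q / M)%R by apply: Rlt_le; apply: Rdiv_lt_0_compat.
        split; first by apply: Rmult_le_pos; lra.
        by have := Rmult_le_compat_l PI _ _ ltac:(lra) h1; lra.
      have [s1 s2] := sin_cubic ht.
      have M2 : (0 <= 2 * M)%R by lra.
      have t1 := Rmult_le_compat_l _ _ _ M2 s1; have t2 := Rmult_le_compat_l _ _ _ M2 s2.
      split.
        apply: Rle_trans t1; right; rewrite /C3; field; lra.
      by apply: Rle_trans t2 _; right; field; lra.
    - have h := is_lim_seq_mult' _ _ _ _ iN iN; rewrite Rmult_0_l in h.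
      have := is_lim_seq_minus' _ _ _ _ (is_lim_seq_const (2 * PI * q)) (is_lim_seq_scal_l _ C3 _ h).
      by rewrite /= Rmult_0_r Rminus_0_r.
    - exact: is_lim_seq_const.
  have q2 : (0 < 2 * PI * q)%R by apply: Rmult_lt_0_compat; lra.
  have ll : is_lim_seq (fun H => ln (2 * INR (H.+1).*2 * sin (PI * (q / INR (H.+1).*2)))) (ln (2 * PI * q)).
    apply: (is_lim_seq_continuous ln) sl.
    by apply: derivable_continuous_pt; eexists; exact: derivable_pt_lim_ln.
  have al : is_lim_seq (fun H => sg * (PI * (q / INR (H.+1).*2 - 1 / 2)))%R (sg * (PI * (0 - 1 / 2)))%R.
    apply: (is_lim_seq_scal_l _ sg (Finite (PI * (0 - 1 / 2)))).
    apply: (is_lim_seq_scal_l _ PI (Finite (0 - 1 / 2))).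
    by apply: is_lim_seq_minus' => //; exact: is_lim_seq_const.
  have cl : Clim (fun H => - w * (ln (2 * INR (H.+1).*2 * sin (PI * (q / INR (H.+1).*2))), sg * (PI * (q / INR (H.+1).*2 - 1 / 2)))%R)
     (- w * (ln (2 * PI * q), sg * (PI * (0 - 1 / 2)))%R).
    by apply: Clim_scal; apply: Clim_reim.
  exact: Clim_Cexp cl.
have gB n : (\rsum_(0 <= k < n) g k <= g 0%N + E0 * S)%R.
  apply: Rle_trans (@rsum_mono 0 n n.+1 g _ (leqnSn n)) _.
    by move=> i; apply: Rmult_le_pos; [lra | left; exact: exp_pos].
  rewrite rsum_recl; apply: Rplus_le_compat_l; rewrite -rsum_mull; apply: Rmult_le_compat_l; first by lra.
  apply: Rle_trans (HS n); apply: rsum_le => k _; apply: exp_mono.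
  apply: Rmult_le_compat_neg_l; first by lra.
  by apply: ln_le; [exact: INR_gt0 | lra].
have HZ' := Csum_scal (Rcpow (2 * PI) (- w) * Cexp (w * (0, sg * (PI / 2))%R)) HZ.
apply: (@tannery (fun H n => if (n < H.+1)%N then half_term w y sg (H.+1).*2 n else 0) _ g (g 0%N + E0 * S)%R) lim_n _ HZ'.
- by move=> n; apply: Rmult_le_pos; [lra | left; exact: exp_pos].
- exact: gB.
- exists 0%N => H n _; case: ifP => hn; last first.
    by rewrite Cmod_0; apply: Rmult_le_pos; [lra | left; exact: exp_pos].
  rewrite /half_term Cmod_Cexp /g /E0 -exp_plus; apply: exp_mono.
  set q := (y + INR n)%R; have hq : (0 < q)%R by exact: yn.
  set M := INR (H.+1).*2; have hM : (0 < M)%R by apply: INR_gt0; lia.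
  have hqM : (q <= M / 2)%R.
    have h : (INR n + 1 <= INR H.+1)%R by rewrite -S_INR; apply: le_INR; lia.
    have : M = (2 * INR H.+1)%R by rewrite /M -muln2 -multE mult_INR /=; ring.
    by rewrite /q; lra.
  have h1 : (0 < q / M <= 1 / 2)%R.
    split; first exact: Rdiv_lt_0_compat.
    by apply: (Rmult_le_reg_r M) => //; rewrite /Rdiv Rmult_assoc Rinv_l; lra.
  have t0 : (0 <= PI * (q / M) <= 2)%R.
    split; first by apply: Rmult_le_pos; lra.
    by have := Rmult_le_compat_l PI _ _ ltac:(lra) (proj2 h1); lra.
  have [s1 _] := @sin_cubic (PI * (q / M)) ltac:(lra).
  have s3 : (q / M / 2 <= sin (PI * (q / M)))%R.
    set t := (PI * (q / M))%R in t0 s1 *.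
    have tt : (t * t * t <= 4 * t)%R.
      by apply: Rmult_le_compat_r; [lra | have := Rmult_le_compat t 2 t 2; lra].
    have : (3 * (q / M) <= t)%R by rewrite /t; apply: Rmult_le_compat_r; lra.
    by lra.
  have l1 : (ln q <= ln (2 * M * sin (PI * (q / M))))%R.
    apply: ln_le => //; have := Rmult_le_compat_l (2 * M) _ _ ltac:(lra) s3.
    by rewrite (_ : 2 * M * (q / M / 2) = q)%R //; field; lra.
  have a1 : (Rabs (sg * (PI * (q / M - 1 / 2))) <= PI)%R.
    rewrite Rabs_mult -[X in (_ <= X)%R]Rmult_1_l; apply: Rmult_le_compat => //; try exact: Rabs_pos.
    rewrite Rabs_mult (Rabs_pos_eq PI); last by lra.
    rewrite -{2}(Rmult_1_r PI); apply: Rmult_le_compat_l; first by lra.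
    by apply: Rabs_le; lra.
  set L := ln (2 * M * sin (PI * (q / M))) in l1 *; set A := (sg * (PI * (q / M - 1 / 2)))%R in a1 *.
  have -> : Re (- w * (L, A)%R) = (- Re w * L + Im w * A)%R by case: (w) => ? ? /=; ring.
  have h2 : (Im w * A <= Rabs (Im w) * PI)%R.
    apply: Rle_trans (Rle_abs _) _; rewrite Rabs_mult; apply: Rmult_le_compat_l a1; exact: Rabs_pos.
  have h3 : (- Re w * L <= - Re w * ln q)%R by apply: Rmult_le_compat_neg_l; lra.
  by lra.
move=> H; apply: Clim_ext_loc (Clim_const _); exists H.+1 => n hn.
by rewrite -big_mkcond [LHS](big_nat_widen _ _ n).
Qed.

(** The upper half of the range is reflected to the lower half, which conjugates
    [1 - e(t)] and replaces [x] by [1 - x]. *)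
Lemma lipschitz_sum_lim w x Z1 Z2 : (1 < Re w)%R -> (0 < x < 1)%R ->
  Csum (fun n => Rcpow (x + INR n) (- w)) Z1 ->
  Csum (fun n => Rcpow (1 - x + INR n) (- w)) Z2 ->
  Clim (fun H => ncpow (H.+1).*2 (- w) * \csum_(0 <= n < (H.+1).*2) Cexp (- w * clog1 ((x + INR n) / INR (H.+1).*2)))
    (Rcpow (2 * PI) (- w) * (Cexp (w * (0, PI / 2)%R) * Z1 + Cexp (w * (0, - (PI / 2))%R) * Z2)).
Proof.
move=> hw hx H1 H2.
have L1 := @half_limit w x 1 Z1 hw hx ltac:(rewrite Rabs_R1; lra) H1.
have L2 := @half_limit w (1 - x) (-1) Z2 hw ltac:(lra) ltac:(rewrite Rabs_m1; lra) H2.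
have := Clim_add L1 L2.
rewrite Rmult_1_l (_ : (-1 * (PI / 2) = - (PI / 2))%R); last by ring.
rewrite (_ : forall a b c d f : C, a * b * c + a * d * f = a * (b * c + d * f)); last by move=> *; ring.
apply: Clim_ext => H; set N := (H.+1).*2.
have hN : (0 < INR N)%R by apply: INR_gt0; rewrite /N; lia.
have pi0 := PI_RGT_0.
have tE (y : R) n : (0 < y < 1)%R -> (n < N)%N -> ncpow N (- w) * Cexp (- w * clog1 ((y + INR n) / INR N)) = half_term w y 1 N n.
  move=> hy hn; rewrite /half_term /ncpow /Rcpow /clog1 -Cexp_add.
  have h1 : (INR n + 1 <= INR N)%R by rewrite -S_INR; apply: le_INR; lia.
  have h0 := pos_INR n.
  have q0 : (0 < (y + INR n) / INR N)%R by apply: Rdiv_lt_0_compat; lra.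
  have q1 : ((y + INR n) / INR N < 1)%R.
    by apply: (Rmult_lt_reg_r (INR N)) => //; rewrite /Rdiv Rmult_assoc Rinv_l; lra.
  set q := ((y + INR n) / INR N)%R in q0 q1 *.
  have sp : (0 < sin (PI * q))%R.
    apply: sin_gt_0; first by apply: Rmult_lt_0_compat; lra.
    by rewrite -{2}(Rmult_1_r PI); apply: Rmult_lt_compat_l; lra.
  rewrite (_ : 2 * INR N * sin (PI * q) = INR N * (2 * sin (PI * q)))%R; last by ring.
  have -> : (ln (INR N * (2 * sin (PI * q))) = ln (INR N) + ln (2 * sin (PI * q)))%R.
    by apply: ln_mult; lra.
  rewrite Rmult_1_l; congr Cexp; rewrite /Cmult /Cplus /Copp /RtoC /=; congr pair; ring.
rewrite csum_mull.
transitivity (\csum_(0 <= n < N) half_term w x 1 N n); last first.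
  by apply: eq_big_nat => n hn; rewrite tE //; lia.
rewrite (@big_cat_nat _ _ _ H.+1 0 N) //=; last by rewrite /N; lia.
congr Cplus.
have -> : N = (H.+1 + H.+1)%N by rewrite /N addnn.
rewrite [RHS]big_nat_shift [RHS]big_nat_rev /= add0n addnn -/N; apply: eq_big_nat => n hn.
rewrite /half_term.
have -> : INR (H.+1 - n.+1 + H.+1) = (INR N - 1 - INR n)%R.
  have h : (H.+1 - n.+1 + H.+1 + n.+1 = N)%N by rewrite /N; lia.
  have -> : INR N = (INR (H.+1 - n.+1 + H.+1) + INR n.+1)%R by rewrite -plus_INR plusE h.
  by rewrite (S_INR n); ring.
have -> : ((x + (INR N - 1 - INR n)) / INR N = 1 - (1 - x + INR n) / INR N)%R by field; lra.
set q := ((1 - x + INR n) / INR N)%R.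
have -> : sin (PI * (1 - q)) = sin (PI * q).
  by rewrite (_ : PI * (1 - q) = PI - PI * q)%R; [rewrite -sin_PI_x //; congr sin; ring | ring].
by congr Cexp; congr Cmult; congr pair; field.
Qed.

(** The two evaluations of the limit of the discrete Lipschitz formula. *)
Lemma strip_equation w x A Z1 Z2 : (1 < Re w < 2)%R -> (0 < x < 1)%R ->
  Csum (fun n => Rcpow (x + INR n) (- w)) Z1 ->
  Csum (fun n => Rcpow (1 - x + INR n) (- w)) Z2 ->
  Csum (fun M => d2 (1 - w) M * Cpow (e x) M) A ->
  rgamma w * A = (1 - e x) * (1 - e x) *
    (Rcpow (2 * PI) (- w) * (Cexp (w * (0, PI / 2)%R) * Z1 + Cexp (w * (0, - (PI / 2))%R) * Z2)).
Proof.
move=> hw hx H1 H2 HA.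
have L := Clim_scal ((1 - e x) * (1 - e x)) (@lipschitz_sum_lim w x Z1 Z2 ltac:(lra) hx H1 H2).
apply: Clim_uniq L.
have [g [B [g0 [gB gD]]]] := bstep_dom hw.
apply: (@tannery (fun H M => ncpow (H.+1).*2 (1 - w) * bstep (w - 2) (H.+1).*2 (M * (H.+1).*2) * Cpow (e x) M)
   (fun M => rgamma w * d2 (1 - w) M * Cpow (e x) M) g B) => //.
- exists 0%N => H M _; rewrite Cmod_mult Cmod_pow Cmod_e pow1 Rmult_1_r; apply: gD; lia.
- move=> M; have h := @bstep_lim w M ltac:(lra).
  have {}h := Clim_subseq (phi := fun H => (H.+1).*2) _ h.
  have {}h := h ltac:(move=> n; lia).
  exact: Clim_mul h (Clim_const _).
- move=> H; have hN : (0 < (H.+1).*2)%N by lia.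
  have := Csum_scal (ncpow (H.+1).*2 (- w)) (@lipschitz_discrete w x _ ltac:(lra) hx hN).
  have -> : forall a b c : C, a * (b * b * c) = b * b * (a * c) by move=> *; ring.
  apply: Csum_ext => M; rewrite /Cminus ncpow_add (ncpow_1 hN); ring.
by apply: Csum_ext (Csum_scal (rgamma w) HA) => M; ring.
Qed.

(** * Dirichlet series with bounded coefficients *)

Definition CSer (a : nat -> C) : C := epsilon (inhabits (RtoC 0)) (Csum a).

Lemma CSer_sum a l : Csum a l -> Csum a (CSer a).
Proof. by move=> H; apply: (epsilon_spec (inhabits (RtoC 0)) (Csum a)); exists l. Qed.

Lemma CSer_eq a l : Csum a l -> CSer a = l.
Proof. by move=> H; exact: (Csum_uniq (CSer_sum H) H). Qed.

Definition dterm (c : nat -> C) (s : C) (n : nat) : C := c n.+1 * ncpow n.+1 (- s).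
Definition dser (c : nat -> C) (s : C) : C := CSer (dterm c s).

Lemma dterm_asum c s : (1 < Re s)%R -> (forall n, (Cmod (c n) <= 1)%R) -> exists B, asum (dterm c s) B.
Proof.
move=> hs hc; have [B HB] := pseries_bound hs; exists B.
apply: asum_dom HB => n; rewrite /dterm Cmod_mult Cmod_ncpow.
rewrite (_ : Re (- s) = - Re s)%R; last by case: (s) => ? ?.
rewrite -{2}(Rmult_1_l (exp _)); apply: Rmult_le_compat_r (hc _); left; exact: exp_pos.
Qed.

Lemma dser_sum c s : (1 < Re s)%R -> (forall n, (Cmod (c n) <= 1)%R) -> Csum (dterm c s) (dser c s).
Proof.
by move=> hs hc; have [B HB] := dterm_asum hs hc; have [l Hl] := asum_conv HB; exact: CSer_sum Hl.
Qed.

Lemma nps_ncpow q s0 r : (0 < q)%N -> (0 < r)%R ->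
  nps (fun s => ncpow q (- s)) s0 r (exp (- (Re s0 - r) * ln (INR q))).
Proof.
move=> hq hr; have hr0 := Rlt_le _ _ hr.
have l0 : (0 <= ln (INR q))%R.
  by rewrite -ln_1; apply: ln_le; [lra | apply: (le_INR 1); lia].
have H1 : nps (fun s => RtoC (- ln (INR q)) * (s - s0)) s0 r (ln (INR q) * r).
  apply: nps_ext (nps_weaken _ (nps_monomial (RtoC (- ln (INR q))) 1 s0 hr0)).
    by move=> z _ /=; ring.
  by rewrite Cmod_R Rabs_Ropp Rabs_pos_eq //; right; ring.
have := nps_scal (ncpow q (- s0)) hr0 (nps_exp hr H1); rewrite Cmod_ncpow -exp_plus.
rewrite (_ : Re (- s0) * ln (INR q) + _ = - (Re s0 - r) * ln (INR q))%R; last by case: (s0) => ? ? /=; ring.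
apply: nps_ext => z _; rewrite /ncpow /Rcpow -Cexp_add RtoC_opp; congr Cexp; ring.
Qed.

Lemma dser_ana c s0 : (1 < Re s0)%R -> (forall n, (Cmod (c n) <= 1)%R) -> ana (dser c) s0.
Proof.
move=> hs hc; pose r := ((Re s0 - 1) / 2)%R; have hr : (0 < r)%R by rewrite /r; lra.
have [B HB] := @pseries_bound (Re s0 - r) ltac:(rewrite /r; lra).
exists r, B; split=> //.
apply: (@nps_sum (fun n s => dterm c s n) _ s0 r (fun n => exp (- (Re s0 - r) * ln (INR n.+1)))) => //.
  move=> n; have := nps_scal (c n.+1) (Rlt_le _ _ hr) (@nps_ncpow n.+1 s0 r isT hr).
  apply: nps_weaken; rewrite -{2}(Rmult_1_l (exp _)); apply: Rmult_le_compat_r (hc _); left; exact: exp_pos.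
move=> z hz; apply: dser_sum => //.
have := re_le_Cmod (z - s0); have -> : Re (z - s0) = (Re z - Re s0)%R by [].
move=> h; have := Rle_trans _ _ _ h hz; move/Rabs_le_between => [h1 _].
by move: h1; rewrite /r; lra.
Qed.

(** * Periodic zeta functions to the right of [-1] *)

(** With [q = m + 1] and [f_i = ((q + i)/q)^(-s)] the second difference is [q^(-s) ((f_1 -
    1)^2 + (f_2 - f_1^2))], and [f_2 / f_1^2 = (1 + O(q^(-2)))^s], so both parts gain a
    factor [q^(-2)]. *)
Lemma d2_nps s0 r : (0 < r)%R -> exists K, (0 <= K)%R /\ forall m,
  nps (fun s => d2 s m.+3) s0 r (K * exp (- (Re s0 - r + 2) * ln (INR m.+1))).
Proof.
move=> hr; have hr0 := Rlt_le _ _ hr.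
pose R0 := (Cmod s0 + r)%R; have hR : (0 <= R0)%R by rewrite /R0; have := Cmod_ge_0 s0; lra.
pose E := exp R0; have hE : (0 < E)%R := exp_pos _.
pose K := (R0 * E * (R0 * E) + E * E * (R0 * E))%R.
have RE : (0 <= R0 * E)%R by apply: Rmult_le_pos => //; lra.
exists K; split.
  have h1 := Rmult_le_pos _ _ RE RE; have h2 := Rmult_le_pos _ _ (Rmult_le_pos _ _ (Rlt_le _ _ hE) (Rlt_le _ _ hE)) RE.
  by rewrite /K; lra.
move=> m; set q := INR m.+1; have hq : (0 < q)%R by exact: INR_gt0.
have q1 : (1 <= q)%R by rewrite /q S_INR; have := pos_INR m; lra.
have eq2 : INR m.+2 = (q + 1)%R by rewrite S_INR.
have eq3 : INR m.+3 = (q + 2)%R by rewrite !S_INR /q S_INR; ring.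
pose l1 := (ln (q + 1) - ln q)%R; pose l2 := (ln (q + 2) - ln q)%R; pose mu := (2 * l1 - l2)%R.
have iq : (0 < / q)%R := Rinv_0_lt_compat _ hq.
have iq1 : (/ q <= 1)%R by rewrite -Rinv_1; apply: Rinv_le_contravar; lra.
have l1E : l1 = ln (1 + / q).
  by rewrite /l1 (_ : q + 1 = q * (1 + / q))%R; [rewrite ln_mult; lra | field; lra].
have l2E : l2 = ln (1 + 2 * / q).
  by rewrite /l2 (_ : q + 2 = q * (1 + 2 * / q))%R; [rewrite ln_mult; lra | field; lra].
have h1 : (0 <= l1 <= / q)%R.
  split; first by rewrite l1E -ln_1; apply: ln_le; lra.
  by have := @ln_le_sub1 (1 + / q)%R ltac:(lra); lra.
have h2 : (0 <= l2 <= 2)%R.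
  split; first by rewrite l2E -ln_1; apply: ln_le; lra.
  by have := @ln_le_sub1 (1 + 2 * / q)%R ltac:(lra); lra.
have qq : (0 < q * (q + 2))%R by apply: Rmult_lt_0_compat; lra.
have muE : mu = ln (1 + / (q * (q + 2))).
  rewrite /mu /l1 /l2.
  have h : (ln (q * (q + 2)) + ln (1 + / (q * (q + 2))) = ln ((q + 1) * (q + 1)))%R.
    rewrite -ln_mult //; first by congr ln; field; lra.
    by have := Rinv_0_lt_compat _ qq; lra.
  by move: h; rewrite !ln_mult; lra.
have h3 : (0 <= mu <= / q * / q)%R.
  have iqq := Rinv_0_lt_compat _ qq.
  split; first by rewrite muE -ln_1; apply: ln_le; lra.
  have := @ln_le_sub1 (1 + / (q * (q + 2)))%R ltac:(lra); rewrite -muE => h.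
  apply: Rle_trans (_ : (/ (q * (q + 2)) <= _)%R); first by lra.
  by rewrite -Rinv_mult; apply: Rinv_le_contravar; [exact: Rmult_lt_0_compat | apply: Rmult_le_compat_l; lra].
have Hz := nps_id s0 hr0; rewrite -/R0 in Hz.
have Hl l B : (0 <= l <= B)%R -> nps (fun s => RtoC (- l) * s) s0 r (B * R0).
  move=> hl; apply: nps_weaken (nps_scal (RtoC (- l)) hr0 Hz); rewrite Cmod_R Rabs_Ropp Rabs_pos_eq; last by lra.
  by apply: Rmult_le_compat_r; lra.
have Hm1 l : (0 <= l <= 1)%R -> (exp (l * R0) - 1 <= l * (R0 * E))%R.
  move=> hl; have h0 : (0 <= l * R0)%R by apply: Rmult_le_pos; lra.
  apply: Rle_trans (expm1_le h0) _; rewrite Rmult_assoc; apply: Rmult_le_compat_l; first by lra.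
  apply: Rmult_le_compat_l => //; apply: exp_mono.
  by rewrite -{2}(Rmult_1_l R0); apply: Rmult_le_compat_r; lra.
have N1 : nps (fun s => Cexp (RtoC (- l1) * s) - 1) s0 r (/ q * (R0 * E)).
  by apply: nps_weaken (nps_expm1 hr (Hl l1 _ h1)); apply: Hm1; lra.
have N2 : nps (fun s => Cexp (RtoC (- l2) * s)) s0 r (E * E).
  apply: nps_weaken (nps_exp hr (Hl l2 _ h2)); rewrite /E -exp_plus; apply: exp_mono; lra.
have N3 : nps (fun s => Cexp (RtoC (- mu) * s) - 1) s0 r (/ q * / q * (R0 * E)).
  have iqq : (0 <= / q * / q <= 1)%R.
    by split; [apply: Rmult_le_pos; lra | rewrite -(Rmult_1_r 1); apply: Rmult_le_compat; lra].
  by apply: nps_weaken (nps_expm1 hr (Hl mu _ h3)); apply: Hm1.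
have NB := nps_add (nps_mul N1 N1) (nps_scal (- (1)) hr0 (nps_mul N2 N3)).
have := nps_mul (@nps_ncpow m.+1 s0 r isT hr) NB; rewrite -/q.
rewrite Cmod_opp Cmod_1.
have -> : (exp (- (Re s0 - r) * ln q) * (/ q * (R0 * E) * (/ q * (R0 * E)) + 1 * (E * E * (/ q * / q * (R0 * E)))) =
   K * exp (- (Re s0 - r + 2) * ln q))%R.
  have -> : (exp (- (Re s0 - r + 2) * ln q) = exp (- (Re s0 - r) * ln q) * (/ q * / q))%R.
    have -> : (/ q = exp (- ln q))%R by rewrite exp_Ropp exp_ln.
    by rewrite -!exp_plus; congr exp; ring.
  by rewrite /K; ring.
apply: nps_ext => s _; rewrite /d2 /delay /pz /=.
have e3 : ncpow m.+3 (- s) = ncpow m.+1 (- s) * Cexp (RtoC (- l2) * s).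
  by rewrite /ncpow /Rcpow eq3 -/q -Cexp_add /l2 RtoC_opp RtoC_minus; congr Cexp; ring.
have e2 : ncpow m.+2 (- s) = ncpow m.+1 (- s) * Cexp (RtoC (- l1) * s).
  by rewrite /ncpow /Rcpow eq2 -/q -Cexp_add /l1 RtoC_opp RtoC_minus; congr Cexp; ring.
have emu : Cexp (RtoC (- l2) * s) * Cexp (RtoC (- mu) * s) = Cexp (RtoC (- l1) * s) * Cexp (RtoC (- l1) * s).
  rewrite -!Cexp_add /mu !RtoC_opp RtoC_minus RtoC_mult; congr Cexp; ring.
rewrite !subSS !subn0 e3 e2.
set f1 := Cexp (RtoC (- l1) * s) in emu *; set f2 := Cexp (RtoC (- l2) * s) in emu *.
set f3 := Cexp (RtoC (- mu) * s) in emu *.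
rewrite (_ : (f1 - 1) * (f1 - 1) + - (1) * (f2 * (f3 - 1)) = f1 * f1 - 2 * f1 + 1 - f2 * f3 + f2); last by ring.
by rewrite emu; ring.
Qed.

(** [(1 - z)^2 sum_k z^k k^(-s)], in a form that converges for [Re s > -1]. *)
Definition A2 (z s : C) : C := CSer (fun M => d2 s M * Cpow z M).

Lemma A2_ana z s0 : Cmod z = 1%R -> (-1 < Re s0)%R ->
  ana (A2 z) s0 /\ Csum (fun M => d2 s0 M * Cpow z M) (A2 z s0).
Proof.
move=> hz hs; pose r := ((Re s0 + 1) / 2)%R; have hr : (0 < r)%R by rewrite /r; lra.
have [K [K0 HK]] := d2_nps s0 hr.
have [S HS] := @pseries_bound (Re s0 - r + 2) ltac:(rewrite /r; lra).
have small k : exists M, nps (fun s => d2 s k) s0 r M.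
  case: k => [|[|[|m]]].
  - exists (Cmod 0); apply: nps_ext (nps_const 0 s0 (Rlt_le _ _ hr)) => s _.
    by rewrite /d2 /delay /pz /=; ring.
  - exists (Cmod 1); apply: nps_ext (nps_const 1 s0 (Rlt_le _ _ hr)) => s _.
    by rewrite /d2 /delay /pz /= ncpow_1l; ring.
  - eexists; apply: nps_ext (nps_add (@nps_ncpow 2 s0 r isT hr) (nps_const (- (2)) s0 (Rlt_le _ _ hr))) => s _.
    by rewrite /d2 /delay /pz /= ncpow_1l; ring.
  - by eexists; exact: HK.
have [M0 H0] := small 0%N; have [M1 H1] := small 1%N; have [M2 H2] := small 2%N.
pose M k := match k with 0%N => M0 | 1%N => M1 | 2%N => M2 | m.+3 => (K * exp (- (Re s0 - r + 2) * ln (INR m.+1)))%R end.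
have HM k : nps (fun s => d2 s k) s0 r (M k) by case: k => [|[|[|m]]] //; exact: HK.
have Mpos k : (0 <= M k)%R by have [a [Ha _]] := HM k; exact: asum_ge0 Ha.
have Mb n : (\rsum_(0 <= k < n) M k <= M0 + M1 + M2 + K * S)%R.
  apply: Rle_trans (@rsum_mono 0 n n.+3 M Mpos _) _; first by lia.
  rewrite !rsum_recl /M -rsum_mull; have := Rmult_le_compat_l _ _ _ K0 (HS n); lra.
have HF k : nps (fun s => d2 s k * Cpow z k) s0 r (M k).
  have := nps_scal (Cpow z k) (Rlt_le _ _ hr) (HM k); rewrite Cmod_pow hz pow1 Rmult_1_l.
  by apply: nps_ext => s _; ring.
have HA s : (Cmod (s - s0) <= r)%R -> Csum (fun M => d2 s M * Cpow z M) (A2 z s).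
  move=> h; have [l Hl] := @asum_conv (fun M => d2 s M * Cpow z M) _ (asum_dom (fun k => nps_val h (HF k)) Mb).
  exact: CSer_sum Hl.
split; last by apply: HA; rewrite Csub_diag Cmod_0; lra.
by exists r, (M0 + M1 + M2 + K * S)%R; split=> //; exact: nps_sum HF Mb HA.
Qed.

Lemma A2_series z s F : Cmod z = 1%R -> Csum (dterm (Cpow z) s) F ->
  A2 z s = (1 - z) * (1 - z) * F.
Proof.
move=> hz HF; apply: CSer_eq.
have H0 : Csum (fun k => pz s k * Cpow z k) F.
  apply: Csum_shift0; first by rewrite /pz /=; ring.
  by apply: Csum_ext HF => n; rewrite /dterm /pz /= Cmult_comm.
have Hk k : Csum (fun M => delay k (pz s) M * Cpow z M) (Cpow z k * F).
  apply: Csum_ext (Csum_scal (Cpow z k) (Csum_delay k H0)) => M; rewrite /delay.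
  case: ifP => hk; last by ring.
  have -> : Cpow z M = Cpow z k * Cpow z (M - k) by rewrite -Cpow_add_r; congr Cpow; lia.
  by ring.
have := Csum_add (Csum_add (Hk 0%N) (Csum_scal (- (2)) (Hk 1%N))) (Hk 2%N).
rewrite (_ : _ + _ + _ = (1 - z) * (1 - z) * F); last by rewrite /=; ring.
by apply: Csum_ext => M; rewrite delay0 /d2; ring.
Qed.

(** * Residue classes *)

Definition cres (K r n : nat) : C := if (n == r %[mod K])%N then RtoC 1 else RtoC 0.

Lemma cres_le1 K r n : (Cmod (cres K r n) <= 1)%R.
Proof. by rewrite /cres; case: ifP => _; rewrite ?Cmod_1 ?Cmod_0; lra. Qed.

Lemma Csum_undelay k f l : Csum (delay k f) l -> Csum f l.
Proof.
elim: k => [|k IH] H; first by apply: Csum_ext H => j; rewrite delay0.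
apply: IH; have := (Csum_shift (delay k.+1 f) l).2; rewrite {1}/delay Cplus_0_l => /(_ H).
by apply: Csum_ext => j; rewrite delayS.
Qed.

Lemma Csum_residue K r (f : nat -> C) l : (0 < K)%N -> (r < K)%N ->
  Csum (fun n => cres K r n * f n) l -> Csum (fun n => f (r + n * K)%N) l.
Proof.
move=> hK hr H; apply: (@Csum_subseq K) => //; apply: (@Csum_undelay r).
apply: Csum_ext H => n; rewrite /cres /delay.
case: (leqP r n) => hrn.
  rewrite eqn_mod_dvd //; case: ifP => hd; last by ring.
  by rewrite divnK // subnKC //; ring.
rewrite !modn_small; [|lia|lia].
by rewrite (_ : (n == r)%N = false); [ring | lia].
Qed.

Lemma dser_residue K r w : (0 < K)%N -> (0 < r < K)%N -> (1 < Re w)%R ->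
  Csum (fun n => Rcpow (INR r / INR K + INR n) (- w)) (ncpow K w * dser (cres K r) w).
Proof.
move=> hK hr hw; have hKp := INR_gt0 hK.
have H := dser_sum hw (cres_le1 K r).
have H2 : Csum (fun n => cres K r n * ncpow n (- w)) (dser (cres K r) w).
  apply: Csum_shift0 H; rewrite /cres mod0n modn_small; last by lia.
  by rewrite (_ : (0 == r)%N = false); [ring | lia].
have := Csum_scal (ncpow K w) (@Csum_residue K r (fun n => ncpow n (- w)) _ hK ltac:(lia) H2).
apply: Csum_ext => n.
rewrite /ncpow.
have E : INR (r + n * K) = (INR K * (INR r / INR K + INR n))%R.
  by rewrite -plusE -multE plus_INR mult_INR; field; lra.
rewrite E Rcpow_mul //; last first.
  apply: Rplus_lt_le_0_compat; last exact: pos_INR.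
  by apply: Rdiv_lt_0_compat => //; apply: INR_gt0; lia.
rewrite (Rcpow_opp (INR K)); have h0 := @Rcpow_neq0 (INR K) w; by field.
Qed.

Lemma dser_multiples K w : (0 < K)%N -> (1 < Re w)%R ->
  dser (cres K 0) w = ncpow K (- w) * dser (fun=> 1) w.
Proof.
move=> hK hw.
have one_le (n : nat) : (Cmod 1 <= 1)%R by rewrite Cmod_1; lra.
have H := dser_sum hw (cres_le1 K 0).
have H1 := dser_sum hw one_le.
have H2 : Csum (fun n => cres K 0 n * pz w n) (dser (cres K 0) w).
  apply: Csum_shift0; first by rewrite /pz /=; ring.
  by apply: Csum_ext H => n.
have := @Csum_residue K 0 (pz w) _ hK hK H2 => H3.
apply: (Csum_uniq H3).
have H4 : Csum (fun n => ncpow K (- w) * pz w n) (ncpow K (- w) * dser (fun=> 1) w).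
  apply: Csum_scal.
  apply: Csum_shift0; first by [].
  by apply: Csum_ext H1 => n; rewrite /dterm /pz /=; ring.
apply: Csum_ext H4 => n; rewrite add0n /pz muln_eq0 (_ : (K == 0)%N = false) ?orbF; last by lia.
case: eqP => hn; first by ring.
rewrite ncpow_mul //; [ring | lia].
Qed.

Lemma Cexp_Ci_half : Cexp (RtoC PI / 2 * Ci) = Ci.
Proof.
rewrite (_ : RtoC PI / 2 * Ci = (0, PI / 2)%R); last first.
  rewrite /Cdiv -RtoC_inv; last by lra.
  by rewrite -RtoC_mult /Ci /Cmult /RtoC /=; congr pair; field.
by rewrite /Cexp /= exp_0 cos_PI2 sin_PI2 /Ci /Cmult /RtoC /=; congr pair; ring.
Qed.

Lemma pair_Ci : (0, PI / 2)%R = RtoC PI / 2 * Ci :> C.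
Proof.
rewrite /Cdiv -RtoC_inv; last by lra.
by rewrite -RtoC_mult /Ci /Cmult /RtoC /=; congr pair; field.
Qed.

(** The right-hand side of the functional equation of [sum_n e(jn/K) n^(-s)]. The two
    Hurwitz zeta functions appear as Dirichlet series over the residue classes of [-j]
    and [j]. *)
Definition fe_side (K j : nat) (s : C) : C :=
  calG s * ncpow K (1 - s) *
   (Cexp (RtoC PI / 2 * Ci * s) * dser (cres K (K - j %% K)) (1 - s)
    - Cexp (- (RtoC PI / 2 * Ci * s)) * dser (cres K j) (1 - s)).

Lemma affine_1s (f : C -> C) s0 : wm f (1 - s0) -> wm (fun s => f (1 - s)) s0.
Proof.
move=> h; have := @wm_comp f 1 s0 (- (1)) _ _; rewrite Cmod_opp Cmod_1 => /(_ erefl) H.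
apply: wm_ext (H _); first by apply: punct_true => z; congr f; ring.
by rewrite (_ : - (1) * s0 + 1 = 1 - s0) //; ring.
Qed.

Lemma affine_add (f : C -> C) a s0 : wm f (s0 + a) -> wm (fun s => f (s + a)) s0.
Proof.
move=> h; have := @wm_comp f a s0 1 _ _; rewrite Cmod_1 => /(_ erefl) H.
apply: wm_ext (H _); first by apply: punct_true => z; congr f; ring.
by rewrite (_ : 1 * s0 + a = s0 + a) //; ring.
Qed.

Lemma calG_wm s0 : wm calG s0.
Proof.
apply: wm_mul; last by apply: affine_1s; exact: Gamma_wm.
apply: wm_mul; first exact: wm_const.
by apply: (@affine_add (Rcpow (2 * PI)) (- (1))); apply: ana_wm; exact: Rcpow_ana.
Qed.

Lemma fe_side_wm K j s0 : (Re s0 < 0)%R -> wm (fe_side K j) s0.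
Proof.
move=> hs.
have hw : (1 < Re (1 - s0))%R by case: (s0) hs => a b /=; lra.
apply: wm_mul; first apply: wm_mul; first exact: calG_wm.
  by apply: affine_1s; apply: ana_wm; exact: ncpow_ana.
have hd r : wm (fun s => dser (cres K r) (1 - s)) s0.
  by apply: affine_1s; apply: ana_wm; apply: dser_ana => // n; exact: cres_le1.
have he c : wm (fun s => Cexp (c * s)) s0.
  by apply: ana_wm; apply: ana_exp; apply: ana_mul; [exact: ana_const | exact: ana_id].
apply: wm_sub; apply: wm_mul => //.
by apply: wm_ext (he (- (RtoC PI / 2 * Ci))); apply: punct_true => z; congr Cexp; ring.
Qed.

Lemma e_frac_neq1 j K : (0 < j < K)%N -> e (INR j / INR K) <> 1.
Proof.
move=> hj; set x := (INR j / INR K)%R.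
have hK : (0 < INR K)%R by apply: INR_gt0; lia.
have hx : (0 < x < 1)%R.
  split; first by apply: Rdiv_lt_0_compat => //; apply: INR_gt0; lia.
  apply: (Rmult_lt_reg_r (INR K)) => //; rewrite /x /Rdiv Rmult_assoc Rinv_l; last by lra.
  by rewrite Rmult_1_r Rmult_1_l; apply: lt_INR; lia.
move=> h; have := Cexp_clog1 hx; rewrite h Csub_diag; exact: Cexp_neq0.
Qed.

Lemma near_re_lt s0 a : (Re s0 < a)%R -> near_pt (fun s => (Re s < a)%R) s0.
Proof.
move=> h; exists ((a - Re s0) / 2)%R; split; first by lra.
move=> s hs; have := Rle_trans _ _ _ (re_le_Cmod (s - s0)) hs.
have -> : Re (s - s0) = (Re s - Re s0)%R by [].
by move/Rabs_le_between; lra.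
Qed.

Lemma near_re_gt s0 a : (a < Re s0)%R -> near_pt (fun s => (a < Re s)%R) s0.
Proof.
move=> h; exists ((Re s0 - a) / 2)%R; split; first by lra.
move=> s hs; have := Rle_trans _ _ _ (re_le_Cmod (s - s0)) hs.
have -> : Re (s - s0) = (Re s - Re s0)%R by [].
by move/Rabs_le_between; lra.
Qed.

Definition echar (K j n : nat) : C := e (INR (j * n) / INR K).

Lemma echar_le1 K j n : (Cmod (echar K j n) <= 1)%R.
Proof. by rewrite /echar Cmod_e; lra. Qed.

(** The discrete Lipschitz formula with [w = 1 - s], rewritten with
    [calG s = -i (2 pi)^(-w) Gamma w]. *)
Lemma fe_strip K j s : (0 < j < K)%N -> (-1 < Re s < 0)%R ->
  A2 (e (INR j / INR K)) s =
  (1 - e (INR j / INR K)) * (1 - e (INR j / INR K)) * fe_side K j s.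
Proof.
move=> hj hs; set x := (INR j / INR K)%R.
have hK : (0 < INR K)%R by apply: INR_gt0; lia.
have hx : (0 < x < 1)%R.
  split; first by apply: Rdiv_lt_0_compat => //; apply: INR_gt0; lia.
  apply: (Rmult_lt_reg_r (INR K)) => //; rewrite /x /Rdiv Rmult_assoc Rinv_l; last by lra.
  by rewrite Rmult_1_r Rmult_1_l; apply: lt_INR; lia.
pose w := 1 - s.
have hw : (1 < Re w < 2)%R by rewrite /w; case: (s) hs => a b /=; lra.
have H1 : Csum (fun n => Rcpow (x + INR n) (- w)) (ncpow K w * dser (cres K j) w).
  by apply: dser_residue; [lia | lia | lra].
have H2 : Csum (fun n => Rcpow (1 - x + INR n) (- w)) (ncpow K w * dser (cres K (K - j)) w).
  have -> : (1 - x = INR (K - j) / INR K)%R.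
    by rewrite -minusE minus_INR; [rewrite /x; field; lra | lia].
  by apply: dser_residue; [lia | lia | lra].
have sw : 1 - w = s by rewrite /w; ring.
have [_ HA] := @A2_ana (e x) s (Cmod_e x) ltac:(lra).
have HA' : Csum (fun M => d2 (1 - w) M * Cpow (e x) M) (A2 (e x) s) by rewrite sw.
have SE := strip_equation hw hx H1 H2 HA'.
have rg : rgamma w <> 0 by apply: rgamma_neq0_pos; lra.
have -> : A2 (e x) s = / rgamma w * (rgamma w * A2 (e x) s) by field.
rewrite SE /fe_side /calG -/w (Gamma_eq rg).
rewrite (_ : s - 1 = - w); last by rewrite /w; ring.
rewrite modn_small; last by lia.
rewrite (_ : (0, - (PI / 2))%R = - (0, PI / 2)%R :> C); last by rewrite /Copp /=; congr pair; ring.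
rewrite pair_Ci.
set h := RtoC PI / 2 * Ci.
have e1 : Cexp (h * s) = Ci * Cexp (w * - h).
  by rewrite -{1}Cexp_Ci_half -Cexp_add; congr Cexp; rewrite /w /h; ring.
have e2 : Cexp (- (h * s)) = - Ci * Cexp (w * h).
  rewrite (_ : - (h * s) = - h + w * h); last by rewrite /w; ring.
  rewrite Cexp_add Cexp_opp /h Cexp_Ci_half (_ : / Ci = - Ci) //.
  by rewrite /Cinv /Ci /Copp /=; congr pair; field.
rewrite e1 e2.
have ii : Ci * Ci = - (1) by rewrite /Ci /Cmult /Copp /RtoC /=; congr pair; ring.
set z1 := (1 - e x); set g := / rgamma w; set d1 := dser _ w; set d2' := dser _ w.
set a1 := Cexp (w * h); set a2 := Cexp (w * - h); set p := Rcpow _ _; set k := ncpow K w.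
transitivity (- (Ci * Ci) * z1 * z1 * g * p * k * (a1 * d1 + a2 * d2')); last by ring.
by rewrite ii; ring.
Qed.

(** A continuation of the periodic zeta function, with its functional equation. The
    equation is required at every point of the left half-plane, where there are no
    poles. *)
Definition is_perz (K j : nat) (A : C -> C) :=
  (forall s, wm A s) /\ (forall s, (Re s < 0)%R -> A s = fe_side K j s) /\
  (forall s, (1 < Re s)%R -> A s = dser (echar K j) s).

Lemma perz_nontrivial K j : (0 < j < K)%N -> exists A, is_perz K j A.
Proof.
move=> hj; pose z := e (INR j / INR K).
have z1 : 1 - z <> 0.
  by move=> h; apply: (e_frac_neq1 hj); rewrite -/z -(Cplus_0_l z) -h; ring.
pose c := / ((1 - z) * (1 - z)).
(* any abscissa strictly between [-1] and [0] would do *)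
pose A s := if Rlt_dec (Re s) (- 1 / 2) then fe_side K j s else c * A2 z s.
have Aleft s : (Re s < 0)%R -> A s = fe_side K j s.
  move=> hs; rewrite /A; case: Rlt_dec => // h; rewrite fe_strip //; last by lra.
  by rewrite /c -/z /=; field.
exists A; split; last split=> // s hs.
  move=> s0; case: (Rlt_dec (Re s0) 0) => h.
    apply: wm_ext (fe_side_wm K j h); apply: near_punct.
    by apply: near_pt_imp (near_re_lt h) => s /Aleft.
  have [Ha _] := @A2_ana z s0 (Cmod_e _) ltac:(lra).
  apply: wm_ext (ana_wm (ana_mul (ana_const c s0) Ha)); apply: near_punct.
  apply: near_pt_imp (@near_re_gt s0 (- 1 / 2) ltac:(lra)) => s hs.
  by rewrite /A; case: Rlt_dec => //= h2; lra.
rewrite /A; case: Rlt_dec => h; first by lra.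
rewrite (@A2_series z s (dser (echar K j) s)) ?Cmod_e //; first by rewrite /c /=; field.
have := dser_sum hs (echar_le1 K j); apply: Csum_ext => n.
rewrite /dterm /z e_pow /echar -multE mult_INR; congr (e _ * _); rewrite /Rdiv; ring.
Qed.

Lemma cres_mod K r r' n : (r = r' %[mod K])%N -> cres K r n = cres K r' n.
Proof. by rewrite /cres => ->. Qed.

Lemma dser_ext c c' s : (forall n, c n = c' n) -> dser c s = dser c' s.
Proof.
move=> h; rewrite /dser; congr CSer; apply: functional_extensionality => n.
by rewrite /dterm h.
Qed.

Lemma dser_odd s : (1 < Re s)%R -> dser (cres 2 1) s = (1 - ncpow 2 (- s)) * dser (fun=> 1) s.
Proof.
move=> hs; have one_le (n : nat) : (Cmod 1 <= 1)%R by rewrite Cmod_1; lra.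
have H1 := dser_sum hs one_le; have H0 := dser_sum hs (cres_le1 2 0).
rewrite (_ : _ * _ = dser (fun=> 1) s + - (1) * dser (cres 2 0) s).
  apply: CSer_eq; apply: Csum_ext (Csum_add H1 (Csum_scal (- (1)) H0)) => n.
  rewrite /dterm /cres !modn2 /=; case: (odd n) => /=; ring.
by rewrite dser_multiples //; ring.
Qed.

(** The alternating zeta function [B] is [2^(1-s) - 1] times [sum_n n^(-s)]; the
    functional equation of [B], whose dual series runs over the odd integers and is
    [1 - 2^(-w)] times the full series, yields that of the quotient. *)
Lemma perz_trivial K j : (0 < K)%N -> (j %% K = 0)%N -> exists A, is_perz K j A.
Proof.
move=> hK hj; have [B [Bwm [Bfe Bser]]] := @perz_nontrivial 2 1 isT.
pose q s := ncpow 2 (1 - s) - 1.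
have q_wm s0 : wm q s0.
  by apply: wm_sub; [apply: affine_1s; apply: ana_wm; exact: ncpow_ana | exact: wm_const].
have Cm s : Cmod (ncpow 2 (1 - s)) = exp ((1 - Re s) * ln 2).
  by rewrite Cmod_ncpow; congr (exp (_ * ln _)); case: (s) => a b /=; ring.
have l2 : (0 < ln 2)%R by rewrite -ln_1; apply: ln_increasing; lra.
have q1 s : Re s <> 1%R -> q s <> 0.
  move=> hs h; have := Cm s; rewrite (_ : ncpow 2 (1 - s) = q s + 1); last by rewrite /q; ring.
  rewrite h Cplus_0_l Cmod_1 => E.
  have : ln (exp ((1 - Re s) * ln 2)) = ln 1 by rewrite -E.
  rewrite ln_exp ln_1 => /Rmult_integral; lra.
have q_ne s0 : ~ punct (fun s => q s = 0) s0.
  move=> h; have h1 := @wm_identity q s0 2 q_wm h.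
  have h2 := @near_re_gt 2 1 ltac:(rewrite /=; lra).
  have [z [e1 e2]] := punct_ex (punct_and h1 (near_punct h2)).
  by apply: (q1 z) => //; lra.
exists (fun s => B s * / q s); split; first by move=> s; apply: wm_mul => //; exact: wm_inv.
split=> s hs.
  rewrite Bfe // /fe_side hj subn0.
  have hw : (1 < Re (1 - s))%R by case: (s) hs => a b /=; lra.
  have -> : dser (cres 2 (2 - 1 %% 2)) (1 - s) = dser (cres 2 1) (1 - s) by [].
  have -> : dser (cres K j) (1 - s) = dser (cres K 0) (1 - s).
    by apply: dser_ext => n; apply: cres_mod; rewrite hj mod0n.
  have -> : dser (cres K K) (1 - s) = dser (cres K 0) (1 - s).
    by apply: dser_ext => n; apply: cres_mod; rewrite modnn mod0n.
  rewrite dser_odd // dser_multiples // !ncpow_opp.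
  have qs := q1 s ltac:(lra); rewrite /q in qs *.
  have k0 := @ncpow_neq0 K (1 - s); have t0 := @ncpow_neq0 2 (1 - s).
  by field; do !split.
have qs := q1 s ltac:(lra).
have one_le (n : nat) : (Cmod 1 <= 1)%R by rewrite Cmod_1; lra.
have -> : dser (echar K j) s = dser (fun=> 1) s.
  apply: dser_ext => n; rewrite /echar.
  have /dvdnP [m ->] : (K %| j)%N by rewrite /dvdn hj.
  have hKp := INR_gt0 hK.
  have -> : (INR (m * K * n) / INR K = INR (m * n))%R.
    by rewrite -!multE !mult_INR; field; lra.
  exact: e_INR.
have -> : B s = 2 * dser (cres 2 0) s - dser (fun=> 1) s.
  rewrite Bser //; apply: CSer_eq.
  have := Csum_add (Csum_scal 2 (dser_sum hs (cres_le1 2 0))) (Csum_scal (- (1)) (dser_sum hs one_le)).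
  rewrite (_ : _ + _ = 2 * dser (cres 2 0) s - dser (fun=> 1) s); last by ring.
  apply: Csum_ext => n; rewrite /dterm /echar mul1n /cres modn2.
  have eh : e (1 / 2) = - (1).
    by rewrite e_def (_ : 2 * PI * (1 / 2) = PI)%R; [rewrite cos_PI sin_PI /Copp /RtoC /=; congr pair; ring | field].
  have -> : (INR n.+1 / INR 2 = INR n.+1 * (1 / 2))%R by rewrite /=; field.
  rewrite -e_pow eh.
  have -> : Cpow (- (1)) n.+1 = if odd n.+1 then - (1) else RtoC 1.
    by elim: (n.+1) => [|m IH] //; rewrite Cpow_S IH /=; case: (odd m) => /=; ring.
  by rewrite mod0n; case: (odd n.+1) => /=; ring.
rewrite dser_multiples // /q in qs *.
have -> : 2 * (ncpow 2 (- s) * dser (fun=> 1) s) - dser (fun=> 1) s = (ncpow 2 (1 - s) - 1) * dser (fun=> 1) s.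
  rewrite /Cminus ncpow_add ncpow_1 // (_ : RtoC (INR 2) = 2); last by congr RtoC; rewrite /=; lra.
  by ring.
by field.
Qed.

Theorem perz_ex K j : (0 < K)%N -> exists A, is_perz K j A.
Proof.
move=> hK; case: (posnP (j %% K)) => h; first exact: perz_trivial.
have hj : (0 < j %% K < K)%N by rewrite h ltn_mod hK.
have [A [A1 [A2' A3]]] := @perz_nontrivial K (j %% K) hj.
exists A; split=> //; split=> s hs; last first.
  rewrite A3 //; apply: dser_ext => n; rewrite /echar.
  have hKp := INR_gt0 hK.
  have -> : (INR (j * n) / INR K = INR (j %% K * n) / INR K + INR (j %/ K * n))%R.
    by rewrite {1}(divn_eq j K) -!multE -plusE !mult_INR plus_INR mult_INR; field; lra.
  by rewrite e_add e_INR Cmult_1_r.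
rewrite A2' // /fe_side modn_mod; congr (_ * (_ - _ * _)).
by apply: dser_ext => n; apply: cres_mod; rewrite modn_mod.
Qed.

(** * Products of three Dirichlet series *)

(** The coefficient at [n] of a triple Dirichlet series with coefficients [G]. The
    summation ranges are those of [tau], so that [tau] is an instance by conversion. *)
Definition tcoef (G : nat -> nat -> nat -> C) (n : nat) : C :=
  \csum_(1 <= x < n.+1) \csum_(1 <= y < n.+1)
    \csum_(1 <= z < n.+1 | (x * y * z == n)%N) G x y z.

Lemma csum_widen0 n M (F : nat -> C) : (n <= M)%N -> (forall i, (n <= i)%N -> F i = 0) ->
  \csum_(1 <= i < n) F i = \csum_(1 <= i < M) F i.
Proof.
move=> hn H; rewrite (big_nat_widen _ _ _ _ _ hn) big_mkcond /=; apply: eq_bigr => i _.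
by case: ltnP => // /H ->.
Qed.

Lemma tcoef_widen G n M : (0 < n <= M)%N -> tcoef G n =
  \csum_(1 <= x < M.+1) \csum_(1 <= y < M.+1) \csum_(1 <= z < M.+1)
    (if (x * y * z == n)%N then G x y z else 0).
Proof.
move=> hn; rewrite /tcoef.
have hz x y z : (n < z)%N -> (0 < x)%N -> (0 < y)%N -> (x * y * z == n)%N = false.
  move=> hz hx hy; apply/negbTE; rewrite neq_ltn; apply/orP; right.
  by apply: leq_trans hz _; rewrite leq_pmull // muln_gt0 hx.
have hy x y z : (n < y)%N -> (0 < x)%N -> (0 < z)%N -> (x * y * z == n)%N = false.
  by move=> h1 h2 h3; rewrite -mulnA (mulnC y) mulnA; exact: hz.
have hx x y z : (n < x)%N -> (0 < y)%N -> (0 < z)%N -> (x * y * z == n)%N = false.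
  by move=> h1 h2 h3; rewrite (mulnC x); exact: hy.
transitivity (\csum_(1 <= x < n.+1) \csum_(1 <= y < M.+1) \csum_(1 <= z < M.+1)
    (if (x * y * z == n)%N then G x y z else 0)); last first.
  apply: csum_widen0; first by lia.
  move=> x h; rewrite big_nat big1 // => y /andP [h1 _]; rewrite big_nat big1 // => z /andP [h2 _].
  by rewrite hx.
apply: eq_big_nat => x /andP [h1 _].
transitivity (\csum_(1 <= y < n.+1) \csum_(1 <= z < M.+1)
    (if (x * y * z == n)%N then G x y z else 0)); last first.
  apply: csum_widen0; first by lia.
  by move=> y h; rewrite big_nat big1 // => z /andP [h2 _]; rewrite hy.
apply: eq_big_nat => y /andP [h2 _]; rewrite big_mkcond /=.
apply: csum_widen0; first by lia.
by move=> z h; rewrite hz.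
Qed.

Lemma tcoef_ext G G' n : (forall x y z, (0 < x)%N -> (0 < y)%N -> (0 < z)%N -> (x * y * z = n)%N -> G x y z = G' x y z) ->
  tcoef G n = tcoef G' n.
Proof.
move=> H; apply: eq_big_nat => x /andP [h1 _]; apply: eq_big_nat => y /andP [h2 _].
rewrite big_nat_cond [RHS]big_nat_cond; apply: eq_bigr => z /andP [/andP [h3 _] /eqP h4]; exact: H.
Qed.

Lemma tcoef_scal c G n : c * tcoef G n = tcoef (fun x y z => c * G x y z) n.
Proof.
rewrite /tcoef csum_mull; apply: eq_bigr => x _; rewrite csum_mull; apply: eq_bigr => y _.
by rewrite csum_mull.
Qed.

Lemma tcoef_csum I (r : seq I) (P : pred I) (G : I -> nat -> nat -> nat -> C) n :
  \big[Cplus/RtoC 0]_(i <- r | P i) tcoef (G i) n =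
  tcoef (fun x y z => \big[Cplus/RtoC 0]_(i <- r | P i) G i x y z) n.
Proof.
rewrite /tcoef exchange_big; apply: eq_bigr => x _; rewrite exchange_big; apply: eq_bigr => y _.
by rewrite exchange_big.
Qed.

Definition pw3 (a b c : C) (x y z : nat) : C := ncpow x (- a) * ncpow y (- b) * ncpow z (- c).

Lemma tauE a b c n : tau a b c n = tcoef (pw3 a b c) n.
Proof. by []. Qed.

Lemma dser_triple (p q r : nat -> C) a b c s :
  (forall n, (Cmod (p n) <= 1)%R) -> (forall n, (Cmod (q n) <= 1)%R) -> (forall n, (Cmod (r n) <= 1)%R) ->
  (1 < Re (s + a))%R -> (1 < Re (s + b))%R -> (1 < Re (s + c))%R ->
  Csum (dterm (tcoef (fun x y z => p x * q y * r z * pw3 a b c x y z)) s)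
       (dser p (s + a) * dser q (s + b) * dser r (s + c)).
Proof.
move=> hp hq hr ha hb hc.
have [Ba Aa] := dterm_asum ha hp; have [Bb Ab] := dterm_asum hb hq; have [Bc Ac] := dterm_asum hc hr.
have := @Csum3_prod _ _ _ _ _ _ _ _ _ (fun N x y z => (x.+1 * y.+1 * z.+1 <= N)%N) Aa Ab Ac
   (dser_sum ha hp) (dser_sum hb hq) (dser_sum hc hr) _.
have hE : forall X, exists N0, forall N, (N0 <= N)%N -> forall x y z, (x < X)%N -> (y < X)%N -> (z < X)%N ->
    (x.+1 * y.+1 * z.+1 <= N)%N.
  move=> X; exists (X * X * X)%N => N hN x y z hx hy hz; apply: leq_trans hN.
  by apply: leq_mul => //; apply: leq_mul.
move=> /(_ hE); apply: Clim_ext => N.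
pose G' x y z := p x * q y * r z * pw3 (s + a) (s + b) (s + c) x y z.
transitivity (\csum_(1 <= x < N.+1) \csum_(1 <= y < N.+1) \csum_(1 <= z < N.+1)
   (if (x * y * z <= N)%N then G' x y z else 0)).
  rewrite big_add1; apply: eq_bigr => x _; rewrite big_add1; apply: eq_bigr => y _.
  rewrite big_add1 big_mkcond; apply: eq_bigr => z _; case: ifP => // _.
  by rewrite /G' /pw3 /dterm; ring.
transitivity (\csum_(0 <= n < N) \csum_(1 <= x < N.+1) \csum_(1 <= y < N.+1) \csum_(1 <= z < N.+1)
   (if (x * y * z == n.+1)%N then G' x y z else 0)).
  rewrite [RHS]exchange_big /=; apply: eq_big_nat => x /andP [h1 _].
  rewrite [RHS]exchange_big /=; apply: eq_big_nat => y /andP [h2 _].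
  rewrite [RHS]exchange_big /=; apply: eq_big_nat => z /andP [h3 _].
  have h4 : (0 < x * y * z)%N by rewrite !muln_gt0 h1 h2.
  have hE2 k : (x * y * z == k.+1)%N = (k == (x * y * z).-1)%N by lia.
  rewrite (eq_bigr (fun k => if (k == (x * y * z).-1)%N then G' x y z else 0)); last by move=> k _; rewrite hE2.
  rewrite -big_mkcond big_nat1_eq leq0n /=.
  by have -> : ((x * y * z).-1 < N)%N = (x * y * z <= N)%N by lia.
apply: eq_big_nat => n hn; rewrite /dterm (@tcoef_widen _ n.+1 N) //.
rewrite csum_mulr; apply: eq_big_nat => x /andP [h1 _].
rewrite csum_mulr; apply: eq_big_nat => y /andP [h2 _].
rewrite csum_mulr; apply: eq_big_nat => z /andP [h3 _].
case: eqP => h; last by ring.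
rewrite -h /G' /pw3 !ncpow_mul ?muln_gt0 ?h1 ?h2 //.
have E t x' : ncpow x' (- (s + t)) = ncpow x' (- s) * ncpow x' (- t).
  by rewrite -ncpow_add; congr ncpow; ring.
by rewrite !E; ring.
Qed.

(** * Finite Fourier analysis modulo [K] *)

Definition om (K n : nat) : C := e (INR n / INR K).

Lemma om_add K m n : om K (m + n) = om K m * om K n.
Proof. by rewrite /om -e_add -plusE plus_INR; congr e; rewrite /Rdiv; ring. Qed.

Lemma om_K K n : (0 < K)%N -> om K (n * K) = 1.
Proof.
move=> hK; have hKp := INR_gt0 hK.
by rewrite /om -multE mult_INR (_ : _ / _ = INR n)%R; [exact: e_INR | field; lra].
Qed.

Lemma om_mod K n : (0 < K)%N -> om K (n %% K) = om K n.
Proof. by move=> hK; rewrite {2}(divn_eq n K) om_add om_K // Cmult_1_l. Qed.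

Lemma om_eqmod K m n : (0 < K)%N -> (m = n %[mod K])%N -> om K m = om K n.
Proof. by move=> hK h; rewrite -(om_mod m hK) h om_mod. Qed.

Lemma om_scale K g n : (0 < g)%N -> (0 < K)%N -> om (K * g) (n * g) = om K n.
Proof.
move=> hg hK; have h1 := INR_gt0 hg; have h2 := INR_gt0 hK.
by rewrite /om -!multE !mult_INR; congr e; field; lra.
Qed.

Lemma om_sum K n : (0 < K)%N -> \csum_(0 <= x < K) om K (x * n) = if (K %| n)%N then RtoC (INR K) else 0.
Proof.
move=> hK; rewrite -roots_sum //; apply: eq_bigr => x _; rewrite /om -multE mult_INR; congr e.
by rewrite /Rdiv; ring.
Qed.

Lemma echarE K j n : echar K j n = om K (j * n).
Proof. by []. Qed.

Lemma csum_residue K X (F : nat -> C) : (0 < K)%N ->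
  \csum_(0 <= x < K) (if (x == X %[mod K])%N then F x else 0) = F (X %% K)%N.
Proof.
move=> hK; rewrite (eq_big_nat _ _ (F2 := fun x => if (x == X %% K)%N then F x else 0)).
  by rewrite -big_mkcond big_nat1_eq leq0n ltn_mod hK.
by move=> x /andP [_ hx]; rewrite (modn_small hx).
Qed.

Lemma negmod_dvd K x X : (0 < K)%N -> (K %| K.-1 * x + X)%N = (x == X %[mod K])%N.
Proof.
move=> hK; rewrite -[RHS](eqn_modDl (K.-1 * x)).
have -> : (K.-1 * x + x = K * x)%N by case: K hK => // K _ /=; lia.
by rewrite modnMr eq_sym.
Qed.

(** Fourier inversion modulo [K]; natural numbers are used for residues, so [K - 1]
    plays the role of [-1]. *)
Lemma fourier_inv K X (F : nat -> C) : (0 < K)%N ->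
  \csum_(0 <= j < K) ((\csum_(0 <= x < K) (F x * om K (K.-1 * j * x))) * om K (j * X)) =
  RtoC (INR K) * F (X %% K)%N.
Proof.
move=> hK; rewrite -(csum_residue X F hK) csum_mull.
rewrite (eq_bigr (fun j => \csum_(0 <= x < K) (F x * om K (j * (K.-1 * x + X))))); last first.
  move=> j _; rewrite csum_mulr; apply: eq_bigr => x _.
  rewrite -Cmult_assoc -om_add; congr (_ * om K _); lia.
rewrite exchange_big /=; apply: eq_bigr => x _.
rewrite -csum_mull om_sum // negmod_dvd //; case: ifP => _; ring.
Qed.

(** * The complete exponential sum *)

Definition csum3 (K h l m n : nat) : C :=
  \csum_(0 <= x < K) \csum_(0 <= y < K) \csum_(0 <= z < K) om K (h * x * y * z + l * x + m * y + n * z).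

Lemma csum3_mod K h l l' m m' n n' : (0 < K)%N -> (l = l' %[mod K])%N -> (m = m' %[mod K])%N ->
  (n = n' %[mod K])%N -> csum3 K h l m n = csum3 K h l' m' n'.
Proof.
move=> hK h1 h2 h3; rewrite /csum3; apply: eq_bigr => x _; apply: eq_bigr => y _; apply: eq_bigr => z _.
have E a a' b : (a = a' %[mod K])%N -> om K (a * b) = om K (a' * b).
  by move=> hh; apply: om_eqmod => //; rewrite -modnMml hh modnMml.
by rewrite !om_add (E l l') // (E m m') // (E n n').
Qed.

(** Three applications of Fourier inversion. *)
Lemma csum3_fourier K h X Y Z : (0 < K)%N ->
  \csum_(0 <= j1 < K) \csum_(0 <= j2 < K) \csum_(0 <= j3 < K)
    (csum3 K h (K.-1 * j1) (K.-1 * j2) (K.-1 * j3) * (om K (j1 * X) * om K (j2 * Y) * om K (j3 * Z))) =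
  RtoC (INR K) * RtoC (INR K) * RtoC (INR K) * om K (h * X * Y * Z).
Proof.
move=> hK.
have cong u v t : (u = v %[mod K] -> u * t = v * t %[mod K])%N.
  by move=> E; rewrite -modnMml E modnMml.
transitivity (\csum_(0 <= j1 < K) ((\csum_(0 <= x < K)
    ((RtoC (INR K) * RtoC (INR K) * om K (h * x * Y * Z)) * om K (K.-1 * j1 * x))) * om K (j1 * X))); last first.
  rewrite fourier_inv //; rewrite (@om_eqmod K (h * (X %% K) * Y * Z) (h * X * Y * Z)) //; first by ring.
  by apply: (cong); apply: (cong); rewrite modnMmr.
apply: eq_bigr => j1 _.
transitivity (\csum_(0 <= x < K) ((\csum_(0 <= j2 < K) ((\csum_(0 <= y < K)
   ((RtoC (INR K) * om K (h * x * y * Z)) * om K (K.-1 * j2 * y))) * om K (j2 * Y))) * om K (K.-1 * j1 * x) * om K (j1 * X))); last first.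
  rewrite csum_mulr; apply: eq_bigr => x _; congr (_ * _ * _).
  rewrite fourier_inv //; rewrite (@om_eqmod K (h * x * (Y %% K) * Z) (h * x * Y * Z)) //; first by ring.
  by apply: cong; rewrite modnMmr.
transitivity (\csum_(0 <= x < K) ((\csum_(0 <= j2 < K) ((\csum_(0 <= y < K)
   ((\csum_(0 <= j3 < K) ((\csum_(0 <= z < K) (om K (h * x * y * z) * om K (K.-1 * j3 * z))) * om K (j3 * Z))) *
     om K (K.-1 * j2 * y))) * om K (j2 * Y))) * om K (K.-1 * j1 * x) * om K (j1 * X))); last first.
  apply: eq_bigr => x _; congr (_ * _ * _); apply: eq_bigr => j2 _; congr (_ * _).
  apply: eq_bigr => y _; congr (_ * _).
  rewrite fourier_inv //; rewrite (@om_eqmod K (h * x * y * (Z %% K)) (h * x * y * Z)) //.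
  by rewrite modnMmr.
rewrite /csum3.
(* both sides are now rearrangements of the same sixfold sum *)
transitivity (\csum_(0 <= j2 < K) \csum_(0 <= j3 < K) \csum_(0 <= x < K) \csum_(0 <= y < K) \csum_(0 <= z < K)
  (om K (h * x * y * z) * om K (K.-1 * j1 * x) * om K (K.-1 * j2 * y) * om K (K.-1 * j3 * z) *
   (om K (j1 * X) * om K (j2 * Y) * om K (j3 * Z)))).
  apply: eq_bigr => j2 _; apply: eq_bigr => j3 _.
  rewrite csum_mulr; apply: eq_bigr => x _; rewrite csum_mulr; apply: eq_bigr => y _; rewrite csum_mulr; apply: eq_bigr => z _.
  by rewrite !om_add.
rewrite [RHS](eq_bigr (fun x => \csum_(0 <= j2 < K) \csum_(0 <= j3 < K) \csum_(0 <= y < K) \csum_(0 <= z < K)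
   (om K (h * x * y * z) * om K (K.-1 * j1 * x) * om K (K.-1 * j2 * y) * om K (K.-1 * j3 * z) *
   (om K (j1 * X) * om K (j2 * Y) * om K (j3 * Z))))); last first.
  move=> x _; rewrite !csum_mulr; apply: eq_bigr => j2 _.
  rewrite !csum_mulr [RHS]exchange_big /=; apply: eq_bigr => y _.
  rewrite !csum_mulr; apply: eq_bigr => j3 _.
  rewrite !csum_mulr; apply: eq_bigr => z _; ring.
rewrite [RHS]exchange_big; apply: eq_bigr => j2 _; by rewrite [RHS]exchange_big.
Qed.

(** * Sums over divisors *)

Lemma csum_divisors n M (F : nat -> C) : (0 < n)%N -> (n < M)%N ->
  \csum_(d <- divisors n) F d = \csum_(0 <= d < M) (if (d %| n)%N then F d else 0).
Proof.
move=> hn hM; rewrite -big_mkcond -[RHS]big_filter; apply: perm_big; apply: uniq_perm.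
- exact: divisors_uniq.
- by apply: filter_uniq; exact: iota_uniq.
move=> d; rewrite mem_filter -dvdn_divisors // mem_index_iota /=.
by case: (boolP (d %| n)%N) => // h; have := dvdn_leq hn h; lia.
Qed.

Lemma csum_multiples N m (F : nat -> C) : (0 < N)%N ->
  \csum_(0 <= j < m * N) (if (N %| j)%N then F j else 0) = \csum_(0 <= k < m) F (k * N)%N.
Proof.
move=> HN; elim: m => [|m IH]; first by rewrite mul0n !big_geq.
rewrite mulSn (@big_cat_nat _ _ _ (m * N)) //=; last by rewrite leq_addl.
rewrite IH csum_recr; congr Cplus.
rewrite big_nat_shift.
case: N HN {IH} => // N _; rewrite csum_recl add0n dvdn_mull //.
rewrite big_nat big1 ?Cplus_0_r // => i Hi.
rewrite addnC dvdn_addr ?dvdn_mull //.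
by case: ifP => // /dvdnP [q Hq]; case: q Hq => [|q]; lia.
Qed.

Lemma if_if_and (b c : bool) (x : C) : (if b then (if c then x else 0) else 0) = if b && c then x else 0.
Proof. by case: b; case: c. Qed.

(** Both sides run over the pairs [(g, f)] with [gf] dividing [n]. *)
Lemma csum_divisors_pair n (F : nat -> nat -> C) : (0 < n)%N ->
  \csum_(g <- divisors n) \csum_(f <- divisors (n %/ g)) F g f =
  \csum_(d <- divisors n) \csum_(g <- divisors d) F g (d %/ g)%N.
Proof.
move=> hn.
transitivity (\csum_(0 <= g < n.+1) \csum_(0 <= f < n.+1) (if (g * f %| n)%N then F g f else 0)).
  rewrite (@csum_divisors n n.+1) //; apply: eq_bigr => g _; case: ifP => hg.
    have g0 : (0 < g)%N by case: g hg => //; rewrite dvd0n; lia.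
    have q0 : (0 < n %/ g)%N by rewrite divn_gt0 //; exact: dvdn_leq.
    rewrite (@csum_divisors _ n.+1) //; last by rewrite ltnS leq_div.
    by apply: eq_bigr => f _; rewrite dvdn_divRL // mulnC.
  rewrite big1 // => f _; case: ifP => // h.
  by move: hg; rewrite (dvdn_trans _ h) // dvdn_mulr.
transitivity (\csum_(0 <= d < n.+1) \csum_(0 <= g < n.+1) (if (d %| n)%N then if (g %| d)%N then F g (d %/ g)%N else 0 else 0)); last first.
  rewrite (@csum_divisors n n.+1) //; apply: eq_bigr => d _; case: ifP => hd; last by rewrite big1.
  have d0 : (0 < d)%N by case: d hd => //; rewrite dvd0n; lia.
  by rewrite (@csum_divisors d n.+1) // ltnS; exact: dvdn_leq.
rewrite [RHS]exchange_big; apply: eq_bigr => g _; case: (posnP g) => [->|g0].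
  rewrite big1; last by move=> f _; rewrite mul0n dvd0n; case: ifP => // h; lia.
  rewrite big1 // => d _; case: ifP => // h1; rewrite dvd0n; case: eqP => // h2.
  by move: h1; rewrite h2 dvd0n; lia.
transitivity (\csum_(0 <= d < n.+1 * g) (if (g %| d)%N then if (d %| n)%N then F g (d %/ g)%N else 0 else 0)).
  rewrite csum_multiples //; apply: eq_bigr => f _; rewrite mulnK // mulnC //.
rewrite (@big_cat_nat _ _ _ n.+1) //=; last by rewrite leq_pmulr.
rewrite [X in _ + X]big_nat [X in _ + X]big1 ?Cplus_0_r; last first.
  by move=> d hd; case: ifP => // _; case: ifP => // h; have := dvdn_leq hn h; lia.
by apply: eq_bigr => d _; case: ifP; case: ifP.
Qed.

(** * The Moebius function *)

Lemma mu_prime_mul p n : prime p -> (0 < n)%N ->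
  mu (p * n) = if (p %| n)%N then 0%Z else (- mu n)%Z.
Proof.
move=> hp hn; have p0 := prime_gt0 hp.
have hl q : prime q -> logn q (p * n) = ((q == p) + logn q n)%N.
  by move=> hq; rewrite lognM // logn_prime.
case: ifP => hd.
  rewrite /mu; case: ifP => // /allP h.
  have := h p; rewrite mem_primes hp muln_gt0 p0 hn dvdn_mulr // => /(_ isT).
  rewrite hl // eqxx; have : (0 < logn p n)%N by rewrite logn_gt0 mem_primes hp hn.
  by lia.
have hperm : perm_eq (primes (p * n)) (p :: primes n).
  apply: uniq_perm; first exact: primes_uniq.
    by rewrite /= primes_uniq andbT mem_primes hp hn hd.
  move=> q; rewrite primesM // inE primes_prime // inE.
  by [].
rewrite /mu (perm_all _ hperm) (perm_size hperm) [all _ _]/= [size _]/=.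
have -> : logn p (p * n) == 1%N.
  by rewrite hl // eqxx; have : logn p n = 0%N by [apply/eqP; rewrite -leqn0 leqNgt logn_gt0 mem_primes hp hn hd]; lia.
rewrite andTb.
have -> : all (fun q => logn q (p * n) == 1%N) (primes n) = all (fun q => logn q n == 1%N) (primes n).
  apply: eq_in_all => q; rewrite mem_primes => /and3P [hq _ hqn]; rewrite hl //.
  by have -> : (q == p) = false by [apply/eqP => E; move: hd; rewrite -E hqn].
by case: ifP => // _; rewrite Nat2Z.inj_succ Z.pow_succ_r; lia.
Qed.

Definition muC (n : nat) : C := RtoC (IZR (mu n)).

(** With [p] a prime factor of [n], the divisors divisible by [p] cancel those prime to
    [p], by [mu_prime_mul]. *)
Lemma mu_sum n : (0 < n)%N -> \csum_(h <- divisors n) muC h = if n == 1%N then RtoC 1 else 0.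
Proof.
move=> hn; case: eqP => [->|h1].
  by rewrite (_ : divisors 1 = [:: 1%N]) // big_cons big_nil /muC /mu /= Cplus_0_r.
pose p := pdiv n.
have hp : prime p by apply: pdiv_prime; lia.
have hpn : (p %| n)%N := pdiv_dvd n.
have p0 := prime_gt0 hp.
pose q := (n %/ p)%N; have En : n = (p * q)%N by rewrite /q mulnC divnK.
have q0 : (0 < q)%N by move: hn; rewrite En muln_gt0 => /andP [].
pose S := \csum_(0 <= h < n.+1) (if (h %| q)%N then if (p %| h)%N then RtoC 0 else muC h else 0).
have qn : (q <= n)%N by rewrite En leq_pmull.
have ext M : (n < M)%N -> \csum_(0 <= h < M) (if (h %| q)%N then if (p %| h)%N then RtoC 0 else muC h else 0) = S.
  move=> hM; rewrite (@big_cat_nat _ _ _ n.+1) //= [X in _ + X]big_nat [X in _ + X]big1 ?Cplus_0_r // => h hh.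
  by case: ifP => // hd; have := dvdn_leq q0 hd; lia.
rewrite (@csum_divisors n (n.+1 * p)) //; last by apply: leq_pmulr.
rewrite (eq_bigr (fun h => (if (h %| q)%N then if (p %| h)%N then RtoC 0 else muC h else 0) +
    (if (p %| h)%N then (if (h %| n)%N then muC h else 0) else 0))); last first.
  move=> h _; case: (boolP (p %| h)%N) => hph.
    by case: ifP => _; case: ifP => _; rewrite Cplus_0_l.
  rewrite Cplus_0_r; congr (if _ then _ else _).
  by rewrite En Gauss_dvdr // coprime_sym prime_coprime.
rewrite big_split /= ext; last by apply: leq_pmulr.
rewrite csum_multiples //.
have -> : \csum_(0 <= k < n.+1) (if (k * p %| n)%N then muC (k * p) else 0) = - S.
  rewrite (_ : - S = - (1) * S); last by ring.
  rewrite /S csum_mull; apply: eq_bigr => k _.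
  rewrite {1}En mulnC dvdn_pmul2l //; case: ifP => hk; last by ring.
  have k0 : (0 < k)%N by case: k hk => //; rewrite dvd0n; lia.
  rewrite /muC mu_prime_mul //; case: ifP => _; first by ring.
  by rewrite opp_IZR RtoC_opp; ring.
by ring.
Qed.

(** * Counting divisors by Moebius inversion *)

Lemma gcd_level_dvd d n l g : (0 < d)%N -> (0 < g)%N -> (g %| gcdn d n)%N ->
  (d %| l * (gcdn d n %/ g))%N = (g %| l)%N && (d * g %| l * n)%N.
Proof.
move=> d0 g0 hg; rewrite -(@dvdn_pmul2r g) // -mulnA divnK // muln_gcdr dvdn_gcd.
by rewrite (mulnC l d) (dvdn_pmul2l d0).
Qed.

Lemma csum_pick (n a : nat) (c : nat) (F : nat -> C) :
  \csum_(a <= i < n) (if (i == c)%N then F i else 0) = if (a <= c < n)%N then F c else 0.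
Proof. by rewrite -big_mkcond big_nat1_eq. Qed.

Lemma csum_if (b : bool) I (r : seq I) (P : pred I) (F : I -> C) :
  \big[Cplus/RtoC 0]_(i <- r | P i) (if b then F i else 0) =
  if b then \big[Cplus/RtoC 0]_(i <- r | P i) F i else 0.
Proof. by case: b => //; rewrite big1. Qed.

Lemma csum_quotient k e n (x : C) : (0 < k)%N -> (0 < e <= n)%N ->
  \csum_(1 <= w < n.+1) (if (k * w == e)%N then x else 0) = if (k %| e)%N then x else 0.
Proof.
move=> hk he; case: (boolP (k %| e)%N) => h.
  rewrite (eq_bigr (fun w => if (w == e %/ k)%N then x else 0)); last first.
    by move=> w _; rewrite eqn_div // mulnC.
  rewrite csum_pick divn_gt0 // dvdn_leq //; last by lia.
  by rewrite ltnS (leq_trans (leq_div _ _)) //; lia.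
by rewrite big1 // => w _; case: eqP => // E; move: h; rewrite -E dvdn_mulr.
Qed.

(** Since [huvw = d], the conditions on [l] and [m] become
    [d | lu] and [d | mv]. With [u] and [v] fixed, a value of [w] exists when [uvh | d], so
    the sum of [mu(h)] runs over the [h] with [uvh | gcd(d, n)] and equals [1] when
    [uv = gcd(d, n)] and [0] otherwise. Finally [g = v], and [d | l gcd(d, n)/g] is
    rewritten by [gcd_level_dvd]. *)
Lemma mu_count d l m n : (0 < d)%N ->
  \csum_(h <- divisors d) (muC h * tcoef (fun u v w =>
      if [&& h * v * w %| l, h * u * w %| m & h * u * v %| n]%N then RtoC 1 else 0) (d %/ h)) =
  \csum_(g <- divisors d)
     (if [&& g %| l, g %| n, d %/ g %| m & d * g %| l * n]%N then RtoC 1 else 0).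
Proof.
move=> d0; pose G := gcdn d n; have G0 : (0 < G)%N by rewrite gcdn_gt0 d0.
have Gd : (G <= d)%N by apply: dvdn_leq => //; exact: dvdn_gcdl.
transitivity (\csum_(1 <= u < d.+1) \csum_(1 <= v < d.+1) \csum_(0 <= h < d.+1)
   (if (u * v * h %| d)%N then (if [&& d %| l * u, d %| m * v & u * v * h %| n]%N then muC h else 0) else 0)).
  rewrite (@csum_divisors d d.+1) //.
  transitivity (\csum_(0 <= h < d.+1) \csum_(1 <= u < d.+1) \csum_(1 <= v < d.+1)
   (if (u * v * h %| d)%N then (if [&& d %| l * u, d %| m * v & u * v * h %| n]%N then muC h else 0) else 0)); last first.
    rewrite exchange_big; apply: eq_bigr => u _; by rewrite exchange_big.
  apply: eq_bigr => h _; case: ifP => hd; last first.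
    rewrite big1 // => u _; rewrite big1 // => v _; case: ifP => // hh.
    by move: hd; rewrite (dvdn_trans _ hh) // dvdn_mull.
  have h0 : (0 < h)%N by case: h hd => //; rewrite dvd0n; lia.
  have hle := dvdn_leq d0 hd.
  have e0 : (0 < d %/ h)%N by rewrite divn_gt0.
  rewrite (@tcoef_widen _ _ d); last by rewrite e0 leq_div.
  rewrite csum_mull; apply: eq_big_nat => u /andP [u0 _].
  rewrite csum_mull; apply: eq_big_nat => v /andP [v0 _].
  rewrite csum_mull.
  rewrite (eq_big_nat _ _ (F2 := fun w => if (u * v * w == d %/ h)%N then
      (if [&& d %| l * u, d %| m * v & u * v * h %| n]%N then muC h else 0) else 0)); last first.
    move=> w /andP [w0 _]; case: eqP => E; last by ring.
    have Ed : (h * u * v * w = d)%N by rewrite -!mulnA mulnA mulnA -(mulnA _ v) -mulnA (mulnA u) E mulnC divnK.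
    rewrite -(@dvdn_pmul2r u (h * v * w) l) // -(@dvdn_pmul2r v (h * u * w) m) //.
    have -> : (h * v * w * u = d)%N by rewrite -Ed; lia.
    have -> : (h * u * w * v = d)%N by rewrite -Ed; lia.
    have -> : (h * u * v = u * v * h)%N by lia.
    by case: ifP => _; ring.
  rewrite csum_quotient ?muln_gt0 ?u0 //; last by rewrite e0 leq_div.
  by rewrite dvdn_divRL.
transitivity (\csum_(1 <= u < d.+1) \csum_(1 <= v < d.+1)
   (if (v * u == G)%N then (if (d %| l * u)%N && (d %| m * v)%N then RtoC 1 else 0) else 0)).
  apply: eq_big_nat => u /andP [u0 _]; apply: eq_big_nat => v /andP [v0 _].
  have uv0 : (0 < u * v)%N by rewrite muln_gt0 u0.
  rewrite (eq_bigr (fun h => if (d %| l * u)%N && (d %| m * v)%N then (if (u * v * h %| G)%N then muC h else 0) else 0)); last first.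
    move=> h _; rewrite /G dvdn_gcd; case: (d %| l * u)%N; case: (d %| m * v)%N; rewrite /= ?if_same //.
    by rewrite if_if_and.
  rewrite csum_if; case: ifP => _; last by rewrite if_same.
  case: (boolP (u * v %| G)%N) => huv; last first.
    rewrite big1; last by move=> h _; case: ifP => // hh; move: huv; rewrite (dvdn_trans _ hh) // dvdn_mulr.
    by case: eqP => // E; move: huv; rewrite -E mulnC dvdnn.
  have q0 : (0 < G %/ (u * v))%N by rewrite divn_gt0 //; exact: dvdn_leq.
  rewrite (eq_bigr (fun h => if (h %| G %/ (u * v))%N then muC h else 0)); last first.
    by move=> h _; rewrite dvdn_divRL // mulnC.
  rewrite -csum_divisors // ?mu_sum //; last by apply: leq_ltn_trans (leq_div _ _) _; lia.
  by rewrite eq_sym eqn_div // mul1n mulnC.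
rewrite exchange_big (@csum_divisors d d.+1) //= [RHS](@big_ltn _ _ _ 0 d.+1) //.
rewrite dvd0n (_ : (d == 0)%N = false) ?Cplus_0_l; last by lia.
apply: eq_big_nat => g /andP [g0 gd].
transitivity (if (g %| G)%N then (if (d %| l * (G %/ g))%N && (d %| m * g)%N then RtoC 1 else 0) else 0).
  case: (boolP (g %| G)%N) => hg; last first.
    by rewrite big1 // => u _; case: eqP => // E; move: hg; rewrite -E dvdn_mulr.
  rewrite (eq_bigr (fun u => if (u == G %/ g)%N then (if (d %| l * u)%N && (d %| m * g)%N then RtoC 1 else 0) else 0)); last first.
    by move=> u _; rewrite eqn_div // mulnC.
  rewrite csum_pick divn_gt0 // dvdn_leq // ltnS (leq_trans (leq_div _ _)) //.
rewrite {1}/G dvdn_gcd; case: (boolP (g %| d)%N) => hgd //=.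
case: (boolP (g %| n)%N) => hgn /=; last by rewrite andbF.
have hgG : (g %| G)%N by rewrite dvdn_gcd hgd.
rewrite gcd_level_dvd // dvdn_divLR //.
by case: (g %| l)%N; case: (d %| m * g)%N; case: (d * g %| l * n)%N.
Qed.

(** * Two-variable sums over a hyperbola modulo [K] *)

(** For [L] prime to [K] this is a classical Kloosterman sum. *)
Definition hyp (K L m n : nat) : C :=
  \csum_(0 <= y < K) \csum_(0 <= z < K) (if (y * z == L %[mod K])%N then om K (m * y + n * z) else 0).

Lemma neg_inv_coprime K h R : (0 < K)%N -> (K %| R * h + 1)%N -> coprime K R.
Proof.
move=> hK hd; rewrite /coprime -dvdn1 -(@dvdn_addr (R * h)).
  by apply: dvdn_trans hd; exact: dvdn_gcdl.
by apply: dvdn_mulr; exact: dvdn_gcdr.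
Qed.

(** The sum over [x] is a sum of additive characters: it forces [hyz = -l], that is
    [yz = R l], modulo [K]. *)
Lemma csum3_hyp K h R l m n : (0 < K)%N -> (K %| R * h + 1)%N ->
  csum3 K h l m n = RtoC (INR K) * hyp K (R * l) m n.
Proof.
move=> hK hR; have co := neg_inv_coprime hK hR.
rewrite /csum3 /hyp exchange_big csum_mull; apply: eq_bigr => y _.
rewrite exchange_big csum_mull; apply: eq_bigr => z _.
rewrite (eq_bigr (fun x => om K (x * (h * y * z + l)) * om K (m * y + n * z))); last first.
  by move=> x _; rewrite -om_add; congr om; lia.
rewrite -csum_mulr om_sum //.
have -> : (K %| h * y * z + l)%N = (y * z == R * l %[mod K])%N.
  rewrite -(Gauss_dvdr _ co) -(eqn_modDl (R * (h * y * z))) -mulnDr.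
  rewrite (_ : R * (h * y * z) + y * z = (R * h + 1) * (y * z))%N; last by lia.
  by rewrite -modnMml (eqP hR) mul0n mod0n eq_sym.
by case: ifP => _; ring.
Qed.

Lemma csum3_swap K h l m n : csum3 K h l m n = csum3 K h m l n.
Proof.
rewrite /csum3 exchange_big; apply: eq_bigr => y _; apply: eq_bigr => x _; apply: eq_bigr => z _.
by congr om; lia.
Qed.

Lemma csum_gcd_split K (F : nat -> C) : (0 < K)%N ->
  \csum_(0 <= y < K) F y =
  \csum_(g <- divisors K) \csum_(0 <= y < K %/ g) (if coprime y (K %/ g) then F (y * g)%N else 0).
Proof.
move=> hK.
transitivity (\csum_(0 <= y < K) \csum_(0 <= g < K.+1) (if (g == gcdn y K)%N then F y else 0)).
  apply: eq_big_nat => y /andP [_ hy]; rewrite csum_pick leq0n ltnS /=.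
  by rewrite dvdn_leq // dvdn_gcdr.
rewrite exchange_big (@csum_divisors K K.+1) //; apply: eq_bigr => g _ /=.
case: ifP => hg; last first.
  by rewrite big1 // => y _; case: eqP => // E; move: hg; rewrite E dvdn_gcdr.
have g0 : (0 < g)%N by case: g hg => //; rewrite dvd0n; lia.
have EK : K = (K %/ g * g)%N by rewrite divnK.
transitivity (\csum_(0 <= j < K %/ g * g) (if (g %| j)%N then (if coprime (j %/ g) (K %/ g) then F j else 0) else 0)).
  rewrite -EK; apply: eq_big_nat => y hy; case: (boolP (g %| y)%N) => hgy.
    have -> : gcdn y K = (gcdn (y %/ g) (K %/ g) * g)%N by rewrite muln_gcdl !divnK.
    have hb (k : nat) : (g == k * g)%N = (k == 1%N) by rewrite -{1}(mul1n g) eqn_pmul2r.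
    by rewrite hb /coprime.
  by case: eqP => // E; move: hgy; rewrite E dvdn_gcdl.
by rewrite csum_multiples //; apply: eq_bigr => y _; rewrite mulnK.
Qed.

Lemma inv_modP y q : (0 < q)%N -> coprime y q ->
  (inv_mod y q < q)%N /\ (y * inv_mod y q = 1 %[mod q])%N.
Proof.
move=> hq hc; set P := fun x => (y * x == 1 %[mod q])%N.
have hasP : has P (seq.iota 0 q).
  have [x hx] : exists x, P x.
    case: (posnP y) => [y0|y0].
      by exists 0%N; rewrite /P; move: hc; rewrite y0 /coprime gcd0n => /eqP ->; rewrite !modn1.
    have /(coprimeP _ y0) [u hu] := hc.
    exists u.1; rewrite /P mulnC.
    have -> : (u.1 * y = u.2 * q + 1)%N by lia.
    by rewrite modnMDl.
  apply/hasP; exists (x %% q)%N; first by rewrite mem_iota ltn_mod.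
  by rewrite /P modnMmr.
have hf := hasP; rewrite has_find size_iota in hf.
split=> //; have := nth_find 0%N hasP; rewrite nth_iota // add0n => /eqP; exact.
Qed.

Lemma inv_uniq y q i b : (y * i = 1 %[mod q])%N -> (y * b == 1 %[mod q])%N = (b == i %[mod q])%N.
Proof.
move=> hi; apply/eqP/eqP => h; last by rewrite -modnMmr h modnMmr.
by rewrite -(muln1 b) -modnMmr -hi modnMmr mulnA (mulnC b) -modnMml h modnMml mul1n.
Qed.

Lemma csum_inv y q (F : nat -> C) : (0 < q)%N ->
  \csum_(0 <= b < q) (if (y * b == 1 %[mod q])%N then F b else 0) =
  if coprime y q then F (inv_mod y q) else 0.
Proof.
move=> hq; case: ifP => hc.
  have [h1 h2] := inv_modP hq hc.
  rewrite (eq_bigr (fun b => if (b == inv_mod y q %[mod q])%N then F b else 0)); last first.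
    by move=> b _; rewrite (inv_uniq b h2).
  by rewrite csum_residue // modn_small.
rewrite big1 // => b _; case: eqP => // h; move: hc.
have -> // : coprime y q.
case: (ltnP 1 q) => h1; last by have -> : q = 1%N; [lia | rewrite /coprime gcdn1].
rewrite (modn_small h1) in h.
have E : (y * b %/ q * q + 1 = y * b)%N by rewrite -[in LHS]h -divn_eq.
rewrite /coprime -dvdn1 -(@dvdn_addr (y * b %/ q * q)); last by apply: dvdn_mull; exact: dvdn_gcdr.
by rewrite E; apply: dvdn_mulr; exact: dvdn_gcdl.
Qed.

Lemma csum_blocks g q c (F : nat -> C) : (0 < q)%N ->
  \csum_(0 <= z < g * q) (if (z == c %[mod q])%N then F z else 0) =
  \csum_(0 <= t < g) F (c %% q + t * q)%N.
Proof.
move=> hq; elim: g => [|g IH]; first by rewrite mul0n !big_geq.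
rewrite mulSn (@big_cat_nat _ _ _ (g * q)) //=; last by rewrite leq_addl.
rewrite IH csum_recr; congr Cplus; rewrite big_nat_shift.
rewrite -(csum_residue c (fun z => F (z + g * q)%N) hq); apply: eq_bigr => z _.
by rewrite addnC modnMDl.
Qed.

(** With [g = gcd(y, K)] the equation [yz = R l] forces [g | l] and determines [z]
    modulo [K/g]; the sum over the [g] lifts of [z] forces [g | n]. *)
Lemma hyp_gcd K R l m n : (0 < K)%N -> coprime K R ->
  hyp K (R * l) m n = \csum_(g <- divisors K)
    (if (g %| l)%N && (g %| n)%N then RtoC (INR g) * hyp (K %/ g) 1 m (R * (l %/ g) * (n %/ g)) else 0).
Proof.
move=> hK co; rewrite {1}/hyp csum_gcd_split // big_seq [RHS]big_seq; apply: eq_bigr => g.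
rewrite -dvdn_divisors // => hg.
have g0 : (0 < g)%N by case: g hg => //; rewrite dvd0n; lia.
set q := (K %/ g)%N; have EK : K = (q * g)%N by rewrite divnK.
have q0 : (0 < q)%N by move: hK; rewrite EK muln_gt0 => /andP [].
have cog : coprime g R by apply: coprime_dvdl co.
case: (boolP (g %| l)%N) => hl /=; last first.
  rewrite big1 // => y _; case: ifP => // _; rewrite big1 // => z _.
  case: eqP => // E; move: hl; rewrite -(Gauss_dvdr _ cog) /dvdn -(modn_dvdm _ hg) -E (modn_dvdm _ hg).
  by rewrite mulnAC modnMl.
set l' := (l %/ g)%N; have El : l = (l' * g)%N by rewrite divnK.
have step y : coprime y q ->
   \csum_(0 <= z < K) (if (y * g * z == R * l %[mod K])%N then om K (m * (y * g) + n * z) else 0) =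
   if (g %| n)%N then RtoC (INR g) * om q (m * y + R * l' * (n %/ g) * inv_mod y q) else 0.
  move=> hc; have [h1 h2] := inv_modP q0 hc; set i := inv_mod y q in h1 h2 *.
  have cond z : (y * g * z == R * l %[mod K])%N = (z == i * (R * l') %[mod q])%N.
    rewrite EK El mulnA (mulnAC y) -!muln_modl eqn_pmul2r //.
    apply/eqP/eqP => E.
      by rewrite -modnMmr -E modnMmr mulnA (mulnC i) -modnMml h2 modnMml mul1n.
    by rewrite -modnMmr E modnMmr mulnA -modnMml h2 modnMml mul1n.
  rewrite (eq_bigr (fun z => om K (m * (y * g)) * (if (z == i * (R * l') %[mod q])%N then om K (n * z) else 0))); last first.
    by move=> z _; rewrite cond; case: ifP => _; rewrite ?om_add //; ring.
  have := csum_blocks g (i * (R * l')) (fun z => om K (n * z)) q0; rewrite (mulnC g) -EK => Eb.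
  rewrite -csum_mull Eb.
  set c := (i * (R * l') %% q)%N.
  rewrite (eq_bigr (fun t => om K (n * c) * om g (t * n))); last first.
    move=> t _; rewrite mulnDr om_add; congr Cmult.
    by rewrite EK (mulnC q) -(@om_scale g q) //; congr om; lia.
  rewrite -csum_mull om_sum //; case: ifP => hn; last by ring.
  set n' := (n %/ g)%N; have En : n = (n' * g)%N by rewrite divnK.
  have -> : om K (m * (y * g)) = om q (m * y) by rewrite EK mulnA om_scale.
  have -> : om K (n * c) = om q (R * l' * n' * i).
    rewrite EK En mulnAC om_scale //; apply: om_eqmod => //.
    by rewrite modnMmr; congr modn; lia.
  by rewrite om_add; ring.
case: (boolP (g %| n)%N) => hn; last first.
  rewrite big1 // => y _; case: ifP => // hc; by rewrite step // (negbTE hn).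
rewrite /hyp csum_mull; apply: eq_bigr => y _.
rewrite (csum_inv y (fun b => om q (m * y + R * l' * (n %/ g) * b))) //.
by case: ifP => hc; [rewrite step // hn | ring].
Qed.

(** Selberg's identity. Exchanging the frequencies [1] and [m] in [csum3] leaves the sum
    unchanged. Only [g = 1] occurs in [hyp_gcd] when the first frequency is [1], while
    after the exchange all common divisors of [m] and [n] occur. *)
Lemma hyp_selberg q R m n : (0 < q)%N -> coprime q R ->
  hyp q 1 m (R * n) = \csum_(f <- divisors q)
    (if (f %| m)%N && (f %| n)%N then RtoC (INR f) * hyp (q %/ f) 1 1 (R * (m %/ f) * (n %/ f)) else 0).
Proof.
move=> hq co.
have [h hh] : exists h, (q %| R * h + 1)%N.
  have [_ hi] : (inv_mod R q < q)%N /\ (R * inv_mod R q = 1 %[mod q])%N by apply: inv_modP => //; rewrite coprime_sym.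
  exists (q.-1 * inv_mod R q)%N.
  rewrite mulnCA /dvdn -modnDml -modnMmr hi modnMmr modnDml muln1 addn1 prednK //.
  by rewrite modnn.
have E2 : hyp q (R * 1) m n = hyp q 1 m (R * n).
  rewrite hyp_gcd // (bigD1_seq 1%N) ?divisor1 ?divisors_uniq //= big1_seq; last first.
    move=> g /andP [hg1 _]; case: ifP => // /andP [h1 _]; move: hg1; rewrite -dvdn1 h1 //.
  by rewrite !divn1 dvd1n /= muln1 Cplus_0_r; ring.
have E := csum3_swap q h 1 m n; rewrite !(csum3_hyp _ _ _ hq hh) in E.
by rewrite -E2 (Cmult_reg_l (RtoC_INR_neq0 hq) E) hyp_gcd.
Qed.

Lemma level_quot d g l n : (0 < g)%N -> (g %| d)%N -> (g %| l)%N -> (g %| n)%N ->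
  (d %/ g %| l %/ g * (n %/ g))%N = (d * g %| l * n)%N.
Proof.
move=> g0 hd hl hn; rewrite -(@dvdn_pmul2r (g * g)) ?muln_gt0 ?g0 //.
by rewrite mulnA divnK // mulnACA !divnK.
Qed.

(** [hyp_gcd] followed by [hyp_selberg], with [d = gf]. The divisibility of
    [(l/g)(n/g)] by [f = d/g] is rewritten as [dg | ln]. *)
Lemma hyp_levels K R l m n : (0 < K)%N -> coprime K R ->
  hyp K (R * l) m n = \csum_(d <- divisors K)
    (RtoC (INR d) * hyp (K %/ d) 1 1 (R * (l * m * n %/ (d * d))) *
     \csum_(g <- divisors d)
       (if [&& g %| l, g %| n, d %/ g %| m & d * g %| l * n]%N then RtoC 1 else 0)).
Proof.
move=> hK co; rewrite hyp_gcd //.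
pose X d := RtoC (INR d) * hyp (K %/ d) 1 1 (R * (l * m * n %/ (d * d))).
pose F g f := if [&& g %| l, g %| n, f %| m & f %| l %/ g * (n %/ g)]%N then X (g * f)%N else 0.
transitivity (\csum_(g <- divisors K) \csum_(f <- divisors (K %/ g)) F g f).
  rewrite big_seq [RHS]big_seq; apply: eq_bigr => g; rewrite -dvdn_divisors // => hg.
  have g0 : (0 < g)%N by case: g hg => //; rewrite dvd0n; lia.
  have q0 : (0 < K %/ g)%N by rewrite divn_gt0 //; exact: dvdn_leq.
  have coq : coprime (K %/ g) R by apply: coprime_dvdl co; rewrite dvdn_div.
  rewrite /F; case: (boolP (g %| l)%N) => hl; last by rewrite big1.
  case: (boolP (g %| n)%N) => hn; last by rewrite big1.
  rewrite -mulnA hyp_selberg // csum_mull big_seq [RHS]big_seq; apply: eq_bigr => f.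
  rewrite -dvdn_divisors // => hf.
  have f0 : (0 < f)%N by case: f hf => //; rewrite dvd0n; lia.
  rewrite andTb andTb; case: ifP => [/andP [hfm hfn]|_]; last by ring.
  rewrite /X -multE mult_INR RtoC_mult multE -divnMA Cmult_assoc; congr (_ * hyp _ _ _ _).
  rewrite -mulnA; congr muln.
  have -> : (l * m * n = (m %/ f) * (l %/ g * (n %/ g) %/ f) * (g * f * (g * f)))%N.
    have e1 := divnK hl; have e2 := divnK hn; have e3 := divnK hfm; have e4 := divnK hfn.
    rewrite -{1}e1 -{1}e2 -{1}e3.
    transitivity ((l %/ g * (n %/ g)) * (m %/ f) * (g * g * f))%N; first by lia.
    by rewrite -{1}e4; lia.
  by rewrite mulnK // !muln_gt0 g0 f0.
rewrite csum_divisors_pair // big_seq [RHS]big_seq; apply: eq_bigr => d; rewrite -dvdn_divisors // => hd.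
have d0 : (0 < d)%N by case: d hd => //; rewrite dvd0n; lia.
rewrite -/(X d) csum_mull big_seq [RHS]big_seq; apply: eq_bigr => g; rewrite -dvdn_divisors // => hg.
have g0 : (0 < g)%N by case: g hg => //; rewrite dvd0n; lia.
rewrite /F; case: (boolP (g %| l)%N) => hl /=; last by ring.
case: (boolP (g %| n)%N) => hn /=; last by ring.
rewrite level_quot // (mulnC g) divnK //; case: ifP => _; ring.
Qed.

(** The first variable is the inverse of the second. For [q = 1] the ranges [0 <= a < q]
    and [1 <= a <= q] consist of different representatives of the same residue. *)
Lemma kloosterman_form q X : (0 < q)%N -> hyp q 1 1 X =
  \csum_(1 <= a < q.+1 | coprime a q) (om q (inv_mod a q) * om q (X * a)).
Proof.
move=> hq.
transitivity (\csum_(0 <= a < q) (if coprime a q then om q (inv_mod a q) * om q (X * a) else 0)).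
  rewrite /hyp exchange_big; apply: eq_bigr => a _ /=.
  rewrite (eq_bigr (fun y => if (a * y == 1 %[mod q])%N then om q y * om q (X * a) else 0)); last first.
    by move=> y _; rewrite mulnC mul1n om_add.
  by rewrite (csum_inv a (fun y => om q y * om q (X * a))).
rewrite [RHS]big_mkcond /=.
case: (ltnP 1 q) => h1; last first.
  have -> : q = 1%N by lia.
  by rewrite !big_nat1 -[coprime 0 1]/true -[coprime 1 1]/true muln1 muln0 -[inv_mod 0 1]/0%N -[inv_mod 1 1]/0%N -(@om_mod 1 X) // modn1.
rewrite big_ltn // [RHS]big_nat_recr //=.
rewrite /coprime gcd0n gcdnn (_ : (q == 1)%N = false); last by lia.
by rewrite Cplus_0_l Cplus_0_r.
Qed.

(** * The Dirichlet coefficients of the functional equation *)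

Lemma tcoef_widen3 G n Mx My Mz : (0 < n)%N -> (n <= Mx)%N -> (n <= My)%N -> (n <= Mz)%N ->
  tcoef G n = \csum_(1 <= x < Mx.+1) \csum_(1 <= y < My.+1) \csum_(1 <= z < Mz.+1)
    (if (x * y * z == n)%N then G x y z else 0).
Proof.
move=> n0 hx hy hz; pose M := (Mx + My + Mz)%N.
rewrite (@tcoef_widen _ n M); last by rewrite n0 /M; lia.
have lx x y z : (n < x)%N -> (0 < y)%N -> (0 < z)%N -> (x * y * z == n)%N = false.
  move=> h1 h2 h3; apply/negbTE; rewrite neq_ltn; apply/orP; right.
  by apply: leq_trans h1 _; rewrite -mulnA leq_pmulr // muln_gt0 h2.
have ly x y z : (n < y)%N -> (0 < x)%N -> (0 < z)%N -> (x * y * z == n)%N = false.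
  by move=> h1 h2 h3; rewrite (mulnC x); exact: lx.
have lz x y z : (n < z)%N -> (0 < x)%N -> (0 < y)%N -> (x * y * z == n)%N = false.
  by move=> h1 h2 h3; rewrite mulnC mulnA; exact: lx.
symmetry; transitivity (\csum_(1 <= x < M.+1) \csum_(1 <= y < My.+1) \csum_(1 <= z < Mz.+1)
    (if (x * y * z == n)%N then G x y z else 0)).
  apply: csum_widen0; first by rewrite /M; lia.
  move=> x h; rewrite big_nat big1 // => y /andP [h1 _]; rewrite big_nat big1 // => z /andP [h2 _].
  by rewrite lx //; lia.
apply: eq_big_nat => x /andP [h1 _].
transitivity (\csum_(1 <= y < M.+1) \csum_(1 <= z < Mz.+1)
    (if (x * y * z == n)%N then G x y z else 0)).
  apply: csum_widen0; first by rewrite /M; lia.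
  by move=> y h; rewrite big_nat big1 // => z /andP [h2 _]; rewrite ly //; lia.
apply: eq_big_nat => y /andP [h2 _].
apply: csum_widen0; first by rewrite /M; lia.
by move=> z h; rewrite lz //; lia.
Qed.

Lemma csum_multiples1 N m (F : nat -> C) : (0 < N)%N ->
  \csum_(1 <= j < (m * N).+1) (if (N %| j)%N then F j else 0) = \csum_(1 <= k < m.+1) F (k * N)%N.
Proof.
move=> hN; have h := csum_multiples m.+1 F hN.
have hh : \csum_(0 <= j < m.+1 * N) (if (N %| j)%N then F j else 0) =
    \csum_(0 <= j < (m * N).+1) (if (N %| j)%N then F j else 0).
  rewrite (@big_cat_nat _ _ _ (m * N).+1) //=; last by rewrite mulSn; lia.
  rewrite [X in _ + X]big_nat [X in _ + X]big1 ?Cplus_0_r // => j hj.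
  by case: ifP => // /dvdnP [k hk]; move: hj; rewrite hk !ltn_pmul2r // => /andP [h1 h2]; lia.
move: h; rewrite hh big_ltn // [in X in _ = X -> _]big_ltn // dvdn0 mul0n => E.
have := f_equal (fun z => - F 0%N + z) E; rewrite !Cplus_assoc (Cplus_comm (- _)) Cplus_opp_r !Cplus_0_l; exact.
Qed.

Lemma tcoef_multiples A B D (G : nat -> nat -> nat -> C) N : (0 < A)%N -> (0 < B)%N -> (0 < D)%N -> (0 < N)%N ->
  tcoef (fun l m n => if [&& A %| l, B %| m & D %| n]%N then G l m n else 0) N =
  if (A * B * D %| N)%N then tcoef (fun l m n => G (l * A) (m * B) (n * D))%N (N %/ (A * B * D)) else 0.
Proof.
move=> hA hB hD hN.
have P0 : (0 < A * B * D)%N by rewrite !muln_gt0 hA hB.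
rewrite (@tcoef_widen3 _ N (N * A) (N * B) (N * D)) ?leq_pmulr //.
transitivity (\csum_(1 <= x < N.+1) \csum_(1 <= y < N.+1) \csum_(1 <= z < N.+1)
    (if (x * A * (y * B) * (z * D) == N)%N then G (x * A) (y * B) (z * D) else RtoC 0)%N).
  rewrite -(csum_multiples1 N (fun x => \csum_(1 <= y < N.+1) \csum_(1 <= z < N.+1)
    (if (x * (y * B) * (z * D) == N)%N then G x (y * B) (z * D) else RtoC 0)%N)) //.
  apply: eq_bigr => x _.
  rewrite -(csum_multiples1 N (fun y => \csum_(1 <= z < N.+1)
    (if (x * y * (z * D) == N)%N then G x y (z * D) else RtoC 0)%N)) // -csum_if; apply: eq_bigr => y _.
  rewrite -(csum_multiples1 N (fun z => if (x * y * z == N)%N then G x y z else 0)) // -!csum_if; apply: eq_bigr => z _.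
  by case: (A %| x)%N; case: (B %| y)%N; case: (D %| z)%N; case: (x * y * z == N)%N.
have E x y z : (x * A * (y * B) * (z * D) = x * y * z * (A * B * D))%N by lia.
case: (boolP (A * B * D %| N)%N) => hd; last first.
  rewrite big1 // => x _; rewrite big1 // => y _; rewrite big1 // => z _; rewrite E.
  by case: eqP => // h; move: hd; rewrite -h dvdn_mull.
rewrite (@tcoef_widen _ _ N); last by rewrite divn_gt0 // dvdn_leq // leq_div.
apply: eq_bigr => x _; apply: eq_bigr => y _; apply: eq_bigr => z _.
by rewrite E eqn_div.
Qed.

Lemma tcoef_exchange F n N :
  tcoef (fun l m k => tcoef (F l m k) n) N = tcoef (fun u v w => tcoef (fun l m k => F l m k u v w) N) n.
Proof.
symmetry; transitivity (\csum_(1 <= u < n.+1) \csum_(1 <= v < n.+1) \csum_(1 <= w < n.+1 | (u * v * w == n)%N)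
  tcoef (fun l m k => F l m k u v w) N); first by [].
rewrite [RHS](_ : _ = tcoef (fun l m k => \csum_(1 <= u < n.+1) \csum_(1 <= v < n.+1)
  \csum_(1 <= w < n.+1 | (u * v * w == n)%N) F l m k u v w) N) //.
rewrite -tcoef_csum; apply: eq_bigr => u _.
rewrite -tcoef_csum; apply: eq_bigr => v _.
by rewrite -tcoef_csum.
Qed.

(** The four steps are [hyp_levels], [mu_count], the exchange of the factorizations
    [lmn = N] and [uvw = d/h], and the substitution of [hvw l], [huw m], [huv n] for
    [l], [m], [n], which multiplies [lmn] by [d^2 h] and splits the powers of [h, u, v, w]
    off. *)
Lemma coef_identity K R a b c N : (0 < K)%N -> coprime K R -> (0 < N)%N ->
  tcoef (fun l m n => pw3 a b c l m n * hyp K (R * l) m n) N =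
  \csum_(d <- divisors K) (RtoC (INR d) * \csum_(h <- divisors d)
    (muC h * (if (d * d * h %| N)%N then
        ncpow h (- (a + b + c)) * tcoef (pw3 (b + c) (a + c) (a + b)) (d %/ h) *
        tcoef (pw3 a b c) (N %/ (d * d * h)) *
        hyp (K %/ d) 1 1 (R * (h * (N %/ (d * d * h))))
      else 0))).
Proof.
move=> hK co hN.
transitivity (tcoef (fun l m n => \csum_(d <- divisors K) (RtoC (INR d) * \csum_(h <- divisors d)
   (muC h * (hyp (K %/ d) 1 1 (R * (N %/ (d * d))) * tcoef (fun u v w => if [&& h * v * w %| l, h * u * w %| m & h * u * v %| n]%N then pw3 a b c l m n else 0) (d %/ h))))) N).
  apply: tcoef_ext => l m n l0 m0 n0 Nn; rewrite hyp_levels // csum_mull big_seq [RHS]big_seq.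
  apply: eq_bigr => d; rewrite -dvdn_divisors // => hd.
  have d0 : (0 < d)%N by case: d hd => //; rewrite dvd0n; lia.
  rewrite -mu_count // Nn [X in _ = _ * X](eq_bigr (fun h => pw3 a b c l m n * hyp (K %/ d) 1 1 (R * (N %/ (d * d))) * (muC h * tcoef (fun u v w =>
      if [&& h * v * w %| l, h * u * w %| m & h * u * v %| n]%N then RtoC 1 else 0) (d %/ h)))).
    by rewrite -csum_mull; ring.
  move=> h _.
  have -> : tcoef (fun u v w => if [&& h * v * w %| l, h * u * w %| m & h * u * v %| n]%N then pw3 a b c l m n else 0) (d %/ h) =
    pw3 a b c l m n * tcoef (fun u v w => if [&& h * v * w %| l, h * u * w %| m & h * u * v %| n]%N then RtoC 1 else 0) (d %/ h).
    by rewrite tcoef_scal; apply: tcoef_ext => u v w _ _ _ _; case: ifP => _; ring.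
  by ring.
rewrite -tcoef_csum big_seq [RHS]big_seq; apply: eq_bigr => d; rewrite -dvdn_divisors // => hd.
have d0 : (0 < d)%N by case: d hd => //; rewrite dvd0n; lia.
rewrite -tcoef_scal -tcoef_csum; congr Cmult; rewrite big_seq [RHS]big_seq; apply: eq_bigr => h; rewrite -dvdn_divisors // => hh.
have h0 : (0 < h)%N by case: h hh => //; rewrite dvd0n; lia.
rewrite -tcoef_scal -tcoef_scal; congr Cmult.
have -> : tcoef (fun l m n => tcoef (fun u v w => if [&& h * v * w %| l, h * u * w %| m & h * u * v %| n]%N then pw3 a b c l m n else 0) (d %/ h)) N =
  tcoef (fun u v w => tcoef (fun l m n => if [&& h * v * w %| l, h * u * w %| m & h * u * v %| n]%N then pw3 a b c l m n else 0) N) (d %/ h).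
  by rewrite tcoef_exchange.
have -> : tcoef (fun u v w => tcoef (fun l m n => if [&& h * v * w %| l, h * u * w %| m & h * u * v %| n]%N then pw3 a b c l m n else 0) N) (d %/ h) =
  tcoef (fun u v w => if (d * d * h %| N)%N then ncpow h (- (a + b + c)) * pw3 (b + c) (a + c) (a + b) u v w * tcoef (pw3 a b c) (N %/ (d * d * h)) else 0) (d %/ h).
  apply: tcoef_ext => u v w u0 v0 w0 E.
  rewrite tcoef_multiples ?muln_gt0 ?h0 ?u0 ?v0 ?w0 //.
  have -> : (h * v * w * (h * u * w) * (h * u * v) = d * d * h)%N.
    have Ed : (d = u * v * w * h)%N by rewrite E divnK.
    by rewrite {1 2}Ed; lia.
  case: ifP => // _; rewrite tcoef_scal; apply: tcoef_ext => l m n l0 m0 n0 _.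
  rewrite /pw3 !ncpow_mul ?muln_gt0 ?h0 ?u0 ?v0 ?w0 //.
  have Eadd t x y : ncpow t (- (x + y)) = ncpow t (- x) * ncpow t (- y).
    by rewrite -ncpow_add; congr ncpow; ring.
  by rewrite !Eadd; ring.
case: (boolP (d * d * h %| N)%N) => hdN; last first.
  rewrite /tcoef big1 ?Cmult_0_r // => u _; rewrite big1 // => v _; by rewrite big1.
have -> : (N %/ (d * d) = h * (N %/ (d * d * h)))%N.
  by rewrite -{1}(divnK hdN) (mulnC (d * d)%N h) mulnA mulnK ?muln_gt0 ?d0 // mulnC.
rewrite (_ : tcoef (fun u v w => _) (d %/ h) = ncpow h (- (a + b + c)) * tcoef (pw3 a b c) (N %/ (d * d * h)) * tcoef (pw3 (b + c) (a + c) (a + b)) (d %/ h)).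
  by ring.
by rewrite tcoef_scal; apply: tcoef_ext => *; ring.
Qed.

(** * Residues of integers *)

(** Congruence with an explicit quotient, which makes products of congruences a matter of
    [ring]. *)
Definition zcong (K : nat) (x y : Z) := exists u, x = (y + u * Z.of_nat K)%Z.

Lemma zcong_refl K x : zcong K x x.
Proof. by exists 0%Z; lia. Qed.

Lemma zcong_mul K x y x' y' : zcong K x x' -> zcong K y y' -> zcong K (x * y) (x' * y').
Proof.
move=> [u ->] [v ->]; exists (x' * v + y' * u + u * v * Z.of_nat K)%Z; ring.
Qed.

Lemma zcong_modn K m n : zcong K (Z.of_nat m) (Z.of_nat n) -> (m = n %[mod K])%N.
Proof.
move=> [u hu]; case: (Z_le_gt_dec 0 u) => h.
  have -> : m = (Z.to_nat u * K + n)%N.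
    by apply: Nat2Z.inj; rewrite -multE -plusE Nat2Z.inj_add Nat2Z.inj_mul Z2Nat.id // hu; ring.
  by rewrite modnMDl.
have -> : n = (Z.to_nat (- u) * K + m)%N.
  by apply: Nat2Z.inj; rewrite -multE -plusE Nat2Z.inj_add Nat2Z.inj_mul Z2Nat.id ?hu; [ring | lia].
by rewrite modnMDl.
Qed.

Definition zres (P : Z) (K : nat) : nat := Z.to_nat (P mod Z.of_nat K).

Lemma zres_cong P K : (0 < K)%N -> zcong K (Z.of_nat (zres P K)) P.
Proof.
move=> hK; have hz : (0 < Z.of_nat K)%Z by lia.
have h := Z.mod_pos_bound P _ hz; exists (- (P / Z.of_nat K))%Z.
by rewrite /zres Z2Nat.id; [have := Z_div_mod_eq_full P (Z.of_nat K); lia | lia].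
Qed.

Lemma zcong_dvd K q x y : (q %| K)%N -> zcong K x y -> zcong q x y.
Proof.
move=> /dvdnP [t ->] [u ->]; exists (u * Z.of_nat t)%Z.
by rewrite -multE Nat2Z.inj_mul; ring.
Qed.

(** The residue of a sign [1] or [-1]. *)
Definition sign_res (K : nat) (x : Z) : nat := if Z.eqb x 1 then 1%N else K.-1.

Lemma sign_res_cong K x : (0 < K)%N -> x = 1%Z \/ x = (-1)%Z -> zcong K (Z.of_nat (sign_res K x)) x.
Proof.
move=> hK [->|->]; first exact: zcong_refl.
by exists 1%Z; rewrite /sign_res -[Z.eqb _ _]/false; lia.
Qed.

Lemma sign_res_sq K x : (0 < K)%N -> (sign_res K x * sign_res K x = 1 %[mod K])%N.
Proof.
move=> hK; apply: zcong_modn; rewrite -multE Nat2Z.inj_mul.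
have [y hy hx] : exists2 y, (y = 1 \/ y = -1)%Z & sign_res K x = sign_res K y.
  by rewrite /sign_res; case: Z.eqb; [exists 1%Z; auto | exists (-1)%Z; auto].
rewrite hx (_ : Z.of_nat 1 = (y * y)%Z); last by case: hy => ->.
by apply: zcong_mul; exact: sign_res_cong.
Qed.

Lemma sign_res_opp K x n : (0 < K)%N -> x = 1%Z \/ x = (-1)%Z -> (K.-1 * (sign_res K (- x) * n) = sign_res K x * n %[mod K])%N.
Proof.
move=> hK hx; apply: zcong_modn; rewrite -!multE !Nat2Z.inj_mul.
have h1 : zcong K (Z.of_nat K.-1) (-1) by exists 1%Z; lia.
have h2 := @sign_res_cong K x hK hx.
have h3 : zcong K (Z.of_nat (sign_res K (- x))) (- x) by apply: sign_res_cong => //; lia.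
have [u hu] := zcong_mul h1 (zcong_mul h3 (zcong_refl K (Z.of_nat n))).
have [v hv] := zcong_mul h2 (zcong_refl K (Z.of_nat n)).
by exists (u - v)%Z; rewrite hu hv; ring.
Qed.

Lemma e_IZR z : e (IZR z) = 1.
Proof.
case: (Z_le_gt_dec 0 z) => h.
  by rewrite -(Z2Nat.id z h) -INR_IZR_INZ e_INR.
rewrite -(Ropp_involutive (IZR z)) e_opp -opp_IZR -(Z2Nat.id (- z)); last by lia.
by rewrite -INR_IZR_INZ e_INR; field; exact: RtoC_inj_neq.
Qed.

Lemma e_frac P K n : (0 < K)%N -> e (INR n * Q2R (frac P K)) = om K (zres P K * n).
Proof.
move=> hK; have K0 := INR_gt0 hK.
have -> : Q2R (frac P K) = (IZR P / INR K)%R.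
  rewrite /frac Qreals.Q2R_div; last by rewrite /QArith_base.Qeq /=; lia.
  by rewrite /Q2R /= !Rinv_1 !Rmult_1_r -INR_IZR_INZ.
have [u hu] := zres_cong P hK.
rewrite /om (_ : (INR n * (IZR P / INR K))%R = (INR (zres P K * n) / INR K + IZR (- u * Z.of_nat n))%R); last first.
  rewrite -multE mult_INR !INR_IZR_INZ hu mult_IZR opp_IZR plus_IZR mult_IZR -!INR_IZR_INZ; field; lra.
by rewrite e_add e_IZR Cmult_1_r.
Qed.
(** * The continuation as a combination of periodic zeta functions *)

Definition fourier_comb (K h : nat) (A : nat -> C -> C) (a b c s : C) : C :=
  / (RtoC (INR K) * RtoC (INR K) * RtoC (INR K)) *
  (\csum_(0 <= j1 < K) \csum_(0 <= j2 < K) \csum_(0 <= j3 < K)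
    (csum3 K h (K.-1 * j1) (K.-1 * j2) (K.-1 * j3) *
     (A j1 (s + a) * A j2 (s + b) * A j3 (s + c)))).

Lemma perz_family K : (0 < K)%N -> exists A : nat -> C -> C, forall j, is_perz K j (A j).
Proof. move=> hK; exact: (choice_fun (fun j => perz_ex j hK)). Qed.

Lemma fourier_comb_wm K h A a b c s0 : (forall j s, wm (A j) s) -> wm (fourier_comb K h A a b c) s0.
Proof.
move=> hA; apply: wm_mul; first exact: wm_const.
apply: wm_csum => j1; apply: wm_csum => j2; apply: wm_csum => j3.
apply: wm_mul; first exact: wm_const.
by apply: wm_mul; [apply: wm_mul|]; apply: affine_add; exact: hA.
Qed.

Lemma ana_csum I (r : seq I) (F : I -> C -> C) z0 : (forall i, ana (F i) z0) ->
  ana (fun z => \big[Cplus/RtoC 0]_(i <- r) F i z) z0.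
Proof.
move=> hF; elim: r => [|i r IH].
  by apply: ana_ext (ana_const 0 z0); exists 1%R; split; [lra | move=> z _; rewrite big_nil].
apply: ana_ext (ana_add (hF i) IH).
by exists 1%R; split; [lra | move=> z _; rewrite big_cons].
Qed.

Lemma fourier_comb_ana K h A a b c s0 : (forall j, is_perz K j (A j)) ->
  (1 < Re (s0 + a))%R -> (1 < Re (s0 + b))%R -> (1 < Re (s0 + c))%R -> ana (fourier_comb K h A a b c) s0.
Proof.
move=> hA ha hb hc.
have key j x : (1 < Re (s0 + x))%R -> ana (fun s => A j (s + x)) s0.
  move=> hx; have h1 : Cmod 1 = 1%R by rewrite Cmod_1.
  have : ana (fun s => A j (1 * s + x)) s0.
    apply: ana_comp => //; rewrite Cmult_1_l.
    apply: (ana_ext (f := dser (echar K j))); last exact: (dser_ana hx (echar_le1 K j)).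
    apply: near_pt_imp (near_re_gt hx) => s hs; symmetry; exact: (proj2 (proj2 (hA j))).
  by apply: ana_ext; exists 1%R; split; [lra | move=> z _; rewrite Cmult_1_l].
apply: ana_mul; first exact: ana_const.
apply: ana_csum => j1; apply: ana_csum => j2; apply: ana_csum => j3.
apply: ana_mul; first exact: ana_const.
by apply: ana_mul; [apply: ana_mul|]; exact: key.
Qed.

Lemma dterm_tcoef_csum K (w : nat -> nat -> nat -> C) (G : nat -> nat -> nat -> nat -> nat -> nat -> C) s n :
  \csum_(0 <= j1 < K) \csum_(0 <= j2 < K) \csum_(0 <= j3 < K)
    (w j1 j2 j3 * dterm (tcoef (G j1 j2 j3)) s n) =
  dterm (tcoef (fun x y z => \csum_(0 <= j1 < K) \csum_(0 <= j2 < K) \csum_(0 <= j3 < K)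
    (w j1 j2 j3 * G j1 j2 j3 x y z))) s n.
Proof.
rewrite /dterm -tcoef_csum csum_mulr; apply: eq_bigr => j1 _.
rewrite -tcoef_csum csum_mulr; apply: eq_bigr => j2 _.
rewrite -tcoef_csum csum_mulr; apply: eq_bigr => j3 _.
by rewrite -tcoef_scal Cmult_assoc.
Qed.

Lemma fourier_comb_series K h A a b c s : (0 < K)%N -> (forall j, is_perz K j (A j)) ->
  (1 < Re (s + a))%R -> (1 < Re (s + b))%R -> (1 < Re (s + c))%R ->
  Csum (dterm (fun n => om K (h * n) * tau a b c n) s) (fourier_comb K h A a b c s).
Proof.
move=> hK hA ha hb hc; have K0 := @RtoC_INR_neq0 K hK.
have E x j : (1 < Re x)%R -> A j x = dser (echar K j) x by move=> hx; exact: (proj2 (proj2 (hA j))).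
pose G j1 j2 j3 x y z := echar K j1 x * echar K j2 y * echar K j3 z * pw3 a b c x y z.
pose w j1 j2 j3 := csum3 K h (K.-1 * j1) (K.-1 * j2) (K.-1 * j3).
have H : Csum (fun n => / (RtoC (INR K) * RtoC (INR K) * RtoC (INR K)) *
   \csum_(0 <= j1 < K) \csum_(0 <= j2 < K) \csum_(0 <= j3 < K) (w j1 j2 j3 * dterm (tcoef (G j1 j2 j3)) s n))
   (fourier_comb K h A a b c s).
  apply: Csum_scal; apply: Csum_csum => j1 _; apply: Csum_csum => j2 _; apply: Csum_csum => j3 _.
  apply: Csum_scal; rewrite !E //; apply: dser_triple => // n; exact: echar_le1.
apply: Csum_ext H => n; rewrite dterm_tcoef_csum /dterm Cmult_assoc; congr Cmult.
rewrite tcoef_scal tauE tcoef_scal; apply: tcoef_ext => x y z _ _ _ Exyz.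
rewrite (_ : \csum_(0 <= j1 < K) \csum_(0 <= j2 < K) \csum_(0 <= j3 < K) (w j1 j2 j3 * G j1 j2 j3 x y z) =
  (\csum_(0 <= j1 < K) \csum_(0 <= j2 < K) \csum_(0 <= j3 < K)
    (csum3 K h (K.-1 * j1) (K.-1 * j2) (K.-1 * j3) * (om K (j1 * x) * om K (j2 * y) * om K (j3 * z)))) * pw3 a b c x y z).
  rewrite csum3_fourier // -Exyz !mulnA; field; exact: K0.
rewrite csum_mulr; apply: eq_bigr => j1 _; rewrite csum_mulr; apply: eq_bigr => j2 _.
rewrite csum_mulr; apply: eq_bigr => j3 _; rewrite /G /w !echarE; ring.
Qed.

Lemma half_plane3 (a b c : C) : exists sg : R, forall s, (sg < Re s)%R ->
  (1 < Re (s + a))%R /\ (1 < Re (s + b))%R /\ (1 < Re (s + c))%R.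
Proof.
exists (1 + Rabs (Re a) + Rabs (Re b) + Rabs (Re c))%R => s hs.
have h x : (- Rabs (Re x) <= Re x)%R by move: (Rle_abs (- Re x)); rewrite Rabs_Ropp; lra.
have p x : (0 <= Rabs (Re x))%R by exact: Rabs_pos.
have E x : Re (s + x) = (Re s + Re x)%R by case: (s); case: x.
rewrite !E; have := (h a, h b, h c, p a, p b, p c); case=> [[[[[]]]]] *; lra.
Qed.

Lemma estermann_dterm a b c s P K n : (0 < K)%N ->
  estermann_term a b c s (frac P K) n.+1 = dterm (fun n => om K (zres P K * n) * tau a b c n) s n.
Proof.
move=> hK; rewrite /estermann_term /dterm e_frac // ncpow_opp /Cdiv; ring.
Qed.

(** [Estermann] is chosen among all continuations of the series; [fourier_comb], with its
    removable singularities filled in, shows that there is one. Filling in changes nothing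
    in the half-plane where the three series converge, because [fourier_comb] is analytic
    there. *)
Lemma estermann_ex a b c P K : (0 < K)%N ->
  is_estermann a b c (frac P K) (fun s => Estermann a b c s (frac P K)).
Proof.
move=> hK; apply: (epsilon_spec (inhabits (fun _ : C => RtoC 0)) (is_estermann a b c (frac P K))).
have [A hA] := perz_family hK; exists (normalized (fourier_comb K (zres P K) A a b c)); split.
  by apply: normalized_meromorphic => z; apply: fourier_comb_wm => j; exact: (proj1 (hA j)).
have [sg hsg] := half_plane3 a b c; exists sg => s hs; have [ha [hb hc]] := hsg s hs.
rewrite normalized_eq; last exact: fourier_comb_ana.
apply/is_series_Csum; apply: Csum_ext (fourier_comb_series (zres P K) hK hA ha hb hc) => n.
by rewrite estermann_dterm.
Qed.

Lemma Estermann_wm a b c P K s0 : (0 < K)%N -> wm (fun s => Estermann a b c s (frac P K)) s0.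
Proof. by move=> hK; apply: meromorphic_wm; case: (estermann_ex a b c P hK). Qed.

Lemma Estermann_series a b c P K : (0 < K)%N -> exists sg : R, forall s, (sg < Re s)%R ->
  Csum (dterm (fun n => om K (zres P K * n) * tau a b c n) s) (Estermann a b c s (frac P K)).
Proof.
move=> hK; have [_ [sg h]] := estermann_ex a b c P hK; exists sg => s hs.
have /is_series_Csum H := h s hs; apply: Csum_ext H => n; by rewrite estermann_dterm.
Qed.

Lemma Estermann_fourier_comb K A a b c P : (0 < K)%N -> (forall j, is_perz K j (A j)) ->
  mero_eq (fun s => Estermann a b c s (frac P K)) (fourier_comb K (zres P K) A a b c).
Proof.
move=> hK hA; have [s1 h1] := Estermann_series a b c P hK; have [s2 h2] := half_plane3 a b c.
pose z := RtoC (1 + Rmax s1 s2).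
apply: (wm_eq_identity (z1 := z)).
- by move=> s; exact: Estermann_wm.
- by move=> s; apply: fourier_comb_wm => j; exact: (proj1 (hA j)).
apply: near_punct; have hz : (Rmax s1 s2 < Re z)%R by rewrite /z /=; lra.
apply: near_pt_imp (near_re_gt hz) => s hs.
have := Rmax_l s1 s2; have := Rmax_r s1 s2 => hr hl.
have [|ha [hb hc]] := h2 s; first by lra.
apply: Csum_uniq (h1 s _) (fourier_comb_series _ hK hA ha hb hc); lra.
Qed.
(** * Applying the functional equation to each factor *)

Lemma fe_side_signs K j s : (0 < K)%N -> fe_side K j s =
  calG s * ncpow K (1 - s) * \csum_(x <- signs)
    (RtoC (IZR x) * Cexp (RtoC PI / 2 * Ci * (RtoC (IZR x) * s)) * dser (cres K (sign_res K (- x) * j)) (1 - s)).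
Proof.
move=> hK; rewrite /fe_side; congr Cmult; rewrite /signs !big_cons big_nil Cplus_0_r.
have -> : dser (cres K (K - j %% K)) (1 - s) = dser (cres K (sign_res K (- (1)) * j)) (1 - s).
  apply: dser_ext => n; apply: cres_mod; rewrite /sign_res -[Z.eqb _ _]/false.

  apply: zcong_modn.
  have hlt : (j %% K < K)%N by rewrite ltn_mod.
  exists (1 - Z.of_nat j + Z.of_nat (j %/ K))%Z.
  have E : Z.of_nat j = (Z.of_nat (j %/ K) * Z.of_nat K + Z.of_nat (j %% K))%Z by rewrite -Nat2Z.inj_mul -Nat2Z.inj_add; congr Z.of_nat; exact: divn_eq.
  rewrite -multE -minusE Nat2Z.inj_mul Nat2Z.inj_sub; last by lia.
  rewrite (_ : Z.of_nat K.-1 = Z.of_nat K - 1)%Z; last by lia.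
  by rewrite E; ring.
have -> : dser (cres K (sign_res K (- (-1)) * j)) (1 - s) = dser (cres K j) (1 - s).
  by apply: dser_ext => n; rewrite /sign_res -[Z.eqb _ _]/true mul1n.
rewrite (_ : RtoC PI / 2 * Ci * (RtoC 1 * s) = RtoC PI / 2 * Ci * s); last by ring.
rewrite (_ : RtoC PI / 2 * Ci * (RtoC (-1) * s) = - (RtoC PI / 2 * Ci * s)); last first.
  by rewrite (_ : (-1)%R = (- (1))%R) // RtoC_opp; ring.
rewrite (_ : RtoC (-1) = - RtoC 1); first by ring.
by rewrite -RtoC_opp.
Qed.

(** What is left of [fourier_comb] at a choice of signs when the gamma factors have been
    pulled out. *)
Definition dual_sum (K h : nat) (e1 e2 e3 : Z) (a b c s : C) : C :=
  \csum_(0 <= j1 < K) \csum_(0 <= j2 < K) \csum_(0 <= j3 < K)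
    (csum3 K h (K.-1 * j1) (K.-1 * j2) (K.-1 * j3) *
     (dser (cres K (sign_res K (- e1) * j1)) (1 - (s + a)) *
      dser (cres K (sign_res K (- e2) * j2)) (1 - (s + b)) *
      dser (cres K (sign_res K (- e3) * j3)) (1 - (s + c)))).

Lemma csum_prod3 (I : Type) (r1 r2 r3 : seq I) (F G H : I -> C) :
  (\csum_(x <- r1) F x) * (\csum_(y <- r2) G y) * (\csum_(z <- r3) H z) =
  \csum_(x <- r1) \csum_(y <- r2) \csum_(z <- r3) (F x * G y * H z).
Proof.
rewrite !csum_mulr; apply: eq_bigr => x _; rewrite -Cmult_assoc csum_mulr csum_mull; apply: eq_bigr => y _.
by rewrite !csum_mull; apply: eq_bigr => z _; rewrite Cmult_assoc.
Qed.

Lemma csum_exchange3 (I J : Type) (r : seq I) (q1 q2 q3 : seq J) (F : I -> J -> J -> J -> C) :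
  \csum_(i <- r) \csum_(x <- q1) \csum_(y <- q2) \csum_(z <- q3) F i x y z =
  \csum_(x <- q1) \csum_(y <- q2) \csum_(z <- q3) \csum_(i <- r) F i x y z.
Proof.
rewrite exchange_big; apply: eq_bigr => x _; rewrite exchange_big; apply: eq_bigr => y _.
by rewrite exchange_big.
Qed.

Lemma fourier_comb_left K h A a b c s : (0 < K)%N -> (forall j, is_perz K j (A j)) ->
  (Re (s + a) < 0)%R -> (Re (s + b) < 0)%R -> (Re (s + c) < 0)%R ->
  fourier_comb K h A a b c s = / RtoC (INR K) * ncpow K (1 - 3 * s - a - b - c) * calG3 a b c s *
    (\csum_(e1 <- signs) \csum_(e2 <- signs) \csum_(e3 <- signs)
      (RtoC (IZR (e1 * e2 * e3)) *
       Cexp (RtoC PI / 2 * Ci * (RtoC (IZR e1) * (s + a) + RtoC (IZR e2) * (s + b) + RtoC (IZR e3) * (s + c))) *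
       dual_sum K h e1 e2 e3 a b c s)).
Proof.
move=> hK hA ha hb hc; have K0 := @RtoC_INR_neq0 K hK; rewrite /fourier_comb.
pose D e j x := dser (cres K (sign_res K (- e) * j)) (1 - x).
pose X e x := RtoC (IZR e) * Cexp (RtoC PI / 2 * Ci * (RtoC (IZR e) * x)).
pose Y e1 e2 e3 := X e1 (s + a) * X e2 (s + b) * X e3 (s + c).
pose w j1 j2 j3 := csum3 K h (K.-1 * j1) (K.-1 * j2) (K.-1 * j3).
have E x j : (Re x < 0)%R -> A j x = calG x * ncpow K (1 - x) * \csum_(e <- signs) (X e x * D e j x).
  by move=> hx; rewrite (proj1 (proj2 (hA j))) // fe_side_signs.
pose P := calG3 a b c s * (ncpow K (1 - (s + a)) * ncpow K (1 - (s + b)) * ncpow K (1 - (s + c))).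
transitivity (/ (RtoC (INR K) * RtoC (INR K) * RtoC (INR K)) * (P *
   \csum_(0 <= j1 < K) \csum_(0 <= j2 < K) \csum_(0 <= j3 < K)
   \csum_(e1 <- signs) \csum_(e2 <- signs) \csum_(e3 <- signs)
    (Y e1 e2 e3 * (w j1 j2 j3 * (D e1 j1 (s + a) * D e2 j2 (s + b) * D e3 j3 (s + c)))))).
  congr Cmult; rewrite csum_mull; apply: eq_bigr => j1 _; rewrite csum_mull; apply: eq_bigr => j2 _.
  rewrite csum_mull; apply: eq_bigr => j3 _.
  rewrite !E // -/(w j1 j2 j3).
  transitivity (w j1 j2 j3 * P * ((\csum_(e1 <- signs) (X e1 (s + a) * D e1 j1 (s + a))) *
     (\csum_(e2 <- signs) (X e2 (s + b) * D e2 j2 (s + b))) *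
     (\csum_(e3 <- signs) (X e3 (s + c) * D e3 j3 (s + c))))).
    by rewrite /P /calG3; ring.
  rewrite csum_prod3 (Cmult_comm (w _ _ _)) -Cmult_assoc; congr Cmult.
  rewrite csum_mull; apply: eq_bigr => e1 _; rewrite csum_mull; apply: eq_bigr => e2 _.
  by rewrite csum_mull; apply: eq_bigr => e3 _; rewrite /Y; ring.
rewrite Cmult_assoc.
have -> : / (RtoC (INR K) * RtoC (INR K) * RtoC (INR K)) * P = / RtoC (INR K) * ncpow K (1 - 3 * s - a - b - c) * calG3 a b c s.
  rewrite /P (_ : 1 - 3 * s - a - b - c = (- (1) + - (1)) + ((1 - (s + a)) + (1 - (s + b)) + (1 - (s + c)))); last by ring.
  move: (1 - (s + a)) (1 - (s + b)) (1 - (s + c)) => u v t.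
  by rewrite !ncpow_add ncpow_opp ncpow_1 //; field.
congr Cmult.
transitivity (\csum_(e1 <- signs) \csum_(e2 <- signs) \csum_(e3 <- signs)
  \csum_(0 <= j1 < K) \csum_(0 <= j2 < K) \csum_(0 <= j3 < K)
    (Y e1 e2 e3 * (w j1 j2 j3 * (D e1 j1 (s + a) * D e2 j2 (s + b) * D e3 j3 (s + c))))).
  rewrite -csum_exchange3; apply: eq_bigr => j1 _; rewrite -csum_exchange3; apply: eq_bigr => j2 _.
  by rewrite -csum_exchange3.
apply: eq_bigr => e1 _; apply: eq_bigr => e2 _; apply: eq_bigr => e3 _.
rewrite (_ : RtoC (IZR (e1 * e2 * e3)) * _ = Y e1 e2 e3); last first.
  rewrite /Y /X !mult_IZR !RtoC_mult !Cmult_plus_distr_l !Cexp_add; ring.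
rewrite /dual_sum csum_mull; apply: eq_bigr => j1 _; rewrite csum_mull; apply: eq_bigr => j2 _.
by rewrite csum_mull.
Qed.

Lemma cres_sign_res K x j n : (0 < K)%N -> x = 1%Z \/ x = (-1)%Z ->
  cres K (sign_res K (- x) * j) n = if (j == sign_res K (- x) * n %[mod K])%N then RtoC 1 else 0.
Proof.
move=> hK hx; rewrite /cres; congr (if _ then _ else _).
have h := sign_res_sq (- x) hK; set E := sign_res K (- x) in h *.
have key u v : (u = E * v %[mod K])%N -> (v = E * u %[mod K])%N.
  by move=> hu; rewrite -modnMmr hu modnMmr mulnA -modnMml h modnMml mul1n.
by apply/eqP/eqP; exact: key.
Qed.

(** For each of the three indices [j], the condition that [n] lies in the class of [-e j]
    modulo [K] is the condition that [j] lies in the class of [-e n], so the sum over [j]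
    has one term. *)
Lemma dual_sum_series K h e1 e2 e3 a b c s : (0 < K)%N ->
  e1 = 1%Z \/ e1 = (-1)%Z -> e2 = 1%Z \/ e2 = (-1)%Z -> e3 = 1%Z \/ e3 = (-1)%Z ->
  (Re (s + a) < 0)%R -> (Re (s + b) < 0)%R -> (Re (s + c) < 0)%R ->
  Csum (dterm (tcoef (fun x y z => csum3 K h (sign_res K e1 * x) (sign_res K e2 * y) (sign_res K e3 * z) *
                                   pw3 (- a) (- b) (- c) x y z)) (1 - s))
       (dual_sum K h e1 e2 e3 a b c s).
Proof.
move=> hK h1 h2 h3 ha hb hc.
pose G j1 j2 j3 x y z := cres K (sign_res K (- e1) * j1) x * cres K (sign_res K (- e2) * j2) y *
  cres K (sign_res K (- e3) * j3) z * pw3 (- a) (- b) (- c) x y z.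
pose w j1 j2 j3 := csum3 K h (K.-1 * j1) (K.-1 * j2) (K.-1 * j3).
have H : Csum (fun n => \csum_(0 <= j1 < K) \csum_(0 <= j2 < K) \csum_(0 <= j3 < K)
    (w j1 j2 j3 * dterm (tcoef (G j1 j2 j3)) (1 - s) n)) (dual_sum K h e1 e2 e3 a b c s).
  apply: Csum_csum => j1 _; apply: Csum_csum => j2 _; apply: Csum_csum => j3 _.
  have E x : 1 - (s + x) = 1 - s + - x by ring.
  have R x : (Re (s + x) < 0)%R -> (1 < Re (1 - s + - x))%R.
    by rewrite -E; case: (s) => ? ?; case: x => ? ? /=; lra.
  apply: Csum_scal; rewrite !E; apply: dser_triple; try exact: R; move=> n; exact: cres_le1.
apply: Csum_ext H => n; rewrite dterm_tcoef_csum /dterm; congr Cmult.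
apply: tcoef_ext => x y z _ _ _ _.
pose H j1 j2 j3 := w j1 j2 j3 * pw3 (- a) (- b) (- c) x y z.
transitivity (\csum_(0 <= j1 < K) (if (j1 == sign_res K (- e1) * x %[mod K])%N then
  \csum_(0 <= j2 < K) (if (j2 == sign_res K (- e2) * y %[mod K])%N then
  \csum_(0 <= j3 < K) (if (j3 == sign_res K (- e3) * z %[mod K])%N then H j1 j2 j3 else 0) else 0) else 0)).
  apply: eq_bigr => j1 _; rewrite -csum_if; apply: eq_bigr => j2 _; rewrite -!csum_if; apply: eq_bigr => j3 _.
  rewrite /G !cres_sign_res // /H; do 3 (case: ifP => _); ring.
rewrite csum_residue // csum_residue // csum_residue // /H /w; congr Cmult.
by apply: csum3_mod => //; rewrite modnMmr sign_res_opp.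
Qed.

Lemma csum_unit K E (F : nat -> C) : (0 < K)%N -> (E * E = 1 %[mod K])%N ->
  (forall u v, (u = v %[mod K])%N -> F u = F v) ->
  \csum_(0 <= x < K) F (E * x)%N = \csum_(0 <= x < K) F x.
Proof.
move=> hK hE hF.
transitivity (\csum_(0 <= x < K) \csum_(0 <= y < K) (if (y == E * x %[mod K])%N then F y else 0)).
  by apply: eq_bigr => x _; rewrite csum_residue //; apply: hF; rewrite modn_mod.
rewrite exchange_big; apply: eq_big_nat => y /andP [_ hy] /=.
transitivity (\csum_(0 <= x < K) (if (x == E * y %[mod K])%N then F y else 0)).
  have key u v : (u = E * v %[mod K])%N -> (v = E * u %[mod K])%N.
    by move=> hu; rewrite -modnMmr hu modnMmr mulnA -modnMml hE modnMml mul1n.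
  by apply: eq_bigr => x _; congr (if _ then _ else _); apply/eqP/eqP; exact: key.
by rewrite csum_residue.
Qed.

(** Substituting [E x] for [x]. *)
Lemma csum3_unit K h E l m n : (0 < K)%N -> (E * E = 1 %[mod K])%N ->
  csum3 K h (E * l) m n = csum3 K (h * E) l m n.
Proof.
move=> hK hE; rewrite /csum3.
rewrite -(csum_unit (F := fun x => \csum_(0 <= y < K) \csum_(0 <= z < K) om K (h * x * y * z + E * l * x + m * y + n * z)) hK hE).
  apply: eq_bigr => x _; apply: eq_bigr => y _; apply: eq_bigr => z _.
  apply: om_eqmod => //.
  have -> : (h * (E * x) * y * z + E * l * (E * x) + m * y + n * z = (h * E * x * y * z + m * y + n * z) + E * E * (l * x))%N by lia.
  by rewrite -modnDmr -modnMml hE modnMml mul1n modnDmr; congr modn; lia.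
move=> u v huv; apply: eq_bigr => y _; apply: eq_bigr => z _.
have X t : (h * t * y * z + E * l * t + m * y + n * z = t * (h * y * z + E * l) + (m * y + n * z))%N by lia.
by rewrite !X !om_add; congr Cmult; apply: om_eqmod => //; rewrite -modnMml huv modnMml.
Qed.

Lemma csum3_rot K h l m n : csum3 K h l m n = csum3 K h m n l.
Proof.
rewrite /csum3 exchange_big; apply: eq_bigr => y _.
rewrite exchange_big; apply: eq_bigr => z _; apply: eq_bigr => x _; congr om; lia.
Qed.

Lemma csum3_units K h E1 E2 E3 l m n : (0 < K)%N -> (E1 * E1 = 1 %[mod K])%N ->
  (E2 * E2 = 1 %[mod K])%N -> (E3 * E3 = 1 %[mod K])%N ->
  csum3 K h (E1 * l) (E2 * m) (E3 * n) = csum3 K (h * E1 * E2 * E3) l m n.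
Proof.
move=> hK h1 h2 h3.
by rewrite csum3_unit // csum3_rot csum3_unit // csum3_rot csum3_unit // csum3_rot.
Qed.
(** * The dual side as a combination of Estermann functions *)

Lemma Csum_dilate M (f : nat -> C) l : (0 < M)%N -> Csum f l ->
  Csum (fun j => if (M %| j)%N then f (j %/ M)%N else 0) l.
Proof.
move=> hM /Clim_eps h; apply/Clim_eps => eps he; have [N0 h0] := h eps he.
exists (N0 * M)%N => n hn.
have E q r : (r <= M)%N -> (0 < r)%N ->
    \csum_(0 <= k < q * M + r) (if (M %| k)%N then f (k %/ M)%N else 0) = \csum_(0 <= k < q.+1) f k.
  move=> hr r0; transitivity (\csum_(0 <= k < q.+1 * M) (if (M %| k)%N then f (k %/ M)%N else 0)); last first.
    by rewrite csum_multiples //; apply: eq_bigr => k _; rewrite mulnK.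
  rewrite [RHS](@big_cat_nat _ _ _ (q * M + r)) //=; last by rewrite mulSn; lia.
  rewrite [X in _ = _ + X]big_nat [X in _ = _ + X]big1 ?Cplus_0_r // => k /andP [k1 k2].
  case: ifP => // /dvdnP [t ht]; move: k1 k2; rewrite ht ltn_pmul2r // => k1 k2.
  have : (q * M < t * M)%N by lia.
  by rewrite ltn_pmul2r //; lia.
case: (posnP (n %% M)) => hr.
  have En : n = (n %/ M * M)%N by rewrite {1}(divn_eq n M) hr addn0.
  have hq : (N0 <= n %/ M)%N by rewrite leq_divRL.
  have -> : \csum_(0 <= k < n) (if (M %| k)%N then f (k %/ M)%N else 0) = \csum_(0 <= k < n %/ M) f k.
    by rewrite {1}En csum_multiples //; apply: eq_bigr => k _; rewrite mulnK.
  exact: h0.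
rewrite {1}(divn_eq n M) E //; last by apply: ltnW; rewrite ltn_mod.
apply: h0; apply: leqW; by rewrite leq_divRL.
Qed.

Lemma dterm_dilate M c S l : (0 < M)%N -> Csum (dterm c S) l ->
  Csum (dterm (fun n => if (M %| n)%N then c (n %/ M)%N else 0) S) (ncpow M (- S) * l).
Proof.
move=> hM h; pose g n := if n == 0%N then RtoC 0 else c n * ncpow n (- S).
have hg : Csum g l by apply: Csum_shift0 => //.
have := Csum_scal (ncpow M (- S)) (Csum_dilate hM hg).
set u := fun n => _; move=> hu.
have h2 : Csum (fun n => u n.+1) (ncpow M (- S) * l).
  by apply/Csum_shift; rewrite {2}/u dvdn0 div0n /g /= Cmult_0_r Cplus_0_l.
apply: Csum_ext h2 => n; rewrite /u /dterm; case: ifP => hd; last by ring.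
have q0 : (0 < n.+1 %/ M)%N by rewrite divn_gt0 // dvdn_leq.
rewrite /g (_ : (n.+1 %/ M == 0)%N = false); last by lia.
rewrite -[in ncpow n.+1 _](divnK hd) ncpow_mul //; ring.
Qed.

(** The Kloosterman sum behind the sum over [a] in the functional equation. Its frequency
    is congruent to [R h N] modulo [q] because [q] divides [K]. *)
Lemma kloosterman_zres K h P R q N : (0 < q)%N -> (q %| K)%N -> zcong K (Z.of_nat R) P ->
  \csum_(1 <= a < q.+1 | coprime a q)
     (e (INR (inv_mod a q) / INR q) * om q (zres (P * Z.of_nat h * Z.of_nat a) q * N)) =
  hyp q 1 1 (R * (h * N)).
Proof.
move=> hq hd hR; rewrite kloosterman_form //; apply: eq_bigr => a _; congr Cmult.
apply: om_eqmod => //; apply: zcong_modn; rewrite -!multE !Nat2Z.inj_mul.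
have [u hu] := zcong_mul (zres_cong (P * Z.of_nat h * Z.of_nat a) hq) (zcong_refl q (Z.of_nat N)).
have [v hv] := zcong_dvd hd hR.
exists (u - v * (Z.of_nat h * Z.of_nat N * Z.of_nat a))%Z; rewrite hu hv; ring.
Qed.

(** The contribution of [d] to the functional equation, with [P] standing for
    [- e1 e2 e3 Hbar]. *)
Definition divisor_term (K : nat) (P : Z) (al be ga s : C) (d : nat) : C :=
  / ncpow d (1 - 2 * s) *
  \csum_(h <- divisors d)
    (muC h * tau (- be - ga) (- al - ga) (- al - be) (d %/ h)%N / ncpow h (1 - s - al - be - ga) *
     \csum_(1 <= a < (K %/ d).+1 | coprime a (K %/ d))
       (e (INR (inv_mod a (K %/ d)) / INR (K %/ d)) *
        Estermann (- al) (- be) (- ga) (1 - s) (frac (P * Z.of_nat h * Z.of_nat a) (K %/ d)))).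

(** [coef_identity] read as an identity of Dirichlet series: a coefficient supported on
    the multiples of [d^2 h] contributes a factor [(d^2 h)^(s-1)], and together with the
    factors [d] and [h^(al+be+ga)] this gives the powers of [d] and [h] in [divisor_term]. *)
Lemma divisor_term_series K P R al be ga s : (0 < K)%N -> zcong K (Z.of_nat R) P -> coprime K R ->
  (forall d h a, (d < K.+1)%N -> (h < K.+1)%N -> (a < K.+1)%N -> (0 < K %/ d)%N ->
    Csum (dterm (fun n => om (K %/ d) (zres (P * Z.of_nat h * Z.of_nat a) (K %/ d) * n) *
                          tau (- al) (- be) (- ga) n) (1 - s))
         (Estermann (- al) (- be) (- ga) (1 - s) (frac (P * Z.of_nat h * Z.of_nat a) (K %/ d)))) ->
  Csum (dterm (tcoef (fun l m n => pw3 (- al) (- be) (- ga) l m n * hyp K (R * l) m n)) (1 - s))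
       (\csum_(d <- divisors K) divisor_term K P al be ga s d).
Proof.
move=> hK hR co hE.
pose T h d := tau (- be - ga) (- al - ga) (- al - be) (d %/ h)%N.
pose t := tau (- al) (- be) (- ga).
pose B d h n := \csum_(1 <= a < (K %/ d).+1 | coprime a (K %/ d))
   (e (INR (inv_mod a (K %/ d)) / INR (K %/ d)) *
     (om (K %/ d) (zres (P * Z.of_nat h * Z.of_nat a) (K %/ d) * n) * t n)).
have H : Csum (fun n => \csum_(d <- divisors K) (/ ncpow d (1 - 2 * s) * \csum_(h <- divisors d)
    (muC h * T h d / ncpow h (1 - s - al - be - ga) *
     (ncpow (d * d * h) (1 - s) * dterm (fun N => if (d * d * h %| N)%N then B d h (N %/ (d * d * h))%N else 0) (1 - s) n))))
    (\csum_(d <- divisors K) divisor_term K P al be ga s d).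
  rewrite big_seq; apply: Csum_ext; first by move=> n; symmetry; rewrite big_seq.
  apply: Csum_csum => d; rewrite -dvdn_divisors // => hd.
  have d0 : (0 < d)%N by case: d hd => //; rewrite dvd0n; lia.
  have dK := dvdn_leq hK hd.
  have q0 : (0 < K %/ d)%N by rewrite divn_gt0.
  apply: Csum_scal; rewrite big_seq; apply: Csum_ext; first by move=> n; symmetry; rewrite big_seq.
  apply: Csum_csum => h; rewrite -dvdn_divisors // => hh.
  have h0 : (0 < h)%N by case: h hh => //; rewrite dvd0n; lia.
  have hdle := dvdn_leq d0 hh.
  apply: Csum_scal.
  have M0 : (0 < d * d * h)%N by rewrite !muln_gt0 d0 h0.
  set F := \csum_(1 <= a < _ | _) _.
  (* compensates the factor produced by the dilation *)
  have -> : F = ncpow (d * d * h) (1 - s) * (ncpow (d * d * h) (- (1 - s)) * F).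
    by rewrite Cmult_assoc -ncpow_add (_ : 1 - s + - (1 - s) = 0) ?ncpow_0; ring.
  apply: Csum_scal; apply: dterm_dilate => //; rewrite /F big_nat_cond.
  apply: (Csum_ext (a := fun n => \csum_(1 <= a < (K %/ d).+1 | coprime a (K %/ d))
   (e (INR (inv_mod a (K %/ d)) / INR (K %/ d)) *
     dterm (fun n => om (K %/ d) (zres (P * Z.of_nat h * Z.of_nat a) (K %/ d) * n) * t n) (1 - s) n))).
    by move=> n; rewrite /dterm /B csum_mulr; apply: eq_bigr => a _; rewrite !Cmult_assoc.
  apply: Csum_ext; first by move=> n; rewrite [RHS]big_nat_cond.
  apply: Csum_csum => a /andP [/andP [a1 a2] _]; apply: Csum_scal; apply: hE => //; first by lia.
  by apply: leq_trans a2 _; rewrite ltnS leq_div.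
apply: Csum_ext H => n; rewrite /dterm coef_identity // csum_mulr big_seq [RHS]big_seq.
apply: eq_bigr => d; rewrite -dvdn_divisors // => hd.
have d0 : (0 < d)%N by case: d hd => //; rewrite dvd0n; lia.
have q0 : (0 < K %/ d)%N by rewrite divn_gt0 //; exact: dvdn_leq.
rewrite -Cmult_assoc csum_mulr.
rewrite (_ : / ncpow d (1 - 2 * s) = RtoC (INR d) * ncpow d (- (1 - s)) * ncpow d (- (1 - s))); last first.
  by rewrite -ncpow_opp -[in RtoC (INR d)](ncpow_1 d0) -!ncpow_add; congr ncpow; ring.
rewrite -!(Cmult_assoc (RtoC (INR d))); congr Cmult; rewrite !csum_mull big_seq [RHS]big_seq; apply: eq_bigr => h.
rewrite -dvdn_divisors // => hh.
have h0 : (0 < h)%N by case: h hh => //; rewrite dvd0n; lia.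
rewrite !ncpow_mul ?muln_gt0 ?d0 //.
case: (boolP (d * d * h %| n.+1)%N) => hN; last by ring.
set N := (n.+1 %/ _)%N.
have -> : B d h N = hyp (K %/ d) 1 1 (R * (h * N)) * t N.
  rewrite -(kloosterman_zres h N q0 (dvdn_div hd) hR) csum_mulr.
  by apply: eq_bigr => a _; rewrite Cmult_assoc.
rewrite -!tauE -/t /Cdiv.
rewrite (_ : / ncpow h (1 - s - al - be - ga) = ncpow h (- (- al + - be + - ga)) * ncpow h (- (1 - s))); last first.
  by rewrite -ncpow_opp -ncpow_add; congr ncpow; ring.
have E x : ncpow x (- (1 - s)) * ncpow x (1 - s) = 1.
  by rewrite -ncpow_add (_ : - (1 - s) + (1 - s) = 0) ?ncpow_0; ring.
rewrite /T.
transitivity ((ncpow d (- (1 - s)) * ncpow d (1 - s)) * (ncpow d (- (1 - s)) * ncpow d (1 - s)) *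
   (ncpow h (- (1 - s)) * ncpow h (1 - s)) * (muC h * (ncpow h (- (- al + - be + - ga)) *
   tau (- be - ga) (- al - ga) (- al - be) (d %/ h) * t N * hyp (K %/ d) 1 1 (R * (h * N))) * ncpow n.+1 (- (1 - s)))).
  rewrite /Cdiv; ring.
by rewrite !E /Cminus !Cmult_1_l.
Qed.
Lemma zcong_dvdn K n : zcong K (Z.of_nat n) 0 -> (K %| n)%N.
Proof. by move=> h; rewrite /dvdn (zcong_modn (n := 0) h) mod0n. Qed.

Lemma zcong_add1 K x y : zcong K x y -> zcong K (x + 1) (y + 1).
Proof. by move=> [u ->]; exists u; ring. Qed.

Lemma zcong_trans K x y z : zcong K x y -> zcong K y z -> zcong K x z.
Proof. by move=> [u ->] [v ->]; exists (u + v)%Z; ring. Qed.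

Lemma sign_inverse K H Hbar e1 e2 e3 : (0 < K)%N ->
  ((Hbar * H) mod Z.of_nat K = 1 mod Z.of_nat K)%Z ->
  e1 = 1%Z \/ e1 = (-1)%Z -> e2 = 1%Z \/ e2 = (-1)%Z -> e3 = 1%Z \/ e3 = (-1)%Z ->
  (K %| zres (- (e1 * e2 * e3) * Hbar) K * (zres H K * sign_res K e1 * sign_res K e2 * sign_res K e3) + 1)%N.
Proof.
move=> hK hH h1 h2 h3.
have hHb : zcong K (Hbar * H) 1.
  exists (Hbar * H / Z.of_nat K - 1 / Z.of_nat K)%Z.
  have := Z_div_mod_eq_full (Hbar * H) (Z.of_nat K); have := Z_div_mod_eq_full 1 (Z.of_nat K).
  by rewrite hH; lia.
apply: zcong_dvdn; rewrite -plusE -!multE Nat2Z.inj_add !Nat2Z.inj_mul.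
rewrite (_ : 0%Z = (-1 + 1)%Z) //; apply: zcong_add1.
apply: zcong_trans (zcong_mul (zres_cong _ hK) (zcong_mul (zcong_mul (zcong_mul (zres_cong H hK) (sign_res_cong hK h1)) (sign_res_cong hK h2)) (sign_res_cong hK h3))) _.
apply: (@zcong_trans _ _ (-1 * (Hbar * H))%Z); last exact: (zcong_mul (zcong_refl K (-1)) hHb).
rewrite (_ : - (e1 * e2 * e3) * Hbar * (H * e1 * e2 * e3) = -1 * (Hbar * H))%Z; first exact: zcong_refl.
by case: h1 => ->; case: h2 => ->; case: h3 => ->; ring.
Qed.

Lemma dual_sum_divisors K H Hbar e1 e2 e3 al be ga s : (0 < K)%N ->
  ((Hbar * H) mod Z.of_nat K = 1 mod Z.of_nat K)%Z ->
  e1 = 1%Z \/ e1 = (-1)%Z -> e2 = 1%Z \/ e2 = (-1)%Z -> e3 = 1%Z \/ e3 = (-1)%Z ->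
  (Re (s + al) < 0)%R -> (Re (s + be) < 0)%R -> (Re (s + ga) < 0)%R ->
  (forall d h a, (d < K.+1)%N -> (h < K.+1)%N -> (a < K.+1)%N -> (0 < K %/ d)%N ->
    Csum (dterm (fun n => om (K %/ d) (zres (- (e1 * e2 * e3) * Hbar * Z.of_nat h * Z.of_nat a) (K %/ d) * n) *
                          tau (- al) (- be) (- ga) n) (1 - s))
         (Estermann (- al) (- be) (- ga) (1 - s) (frac (- (e1 * e2 * e3) * Hbar * Z.of_nat h * Z.of_nat a) (K %/ d)))) ->
  dual_sum K (zres H K) e1 e2 e3 al be ga s =
  RtoC (INR K) * \csum_(d <- divisors K) divisor_term K (- (e1 * e2 * e3) * Hbar) al be ga s d.
Proof.
move=> hK hH h1 h2 h3 ha hb hc hE.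
have hR := sign_inverse hK hH h1 h2 h3; set R := zres _ K in hR.
have co := neg_inv_coprime hK hR.
have hS := divisor_term_series hK (zres_cong _ hK) co hE.
apply: Csum_uniq (dual_sum_series (zres H K) hK h1 h2 h3 ha hb hc) _.
apply: Csum_ext (Csum_scal (RtoC (INR K)) hS) => n; rewrite /dterm Cmult_assoc; congr Cmult.
rewrite tcoef_scal; apply: tcoef_ext => x y z _ _ _ _.
rewrite csum3_units; try exact: sign_res_sq; last by [].
by rewrite (csum3_hyp _ _ _ hK hR) -/R; ring.
Qed.

(** * Identities far to the left *)

(** Each Estermann function is known to equal its series only to the right of some
    abscissa that depends on the function; finitely many of them are dealt with by
    moving far enough to the left. *)
Definition far_left (P : C -> Prop) := exists T : R, forall s, (Re s < T)%R -> P s.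

Lemma far_left_and P Q : far_left P -> far_left Q -> far_left (fun s => P s /\ Q s).
Proof.
move=> [t ht] [u hu]; exists (Rmin t u) => s hs.
have := Rmin_l t u; have := Rmin_r t u => *; split; [apply: ht | apply: hu]; lra.
Qed.

Lemma far_left_imp (P Q : C -> Prop) : (forall s, P s -> Q s) -> far_left P -> far_left Q.
Proof. by move=> h [t ht]; exists t => s /ht; exact: h. Qed.

Lemma far_left_all n (P : nat -> C -> Prop) : (forall i, far_left (P i)) ->
  far_left (fun s => forall i, (i < n)%N -> P i s).
Proof.
move=> hP; elim: n => [|n IH]; first by exists 0%R.
apply: far_left_imp (far_left_and IH (hP n)) => s [h1 h2] i.
by rewrite ltnS leq_eqVlt => /orP [/eqP ->|]; auto.
Qed.

Lemma far_left_signs (F G : Z -> C -> C) :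
  (forall x, x = 1%Z \/ x = (-1)%Z -> far_left (fun s => F x s = G x s)) ->
  far_left (fun s => \csum_(x <- signs) F x s = \csum_(x <- signs) G x s).
Proof.
move=> h; have h1 := h 1%Z (or_introl erefl); have h2 := h (-1)%Z (or_intror erefl).
apply: far_left_imp (far_left_and h1 h2) => s [e1 e2]; by rewrite /signs !big_cons !big_nil e1 e2.
Qed.

Lemma far_left_neg (a b c : C) : far_left (fun s => (Re (s + a) < 0)%R /\ (Re (s + b) < 0)%R /\ (Re (s + c) < 0)%R).
Proof.
have [sg h] := half_plane3 (- a) (- b) (- c); exists (- sg)%R => s hs.
have [|h1 [h2 h3]] := h (- s); first by move: hs; case: (s) => ? ? /=; lra.
have E x : (1 < Re (- s + - x))%R -> (Re (s + x) < 0)%R by case: (s) => ? ?; case: x => ? ? /=; lra.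
by split; [|split]; exact: E.
Qed.

Lemma far_left_series al be ga P K : (0 < K)%N ->
  far_left (fun s => Csum (dterm (fun n => om K (zres P K * n) * tau al be ga n) (1 - s))
                     (Estermann al be ga (1 - s) (frac P K))).
Proof.
move=> hK; have [sg h] := Estermann_series al be ga P hK; exists (1 - sg)%R => s hs.
by apply: h; move: hs; case: (s) => ? ? /=; lra.
Qed.

Lemma far_left_dual K H Hbar e1 e2 e3 al be ga : (0 < K)%N ->
  ((Hbar * H) mod Z.of_nat K = 1 mod Z.of_nat K)%Z ->
  e1 = 1%Z \/ e1 = (-1)%Z -> e2 = 1%Z \/ e2 = (-1)%Z -> e3 = 1%Z \/ e3 = (-1)%Z ->
  far_left (fun s => dual_sum K (zres H K) e1 e2 e3 al be ga s =
    RtoC (INR K) * \csum_(d <- divisors K) divisor_term K (- (e1 * e2 * e3) * Hbar) al be ga s d).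
Proof.
move=> hK hH h1 h2 h3.
set P := (- (e1 * e2 * e3) * Hbar)%Z.
have hE : far_left (fun s => forall d, (d < K.+1)%N -> forall h, (h < K.+1)%N -> forall a, (a < K.+1)%N -> (0 < K %/ d)%N ->
    Csum (dterm (fun n => om (K %/ d) (zres (P * Z.of_nat h * Z.of_nat a) (K %/ d) * n) *
                          tau (- al) (- be) (- ga) n) (1 - s))
         (Estermann (- al) (- be) (- ga) (1 - s) (frac (P * Z.of_nat h * Z.of_nat a) (K %/ d)))).
  apply: far_left_all => d; apply: far_left_all => h; apply: far_left_all => a.
  case: (posnP (K %/ d)) => [->|q0]; first by exists 0%R.
  by apply: far_left_imp (far_left_series (- al) (- be) (- ga) (P * Z.of_nat h * Z.of_nat a) q0).
apply: far_left_imp (far_left_and hE (far_left_neg al be ga)) => s [hs [ha [hb hc]]].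
by apply: dual_sum_divisors => // d h a hd hh hha; exact: hs.
Qed.

Lemma ana_ncpow n (f : C -> C) z0 : ana f z0 -> ana (fun s => ncpow n (f s)) z0.
Proof. by move=> hf; apply: ana_exp; apply: ana_mul hf (ana_const _ _). Qed.

Lemma divisor_term_wm K P al be ga d s0 : (0 < K)%N -> d \in divisors K -> wm (fun s => divisor_term K P al be ga s d) s0.
Proof.
move=> hK; rewrite -dvdn_divisors // => hd.
have q0 : (0 < K %/ d)%N by rewrite divn_gt0; [exact: dvdn_leq | case: d hd => //; rewrite dvd0n; lia].
apply: wm_mul.
  apply: ana_wm; apply: ana_inv; first exact: ncpow_neq0.
  by apply: ana_ncpow; apply: ana_sub (ana_const _ _) (ana_mul (ana_const _ _) (ana_id _)).
apply: wm_csum => h; apply: wm_mul.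
  apply: wm_mul; first exact: wm_const.
  apply: ana_wm; apply: ana_inv; first exact: ncpow_neq0.
  by apply: ana_ncpow; do 3 (apply: ana_sub (ana_const _ _)); apply: ana_sub (ana_const _ _) (ana_id _).
apply: wm_csum => a; apply: wm_mul; first exact: wm_const.
exact: (affine_1s (f := fun s => Estermann (- al) (- be) (- ga) s _) (Estermann_wm _ _ _ _ _ q0)).
Qed.

Definition dual_side (H Hbar : Z) (K : nat) (al be ga s : C) : C :=
  ncpow K (1 - 3 * s - al - be - ga) * calG3 al be ga s *
  \csum_(e1 <- signs) \csum_(e2 <- signs) \csum_(e3 <- signs)
    (RtoC (IZR (e1 * e2 * e3)) *
     Cexp (RtoC PI / 2 * Ci * (RtoC (IZR e1) * (s + al) + RtoC (IZR e2) * (s + be) + RtoC (IZR e3) * (s + ga))) *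
     \csum_(d <- divisors K) divisor_term K (- (e1 * e2 * e3) * Hbar) al be ga s d).

Lemma dual_side_wm H Hbar K al be ga s0 : (0 < K)%N -> wm (dual_side H Hbar K al be ga) s0.
Proof.
move=> hK; apply: wm_mul.
  apply: wm_mul.
    apply: ana_wm; apply: ana_ncpow; do 3 (apply: ana_sub; last exact: ana_const).
    by apply: ana_sub (ana_const _ _) (ana_mul (ana_const _ _) (ana_id _)).
  by apply: wm_mul; [apply: wm_mul|]; apply: affine_add; exact: calG_wm.
apply: wm_csum => e1; apply: wm_csum => e2; apply: wm_csum => e3.
apply: wm_mul.
  apply: wm_mul; first exact: wm_const.
  apply: ana_wm; apply: ana_exp; apply: ana_mul; first exact: ana_const.
  have h x y : ana (fun s => RtoC (IZR x) * (s + y)) s0.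
    by apply: ana_mul; [exact: ana_const | exact: ana_add (ana_id _) (ana_const _ _)].
  by apply: ana_add; [apply: ana_add|].
apply: (wm_ext (f := fun s => \csum_(d <- divisors K)
   (if d \in divisors K then divisor_term K (- (e1 * e2 * e3) * Hbar) al be ga s d else 0))).
  by apply: punct_true => s; rewrite -big_mkcond -big_seq.
apply: wm_csum => d; case: (boolP (d \in divisors K)) => hd; last exact: wm_const.
exact: divisor_term_wm.
Qed.

Lemma far_left_dual_side K H Hbar A al be ga : (0 < K)%N -> (forall j, is_perz K j (A j)) ->
  ((Hbar * H) mod Z.of_nat K = 1 mod Z.of_nat K)%Z ->
  far_left (fun s => fourier_comb K (zres H K) A al be ga s = dual_side H Hbar K al be ga s).
Proof.
move=> hK hA hH.
pose X s e1 e2 e3 := RtoC (IZR (e1 * e2 * e3)) *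
     Cexp (RtoC PI / 2 * Ci * (RtoC (IZR e1) * (s + al) + RtoC (IZR e2) * (s + be) + RtoC (IZR e3) * (s + ga))).
pose V s e1 e2 e3 := RtoC (INR K) * \csum_(d <- divisors K) divisor_term K (- (e1 * e2 * e3) * Hbar) al be ga s d.
have hS : far_left (fun s => \csum_(e1 <- signs) \csum_(e2 <- signs) \csum_(e3 <- signs)
     (X s e1 e2 e3 * dual_sum K (zres H K) e1 e2 e3 al be ga s) =
   \csum_(e1 <- signs) \csum_(e2 <- signs) \csum_(e3 <- signs) (X s e1 e2 e3 * V s e1 e2 e3)).
  apply: far_left_signs => e1 h1; apply: far_left_signs => e2 h2; apply: far_left_signs => e3 h3.
  by apply: far_left_imp (far_left_dual al be ga hK hH h1 h2 h3) => s ->.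
apply: far_left_imp (far_left_and hS (far_left_neg al be ga)) => s [E [ha [hb hc]]].
rewrite fourier_comb_left // E.
have -> : \csum_(e1 <- signs) \csum_(e2 <- signs) \csum_(e3 <- signs) (X s e1 e2 e3 * V s e1 e2 e3) =
  RtoC (INR K) * \csum_(e1 <- signs) \csum_(e2 <- signs) \csum_(e3 <- signs)
    (X s e1 e2 e3 * \csum_(d <- divisors K) divisor_term K (- (e1 * e2 * e3) * Hbar) al be ga s d).
  rewrite csum_mull; apply: eq_bigr => e1 _; rewrite csum_mull; apply: eq_bigr => e2 _.
  by rewrite csum_mull; apply: eq_bigr => e3 _; rewrite /V; ring.
have K0 := @RtoC_INR_neq0 K hK.
by rewrite /dual_side Cmult_assoc; congr Cmult; field.
Qed.

Theorem proposition3p1 (al be ga : C) (H Hbar : Z) (K : nat) :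
  (1 <= K)%N ->
  Z.gcd H (Z.of_nat K) = 1%Z ->
  ((Hbar * H) mod Z.of_nat K = 1 mod Z.of_nat K)%Z ->
  mero_eq
    (fun s => Estermann al be ga s (frac H K))
    (fun s =>
       ncpow K (1 - 3 * s - al - be - ga) * calG3 al be ga s *
       \csum_(e1 <- signs) \csum_(e2 <- signs) \csum_(e3 <- signs)
         (RtoC (IZR (e1 * e2 * e3)) *
          Cexp (RtoC PI / 2 * Ci * (RtoC (IZR e1) * (s + al)
                                    + RtoC (IZR e2) * (s + be)
                                    + RtoC (IZR e3) * (s + ga))) *
          \csum_(d <- divisors K)
            (/ ncpow d (1 - 2 * s) *
             \csum_(h <- divisors d)
               (RtoC (IZR (mu h))
                * tau (- be - ga) (- al - ga) (- al - be) (d %/ h)%N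
                / ncpow h (1 - s - al - be - ga) *
                \csum_(1 <= a < (K %/ d).+1 | coprime a (K %/ d))
                  (e (INR (inv_mod a (K %/ d)) / INR (K %/ d)) *
                   Estermann (- al) (- be) (- ga) (1 - s)
                     (frac (- (e1 * e2 * e3) * Hbar * Z.of_nat h * Z.of_nat a)
                           (K %/ d))))))).
Proof.
move=> hK _ hH; have [A hA] := perz_family hK.
have hL := Estermann_fourier_comb al be ga H hK hA.
have [T hT] := far_left_dual_side al be ga hK hA hH.
have hR : mero_eq (fourier_comb K (zres H K) A al be ga) (dual_side H Hbar K al be ga).
  apply: (wm_eq_identity (z1 := RtoC (T - 1))).
  - by move=> s; apply: fourier_comb_wm => j; exact: (proj1 (hA j)).
  - by move=> s; exact: dual_side_wm.
  apply: near_punct; apply: near_pt_imp (near_re_lt (a := T) _) => //=; lra.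
move=> z; apply/punct_locally.
have /punct_locally h1 := hL z; have /punct_locally h2 := hR z.
by apply: punct_imp (punct_and h1 h2) => s [-> ->].
Qed.
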